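(* Let $n\ge2$. There is a constant $C(n)$ depending only on $n$ such that the following holds. Let $K\ge1$ and let $f:\mathbb{B}^n\to\mathbb{B}^n$ be a $K$-quasiconformal mapping (a homeomorphism of $\mathbb{B}^n$ onto $\mathbb{B}^n$) fixing the origin. Then $f$ extends to a homeomorphism $\tilde f:\overline{\mathbb{B}}^n\to\overline{\mathbb{B}}^n$ such that $$|f(x)-\tilde f(\xi)|\le C(n)\,|x-\xi|^{\alpha/2},\qquad x\in\mathbb{B}^n,\ \xi\in\partial\mathbb{B}^n,$$ where $\alpha=1/K^{1/(n-1)}$.
   Context: $\mathbb{B}^n$ is the open unit ball in $\mathbb{R}^n$. For a curve family $\Gamma$ the conformal modulus is $\mathsf{M}(\Gamma)=\inf_\rho\int_{\mathbb{R}^n}\rho^n\,dm$ over Borel $\rho\ge0$ with $\int_\gamma\rho\,|dx|\ge1$ for every locally rectifiable $\gamma\in\Gamma$. A homeomorphism $f:G\to G'$ between domains in $\overline{\mathbb{R}}^n$ is $K$-quasiconformal if $K^{-1}\mathsf{M}(\Gamma)\le\mathsf{M}(f(\Gamma))\le K\,\mathsf{M}(\Gamma)$ for all curve families $\Gamma$ in $G$. *)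

(* Defs.v *)
From HB Require Import structures.
From mathcomp Require Import all_boot all_order all_algebra.
From mathcomp Require Import all_classical all_reals all_analysis.
From mathcomp Require Import measurable_realfun.

Set Implicit Arguments.
Unset Strict Implicit.
Unset Printing Implicit Defensive.

Import Order.TTheory GRing.Theory Num.Def Num.Theory.
Import numFieldNormedType.Exports.

Local Open Scope classical_set_scope.
Local Open Scope ring_scope.

(* The library's norm on 'rV[R]_n is the sup norm; it induces the same
   topology, but lengths, balls and distances below are Euclidean. *)
Definition enorm (R : realType) (n : nat) (x : 'rV[R]_n) : R :=
  Num.sqrt (\sum_(i < n) (x 0 i) ^+ 2).

Definition unit_ball (R : realType) (n : nat) : set 'rV[R]_n :=
  [set x | enorm x < 1].

Definition closed_unit_ball (R : realType) (n : nat) : set 'rV[R]_n :=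
  [set x | enorm x <= 1].

Definition unit_sphere (R : realType) (n : nat) : set 'rV[R]_n :=
  [set x | enorm x = 1].

Notation borelRn R n := (g_sigma_algebraType (@open 'rV[R]_n)).

Section cons_measure.
Context {R : realType} {n : nat}.
Variable m : {sigma_finite_measure set (n.-tuple R) -> \bar R}.

Definition tcons (p : R * n.-tuple R) : n.+1.-tuple R := [tuple of p.1 :: p.2].

Definition cons_measure : set (n.+1.-tuple R) -> \bar R :=
  pushforward (lebesgue_measure \x m)%E tcons.

Let mtcons : measurable_fun [set: R * n.-tuple R] tcons.
Proof. exact: measurable_cons. Qed.

Let cons_measure0 : cons_measure set0 = 0%E.
Proof. by rewrite /cons_measure /pushforward preimage_set0 measure0. Qed.

Let cons_measure_ge0 A : (0 <= cons_measure A)%E.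
Proof. exact: measure_ge0. Qed.

Let cons_measure_sigma_additive : semi_sigma_additive cons_measure.
Proof.
move=> F mF tF mUF; rewrite /cons_measure /pushforward preimage_bigcup.
have mpre B : measurable B -> measurable (tcons @^-1` B).
  by move=> mB; rewrite -[X in measurable X]setTI; exact: mtcons.
apply: measure_semi_sigma_additive.
- by move=> k; exact: mpre.
- apply/trivIsetP => i j _ _ ij; rewrite -preimage_setI.
  by move/trivIsetP : tF => /(_ _ _ _ _ ij) ->//; rewrite preimage_set0.
- by rewrite -preimage_bigcup; exact: mpre.
Qed.

HB.instance Definition _ := isMeasure.Build _ _ _ cons_measure
  cons_measure0 cons_measure_ge0 cons_measure_sigma_additive.

Let cons_measure_sigma_finite : sigma_finite setT cons_measure.
Proof.
have [F TF Foo] : exists2 F : nat -> set (R * n.-tuple R),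
    setT = \bigcup_k F k &
    forall k, measurable (F k) /\ ((lebesgue_measure \x m)%E (F k) < +oo)%E.
  have /sigma_finiteP[F [TF ndF Foo]] := sigma_finiteT (@lebesgue_measure R).
  have /sigma_finiteP[G [TG ndG Goo]] := sigma_finiteT m.
  exists (fun k => F k `*` G k).
    apply/esym; rewrite -subTset => -[x y] _.
    have [k _ Fkx] : (\bigcup_k F k) x by rewrite -TF.
    have [l _ Gly] : (\bigcup_k G k) y by rewrite -TG.
    exists (maxn k l) => //; split => /=.
      by move: x Fkx; exact/subsetPset/ndF/leq_maxl.
    by move: y Gly; exact/subsetPset/ndG/leq_maxr.
  move=> k; have [mF Fk] := Foo k; have [mG Gk] := Goo k.
  split; first exact: measurableX.
  by rewrite product_measure1E// lte_mul_pinfty// ge0_fin_numE.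
have mtuncons : measurable_fun [set: n.+1.-tuple R]
    (fun t => (thead t, [tuple of behead t]) : R * n.-tuple R).
  apply/measurable_fun_pairP; split => /=; last exact: measurable_behead.
  exact: measurable_tnth.
pose u (t : n.+1.-tuple R) := (thead t, [tuple of behead t]).
have uK (p : R * n.-tuple R) : u (tcons p) = p.
  case: p => a t; rewrite /u /tcons theadE; congr pair.
  by apply/val_inj.
exists (fun k => u @^-1` F k).
  by rewrite -preimage_bigcup -TF preimage_setT.
move=> k; have [mF Fk] := Foo k; split.
  by rewrite -[X in measurable X]setTI; exact: mtuncons.
rewrite /= /cons_measure /pushforward -comp_preimage.
by rewrite (_ : _ \o _ = id) ?preimage_id//; apply/funext => p /=.
Qed.

HB.instance Definition _ := Measure_isSigmaFinite.Build _ _ _ cons_measure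
  cons_measure_sigma_finite.

End cons_measure.

(* Lebesgue measure on R^n as the n-fold product of [lebesgue_measure]; it is
   transported to the Borel sets of 'rV[R]_n by [lebesgue_Rn] below. *)
Fixpoint lebesgue_tuple (R : realType) (n : nat) :
    {sigma_finite_measure set (n.-tuple R) -> \bar R} :=
  match n with
  | 0 => dirac [tuple]
  | n'.+1 => cons_measure (lebesgue_tuple R n')
  end.

Definition row_of_tuple (R : realType) (n : nat) (t : n.-tuple R) : borelRn R n :=
  \row_i tnth t i.

Section row_of_tuple_measurable.
Context {R : realType} {n : nat}.

Let box (p : 'rV[rat]_n * 'rV[rat]_n) : set (n.-tuple R) :=
  \bigcap_(i in [set: 'I_n])
    (fun t => tnth t i) @^-1` `]ratr (p.1 0 i), ratr (p.2 0 i)[.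

Let measurable_box p : measurable (box p).
Proof.
apply: fin_bigcap_measurable => [|i _]; first exact: finite_finset.
rewrite -[X in measurable X]setTI.
by apply: measurable_tnth => //; exact: measurable_itv.
Qed.

Lemma measurable_row_of_tuple :
  measurable_fun [set: n.-tuple R] (@row_of_tuple R n).
Proof.
apply: (@measurability _ _ _ (borelRn R n) _ _ (@open 'rV[R]_n)) => //.
move=> _ [U oU <-]; rewrite setTI.
rewrite (_ : _ @^-1` _ = \bigcup_p
    (if `[< box p `<=` @row_of_tuple R n @^-1` U >] then box p else set0)).
  apply: countable_bigcupT_measurable => // p.
  by case: ifP => // _; exact: measurable0.
apply/seteqP; split => [t Ut|t [p _]]; last first.
  by case: ifPn => // /asboolP; exact.
have /nbhs_ballP[e /= e0 eU] : nbhs (row_of_tuple t : 'rV[R]_n) U.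
  exact: open_nbhs_nbhs.
have /choice[l lP] i : exists q : rat, ratr q \in `](tnth t i - e), (tnth t i)[.
  by apply: rat_in_itvoo; rewrite ltrBlDr ltrDl.
have /choice[r rP] i : exists q : rat, ratr q \in `](tnth t i), (tnth t i + e)[.
  by apply: rat_in_itvoo; rewrite ltrDl.
exists (\row_i l i, \row_i r i) => //; case: ifPn => [_ i _|/asboolP[]] /=.
  have := lP i; have := rP i.
  by rewrite !in_itv /= !mxE => /andP[-> _] /andP[_ ->].
move=> u ubox; apply: eU; split => // k i; rewrite ord1 !mxE.
have := ubox i I; have := lP i; have := rP i.
rewrite /= !in_itv /= !mxE => /andP[_ re] /andP[le _] /andP[lu ur].
rewrite /ball /= ltr_distlC; apply/andP; split.
  exact: lt_trans le lu.
exact: lt_trans ur re.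
Qed.

End row_of_tuple_measurable.

Section lebesgue_Rn.
Context (R : realType) (n : nat).

Definition lebesgue_Rn : set (borelRn R n) -> \bar R :=
  pushforward (lebesgue_tuple R n) (@row_of_tuple R n).

Let mpre (B : set (borelRn R n)) :
  measurable B -> measurable (@row_of_tuple R n @^-1` B).
Proof.
by move=> mB; rewrite -[X in measurable X]setTI; exact: measurable_row_of_tuple.
Qed.

Let lebesgue_Rn0 : lebesgue_Rn set0 = 0%E.
Proof. by rewrite /lebesgue_Rn /pushforward preimage_set0 measure0. Qed.

Let lebesgue_Rn_ge0 A : (0 <= lebesgue_Rn A)%E.
Proof. by rewrite /lebesgue_Rn /pushforward measure_ge0. Qed.

Let lebesgue_Rn_sigma_additive : semi_sigma_additive lebesgue_Rn.
Proof.
move=> F mF tF mUF; rewrite /lebesgue_Rn /pushforward preimage_bigcup.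
apply: measure_semi_sigma_additive.
- by move=> k; exact: mpre.
- apply/trivIsetP => i j _ _ ij; rewrite -preimage_setI.
  by move/trivIsetP : tF => /(_ _ _ _ _ ij) ->//; rewrite preimage_set0.
- by rewrite -preimage_bigcup; exact: mpre.
Qed.

HB.instance Definition _ := isMeasure.Build _ _ _ lebesgue_Rn
  lebesgue_Rn0 lebesgue_Rn_ge0 lebesgue_Rn_sigma_additive.

End lebesgue_Rn.

(* A curve is a continuous map of an interval of R (open, closed or half-open,
   bounded or not); the values of [curve_map] off [curve_dom] are irrelevant. *)
Record curve (R : realType) (n : nat) := Curve {
  curve_dom : interval R;
  curve_map : R -> 'rV[R]_n }.

Section curves.
Context {R : realType} {n : nat}.
Implicit Types (g : curve R n) (a b : R) (rho : borelRn R n -> \bar R).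

Definition curve_in (G : set 'rV[R]_n) g : Prop :=
  let J := [set` curve_dom g] in
  [/\ J !=set0, {within J, continuous (curve_map g)} &
      curve_map g @` J `<=` G].

Definition curve_image (f : 'rV[R]_n -> 'rV[R]_n) g : curve R n :=
  Curve (curve_dom g) (f \o curve_map g).

(* length of g restricted to [a, b], for a <= b in the domain of g *)
Definition arc_length g a b : \bar R :=
  ereal_sup [set (\sum_(0 <= i < size s)
      enorm (curve_map g (nth b (a :: s) i.+1) -
             curve_map g (nth b (a :: s) i)))%:E | s in itv_partition a b].

Definition locally_rectifiable g : Prop :=
  forall a b, a \in curve_dom g -> b \in curve_dom g -> a <= b ->
    (arc_length g a b < +oo)%E.

(* Arc length parametrization of g restricted to [a, b]: the value at u is
   g t for any t in [a, b] such that g has length u on [a, t]. *)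
Definition arc_length_param g a b (u : R) : 'rV[R]_n :=
  curve_map g (xget a [set t | a <= t <= b /\ arc_length g a t = u%:E]).

Definition line_integral_seg rho g a b : \bar R :=
  (\int[lebesgue_measure]_(u in `[0%R, fine (arc_length g a b)])
     rho (arc_length_param g a b u))%E.

(* For a locally rectifiable curve the integral is the supremum of the
   integrals over its closed subcurves. *)
Definition line_integral rho g : \bar R :=
  ereal_sup [set x | exists a b, [/\ a \in curve_dom g, b \in curve_dom g,
    a <= b & x = line_integral_seg rho g a b]].

(* The densities may take the value +oo. *)
Definition admissible (Gam : set (curve R n)) : set (borelRn R n -> \bar R) :=
  [set rho : borelRn R n -> \bar R | [/\ measurable_fun [set: borelRn R n] rho,
    forall x, (0 <= rho x)%E &
    forall g, Gam g -> locally_rectifiable g -> (1 <= line_integral rho g)%E]].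

Definition modulus (Gam : set (curve R n)) : \bar R :=
  ereal_inf ((fun rho : borelRn R n -> \bar R =>
    \int[@lebesgue_Rn R n]_x (rho x ^+ n))%E @` admissible Gam).

Definition domain (G : set 'rV[R]_n) : Prop :=
  [/\ open G, connected G & G !=set0].

Definition homeomorphism_on (G G' : set 'rV[R]_n) (f : 'rV[R]_n -> 'rV[R]_n) :=
  [/\ set_bij G G' f, {within G, continuous f} &
      exists h, {in G, cancel f h} /\ {within G', continuous h}].

Definition quasiconformal (K : R) (G G' : set 'rV[R]_n)
    (f : 'rV[R]_n -> 'rV[R]_n) : Prop :=
  [/\ domain G, domain G', homeomorphism_on G G' f &
      forall Gam : set (curve R n), Gam `<=` curve_in G ->
        ((K^-1)%:E * modulus Gam <= modulus (curve_image f @` Gam))%E /\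
        (modulus (curve_image f @` Gam) <= K%:E * modulus Gam)%E].

End curves.

(* Main.v *)
(* Let xi lie on the sphere and let x, y be points of the ball within r = q^-M
   of xi. Curves of the ball that join the segment [x, y] to the ray from 0 to
   -xi must cross the ring r < |z - xi| < 1, of which only one half lies in the
   ball; hence their modulus is at most half of that of the ring, which is a
   constant times M^(1-n). Their images contain all polygons of the ball that
   join two paths, one issued from f x and of diameter at least |f x - f y|,
   the other from 0 and of diameter at least 1/2. If |f x - f y| >= q^-N, the
   modulus of these polygons is, up to a factor close to 1, at least that of a
   half ring, a constant times N^(1-n): the polygons run radially inside a cone
   based at f x, and the two links to the paths cost little once averaged over
   the points of the paths, because a segment integral averaged over such a
   family of starting points is dominated by the n-th power of the density.
   With quasiconformality this gives M^(n-1) <= 2 K N^(n-1), that is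
   |f x - f y| <= C r^(alpha/2). So f is uniformly continuous up to the sphere,
   the same holds for its inverse, and their extensions are inverse to each
   other by continuity. *)

Require Import Defs.
From HB Require Import structures.
From mathcomp Require Import all_boot all_order all_algebra.
From mathcomp Require Import all_classical all_reals all_analysis.
From mathcomp Require Import measurable_realfun.
From mathcomp Require Import ring lra.
Set Implicit Arguments.
Unset Strict Implicit.
Unset Printing Implicit Defensive.
Import Order.TTheory GRing.Theory Num.Def Num.Theory.
Import numFieldNormedType.Exports.
Local Open Scope classical_set_scope.
Local Open Scope ring_scope.

(** * The Euclidean norm *)

(** No polar coordinates occur. Both moduli are discretized into rings of ratio q, each a dilate of
    the shell 1 < |v| < q, whose volume [om] is never evaluated: it cancels between the two bounds.
    Cutting into rings, shrinking the half shell to a cone and adding the links together lose a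
    factor below 2, and this is what the exponent pays for: the loss is at most 2^(n-1), which turns
    alpha into alpha / 2. Since no sharp constant is sought, q, the cone and the cost of the links
    can be fixed by n alone, and so can C. The links shape the lower bound. Curves through a given
    point have modulus zero, so a density of small energy may have infinite integral over every
    segment issued from that point. A link must therefore start from a whole continuum of points,
    found at all distances s from the start of a path, and its cost is an average over s. *)

Lemma subr_subrr (V : zmodType) (x y z : V) : x - z - (y - z) = x - y.
Proof. by rewrite opprB addrA subrK. Qed.

Section enorm_theory.
Context {R : realType} {n : nat}.
Implicit Types (x y z : 'rV[R]_n) (c r : R).

Definition dotp x y : R := \sum_(i < n) x 0 i * y 0 i.

Lemma dotpC x y : dotp x y = dotp y x.
Proof. by apply: eq_bigr => i _; rewrite mulrC. Qed.

Lemma dotpDl x y z : dotp (x + y) z = dotp x z + dotp y z.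
Proof. by rewrite -big_split; apply: eq_bigr => i _; rewrite mxE mulrDl. Qed.

Lemma dotpZl c x y : dotp (c *: x) y = c * dotp x y.
Proof. by rewrite mulr_sumr; apply: eq_bigr => i _; rewrite mxE mulrA. Qed.

Lemma dotpDr x y z : dotp z (x + y) = dotp z x + dotp z y.
Proof. by rewrite !(dotpC z) dotpDl. Qed.

Lemma dotpZr c x y : dotp x (c *: y) = c * dotp x y.
Proof. by rewrite !(dotpC x) dotpZl. Qed.

Lemma dotpNl x y : dotp (- x) y = - dotp x y.
Proof. by rewrite -scaleN1r dotpZl mulN1r. Qed.

Lemma dotpNr x y : dotp x (- y) = - dotp x y.
Proof. by rewrite !(dotpC x) dotpNl. Qed.

Lemma dotp_ge0 x : 0 <= dotp x x.
Proof. by apply: sumr_ge0 => i _; rewrite -expr2 sqr_ge0. Qed.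

Lemma enormE x : enorm x = Num.sqrt (dotp x x).
Proof. by congr Num.sqrt; apply: eq_bigr => i _; rewrite expr2. Qed.

Lemma enorm_ge0 x : 0 <= enorm x.
Proof. exact: sqrtr_ge0. Qed.

Lemma sqr_enorm x : enorm x ^+ 2 = dotp x x.
Proof. by rewrite enormE sqr_sqrtr// dotp_ge0. Qed.

Lemma enorm_lt_sqr x r : 0 <= r -> (enorm x < r) = (dotp x x < r ^+ 2).
Proof.
by move=> r0; rewrite -sqr_enorm ltr_pXn2r// nnegrE// enorm_ge0.
Qed.

Lemma enorm_le_sqr x r : 0 <= r -> (enorm x <= r) = (dotp x x <= r ^+ 2).
Proof.
by move=> r0; rewrite -sqr_enorm ler_pXn2r// nnegrE// enorm_ge0.
Qed.

Lemma enormZ c x : enorm (c *: x) = `|c| * enorm x.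
Proof.
by rewrite !enormE dotpZl dotpZr mulrA -expr2 sqrtrM ?sqr_ge0// sqrtr_sqr.
Qed.

Lemma enorm0 : enorm (0 : 'rV[R]_n) = 0.
Proof. by rewrite -(scale0r 0) enormZ normr0 mul0r. Qed.

Lemma enormN x : enorm (- x) = enorm x.
Proof. by rewrite -scaleN1r enormZ normrN1 mul1r. Qed.

Lemma enormBC x y : enorm (x - y) = enorm (y - x).
Proof. by rewrite -opprB enormN. Qed.

Lemma coord_le_enorm x i : `|x 0 i| <= enorm x.
Proof.
rewrite -sqrtr_sqr ler_wsqrtr// (bigD1 i)//= lerDl.
by apply: sumr_ge0 => j _; exact: sqr_ge0.
Qed.

Lemma enorm_eq0 x : (enorm x == 0) = (x == 0).
Proof.
apply/eqP/eqP => [x0|->]; last exact: enorm0.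
apply/rowP => i; rewrite mxE; apply/eqP; rewrite -normr_le0 -x0.
exact: coord_le_enorm.
Qed.

Lemma enorm_gt0 x : (0 < enorm x) = (x != 0).
Proof. by rewrite lt_def enorm_ge0 andbT enorm_eq0. Qed.

Lemma dotp_le x y : dotp x y <= enorm x * enorm y.
Proof.
have [->|x0] := eqVneq x 0.
  rewrite enorm0 mul0r /dotp big1// => i _; by rewrite mxE mul0r.
have [->|y0] := eqVneq y 0.
  rewrite enorm0 mulr0 /dotp big1// => i _; by rewrite mxE mulr0.
have : 0 <= dotp (enorm y *: x - enorm x *: y) (enorm y *: x - enorm x *: y).
  exact: dotp_ge0.
rewrite !(dotpDl, dotpDr, dotpNl, dotpNr, dotpZl, dotpZr) -!sqr_enorm.
rewrite (dotpC y x) => h.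
have xy0 : 0 < 2 * enorm x * enorm y by rewrite !mulr_gt0// enorm_gt0.
rewrite -(ler_pM2l xy0) -subr_ge0.
by apply: le_trans h _; rewrite le_eqVlt; apply/orP; left; apply/eqP; ring.
Qed.

Lemma ler_enormD x y : enorm (x + y) <= enorm x + enorm y.
Proof.
rewrite enorm_le_sqr ?addr_ge0 ?enorm_ge0//.
rewrite !(dotpDl, dotpDr) (dotpC y x) -!sqr_enorm.
have := dotp_le x y; nra.
Qed.

Lemma ler_enormB x y : enorm (x - y) <= enorm x + enorm y.
Proof. by rewrite -(enormN y) ler_enormD. Qed.

Lemma ler_enorm_sub z x y : enorm (x - y) <= enorm (x - z) + enorm (z - y).
Proof. by have := ler_enormD (x - z) (z - y); rewrite addrA subrK. Qed.

Lemma ler_dist_enorm x y : `|enorm x - enorm y| <= enorm (x - y).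
Proof.
have h (u v : 'rV[R]_n) : enorm u - enorm v <= enorm (u - v).
  by rewrite lerBlDr; have := ler_enormD (u - v) v; rewrite subrK.
by rewrite ler_norml h andbT lerNl opprB (enormBC x) h.
Qed.

Lemma ler_enorm_center z x y : enorm (x - z) - enorm (y - z) <= enorm (x - y).
Proof.
rewrite -[x in leRHS](subrK z) -addrA -(opprB y z).
exact: le_trans (ler_norm _) (ler_dist_enorm _ _).
Qed.

Lemma normr_le_enorm x : `|x| <= enorm x.
Proof.
rewrite -[`|x|]/(mx_norm x) /mx_norm -[X in _ <= X]/((NngNum (enorm_ge0 x))%:num).
rewrite num_le; apply/bigmax_leP; split => [|[i j] _].
  by rewrite -num_le/= enorm_ge0.
by rewrite -num_le/= ord1 coord_le_enorm.
Qed.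

Lemma enorm_le_normr x : enorm x <= n%:R * `|x|.
Proof.
rewrite enorm_le_sqr ?mulr_ge0// /dotp.
apply: (@le_trans _ _ (\sum_(i < n) `|x| ^+ 2)).
  apply: ler_sum => i _; rewrite -expr2 -real_normK ?num_real//.
  rewrite lerXn2r ?nnegrE// [leRHS]/Num.Def.normr /= mx_normrE.
  exact: (le_bigmax _ (fun i => `|x i.1 i.2|) (0, i)).
rewrite sumr_const card_ord exprMn -[leLHS]mulr_natl; apply: ler_wpM2r.
  exact: sqr_ge0.
by rewrite expr2 -natrM ler_nat; case: (n) => // m; rewrite leq_pmulr.
Qed.

End enorm_theory.

Section enorm_topology.
Context {R : realType} {n : nat}.
Implicit Types (x y z : 'rV[R]_n) (e r : R).

Lemma enorm_nbhs x (A : set 'rV[R]_n) :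
  nbhs x A <-> exists2 e, 0 < e & forall y, enorm (x - y) < e -> A y.
Proof.
split => [/nbhs_ballP[e /= e0 eA]|[e e0 eA]].
  exists e => // y xy; apply: eA.
  by rewrite -ball_normE /=; exact: le_lt_trans (normr_le_enorm _) xy.
(* [n.+1] in place of [n] keeps the radius positive when n = 0. *)
apply/nbhs_ballP; exists (e / n.+1%:R) => /=; first by rewrite divr_gt0.
move=> y; rewrite -ball_normE /= => xy; apply: eA.
apply: le_lt_trans (enorm_le_normr _) _.
apply: (@le_lt_trans _ _ (n.+1%:R * `|x - y|)).
  by rewrite ler_wpM2r// ler_nat.
by rewrite mulrC -ltr_pdivlMr.
Qed.

Lemma cvg_enorm (T : Type) (F : set_system T) {FF : Filter F}
    (f : T -> 'rV[R]_n) x :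
  f @ F --> x <-> forall e, 0 < e -> \forall t \near F, enorm (x - f t) < e.
Proof.
split => [fx e e0|h].
  by apply: (fx [set y | enorm (x - y) < e]); apply/enorm_nbhs; exists e.
by move=> A /enorm_nbhs[e e0 eA]; apply: filterS (h e e0) => t; exact: eA.
Qed.

Lemma continuous_enorm : continuous (@enorm R n).
Proof.
move=> x A /nbhs_ballP[e /= e0 eA]; apply/enorm_nbhs; exists e => // y xy.
by apply: eA; rewrite -ball_normE /=; exact: le_lt_trans (ler_dist_enorm _ _) xy.
Qed.

Lemma within_continuous_enormP (D : set 'rV[R]_n) (f : 'rV[R]_n -> 'rV[R]_n) :
  {within D, continuous f} <->
  forall x, D x -> forall e, 0 < e -> exists2 d, 0 < d &
    forall y, D y -> enorm (x - y) < d -> enorm (f x - f y) < e.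
Proof.
rewrite subspace_continuousP; split => h x Dx.
  move=> e e0; move/cvg_enorm: (h x Dx) => /(_ e e0)/enorm_nbhs[d d0 H].
  by exists d => // y Dy xy; exact: H.
apply/cvg_enorm => e e0; have [d d0 H] := h x Dx e e0.
by apply/enorm_nbhs; exists d => // y xy Dy; exact: H.
Qed.

Lemma within_continuous_pathP (J : set R) (g : R -> 'rV[R]_n) :
  {within J, continuous g} <->
  forall t, J t -> forall e, 0 < e -> exists2 d, 0 < d &
    forall u, J u -> `|t - u| < d -> enorm (g t - g u) < e.
Proof.
rewrite subspace_continuousP; split => h x Dx.
  move=> e e0; move/cvg_enorm: (h x Dx) => /(_ e e0)/nbhs_ballP[d d0 H].
  by exists d => // y Dy xy; exact: H.
apply/cvg_enorm => e e0; have [d d0 H] := h x Dx e e0.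
by apply/nbhs_ballP; exists d => // y xy Dy; exact: H.
Qed.

End enorm_topology.

(** * Lebesgue measure on R^n *)

Section measurable_row.
Context {R : realType} {n : nat}.

(** The map factors through tuples, whose sigma-algebra is generated by the coordinates, followed by
    [row_of_tuple]. *)
Lemma measurable_rowP d (T : measurableType d) (f : T -> borelRn R n) :
  (forall i, measurable_fun [set: T] (fun t => (f t : 'rV[R]_n) 0 i)) ->
  measurable_fun [set: T] f.
Proof.
move=> mf.
rewrite (_ : f = @row_of_tuple R n \o (fun t => [tuple (f t : 'rV[R]_n) 0 i | i < n])).
  apply: measurableT_comp; first exact: measurable_row_of_tuple.
  apply/measurable_fun_tnthP => i.
  rewrite (_ : _ \o _ = fun t => (f t : 'rV[R]_n) 0 i)//.
  by apply/funext => t /=; rewrite tnth_mktuple.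
by apply/funext => t /=; apply/rowP => i; rewrite mxE tnth_mktuple.
Qed.

Lemma open_borelRn (U : set 'rV[R]_n) : open U -> measurable (U : set (borelRn R n)).
Proof. exact: sub_sigma_algebra. Qed.

Lemma continuous_borelRn (f : 'rV[R]_n -> R) : continuous f ->
  measurable_fun [set: borelRn R n] (f : borelRn R n -> R).
Proof.
move=> /continuousP cf; apply: (measurability _ (RGenOpens.measurableE R)).
move=> _ [_ [a [b ->] <-]]; rewrite setTI; apply: open_borelRn.
exact/cf/interval_open.
Qed.

Lemma measurable_coord i :
  measurable_fun [set: borelRn R n] (fun x : borelRn R n => (x : 'rV[R]_n) 0 i).
Proof. by apply: continuous_borelRn; exact: coord_continuous. Qed.

Lemma measurable_enorm : measurable_fun [set: borelRn R n] (@enorm R n).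
Proof. by apply: continuous_borelRn; exact: continuous_enorm. Qed.

End measurable_row.

(** * Change of variables for scaled pushforward measures *)

Section change_of_variables.
Local Open Scope ereal_scope.
Context d1 d2 (T1 : measurableType d1) (T2 : measurableType d2) (R : realType).
Variables (phi : T1 -> T2) (m1 : {measure set T1 -> \bar R})
  (m2 : {measure set T2 -> \bar R}) (r : {nonneg R}).
Hypothesis mphi : measurable_fun [set: T1] phi.

(** The existential yields a bundled measure known only by its values, ready for the uniqueness
    theorems. *)
Lemma scaled_pushforward_measure : exists nu : {measure set T2 -> \bar R},
  forall A, nu A = r%:num%:E * m1 (phi @^-1` A).
Proof.
by unshelve eexists (mscale r (pushforward m1 phi) : {measure set T2 -> \bar R}).
Qed.

Lemma ge0_integral_scaled_pushforward (f : T2 -> \bar R) :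
  (forall A, measurable A -> m2 A = r%:num%:E * m1 (phi @^-1` A)) ->
  measurable_fun [set: T2] f -> (forall x, 0 <= f x) ->
  \int[m2]_x f x = r%:num%:E * \int[m1]_x f (phi x).
Proof.
move=> m2E mf f0.
have -> : \int[m1]_x f (phi x) = \int[pushforward m1 phi]_x f x.
  by rewrite ge0_integral_pushforward.
rewrite -ge0_integral_mscale//.
by apply: eq_measure_integral => A mA _; rewrite m2E.
Qed.

End change_of_variables.

Section lebesgue_affine.
Context {R : realType}.
Local Notation mu := (@lebesgue_measure R).

Lemma measurable_affine (c b : R) :
  measurable_fun [set: measurableTypeR R]
    ((fun t : R => c * t + b) : _ -> measurableTypeR R).
Proof. by apply: measurable_funD => //; exact: measurable_funM. Qed.

Lemma lebesgue_measure_affine (c b : R) (A : set R) : c != 0 -> measurable A ->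
  (mu A = `|c|%:E * mu ((fun t => (c * t + b)%R) @^-1` A))%E.
Proof.
move=> c0 mA.
have [nu nuE] := scaled_pushforward_measure mu (NngNum (normr_ge0 c)) (measurable_affine c b).
rewrite -nuE; apply: lebesgue_measure_unique => // _ [[x y] /= _ <-].
rewrite nuE lebesgue_measure_itv /= lte_fin.
have [cp|cn] : 0 < c \/ c < 0 by move: c0; rewrite neq_lt => /orP[]; [right|left].
- rewrite (_ : _ @^-1` _ = `](x - b) / c, (y - b) / c]%classic); last first.
    apply/seteqP; split => t /=;
      by rewrite !in_itv/= ltr_pdivrMr// ler_pdivlMr// ltrBlDr lerBrDr (mulrC c).
  rewrite lebesgue_measure_itv /= lte_fin ltr_pM2r ?invr_gt0// ltrD2r.
  case: ifPn => _; last by rewrite mule0.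
  rewrite gtr0_norm// -!EFinB -EFinM; congr EFin; field; lra.
(* For negative c the preimage of a left-open interval is right-open; its length is computed in the
   same way. *)
- rewrite (_ : _ @^-1` _ = `[(y - b) / c, (x - b) / c[%classic); last first.
    apply/seteqP; split => t /=;
      by rewrite !in_itv/= ler_ndivrMr// ltr_ndivlMr// ltrBlDr lerBrDr (mulrC c) andbC.
  rewrite lebesgue_measure_itv /= lte_fin ltr_nM2r ?invr_lt0// ltrD2r.
  case: ifPn => _; last by rewrite mule0.
  rewrite ltr0_norm// -!EFinB -EFinM; congr EFin; field; lra.
Qed.

Lemma ge0_integral_affine (c b : R) (f : R -> \bar R) : c != 0 ->
  measurable_fun [set: R] f -> (forall t, 0 <= f t)%E ->
  (\int[mu]_t f t = `|c|%:E * \int[mu]_t f (c * t + b)%R)%E.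
Proof.
move=> c0 mf f0.
rewrite (@ge0_integral_scaled_pushforward _ _ (measurableTypeR R) (measurableTypeR R)
  _ (fun t => c * t + b) mu mu (NngNum (normr_ge0 c)))//; first exact: measurable_affine.
by move=> A; exact: lebesgue_measure_affine.
Qed.

Lemma ge0_integral_itv_affine (c b x y : R) (f : R -> \bar R) : 0 < c ->
  measurable_fun [set: R] f -> (forall t, 0 <= f t)%E ->
  (\int[mu]_(t in `[(c * x + b)%R, (c * y + b)%R]) f t =
   c%:E * \int[mu]_(t in `[x, y]) f (c * t + b)%R)%E.
Proof.
move=> c0 mf f0; rewrite [LHS]integral_mkcond.
rewrite (@ge0_integral_affine c b); last 3 first.
- by rewrite gt_eqF.
- exact/(measurable_restrictT _ _).1/measurable_funTS.
- by move=> t; apply: erestrict_ge0.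
rewrite gtr0_norm// [in RHS]integral_mkcond; congr (_ * _)%E.
apply: eq_integral => t _; rewrite /patch !mem_setE !in_itv/= !lerD2r.
by rewrite !ler_pM2l.
Qed.

Lemma ge0_integral_itv_opp (x y : R) (f : R -> \bar R) :
  measurable_fun [set: R] f -> (forall t, 0 <= f t)%E ->
  (\int[mu]_(t in `[x, y]) f t = \int[mu]_(t in `[(- y)%R, (- x)%R]) f (- t)%R)%E.
Proof.
move=> mf f0; rewrite [LHS]integral_mkcond.
rewrite (@ge0_integral_affine (-1) 0); last 3 first.
- by rewrite oppr_eq0 oner_eq0.
- exact/(measurable_restrictT _ _).1/measurable_funTS.
- by move=> t; apply: erestrict_ge0.
rewrite normrN1 mul1e [in RHS]integral_mkcond.
apply: eq_integral => t _; rewrite /patch !mem_setE !in_itv/= addr0 mulN1r.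
by rewrite lerNr lerNl andbC.
Qed.

End lebesgue_affine.

(** * Lebesgue measure on R^n: rectangles, uniqueness, affine maps *)

Section lebesgue_Rn_theory.
Context {R : realType}.
Local Notation mu := (@lebesgue_measure R).

Lemma lebesgue_tuple_prod n (A : 'I_n -> set R) : (forall i, measurable (A i)) ->
  (lebesgue_tuple R n [set t | forall i, A i (tnth t i)] = \prod_(i < n) mu (A i))%E.
Proof.
elim: n A => [|n IH] A mA.
  rewrite big_ord0 /= diracE mem_set// => -[]//.
rewrite big_ord_recl -IH//=.
have mA' : measurable [set t : n.-tuple R | forall i, A (lift ord0 i) (tnth t i)].
  rewrite (_ : mkset _ = \bigcap_(i in [set: 'I_n]) ((@tnth n R ^~ i) @^-1` A (lift ord0 i))).
    apply: fin_bigcap_measurable => [|i _]; first exact: finite_finset.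
    by rewrite -[X in measurable X]setTI; exact: measurable_tnth.
  by apply/seteqP; split => [t h i _|t h i] //; exact: h.
rewrite -product_measure1E//; last exact: mA.
rewrite /= /cons_measure /pushforward; congr (product_measure1 _ _ _).
apply/seteqP; split => [[x t] h|[x t] [Ax h] i] /=.
  by split => [|i]; [have := h ord0|have := h (lift ord0 i); rewrite tnthS].
by case: (unliftP ord0 i) => [j ->|->]; [rewrite tnthS; exact: h|].
Qed.

Definition row_rect n (A : 'I_n -> set R) : set 'rV[R]_n :=
  [set x | forall i, A i (x 0 i)].

Lemma measurable_row_rect n (A : 'I_n -> set R) : (forall i, measurable (A i)) ->
  measurable (row_rect A : set (borelRn R n)).
Proof.
move=> mA; rewrite (_ : row_rect A = \bigcap_(i in [set: 'I_n])
    ((fun x : borelRn R n => (x : 'rV[R]_n) 0 i) @^-1` A i)).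
  apply: fin_bigcap_measurable => [|i _]; first exact: finite_finset.
  by rewrite -[X in measurable X]setTI; exact: measurable_coord.
by apply/seteqP; split => [t h i _|t h i] //; exact: h.
Qed.

Lemma lebesgue_Rn_rect n (A : 'I_n -> set R) : (forall i, measurable (A i)) ->
  (lebesgue_Rn (row_rect A : set (borelRn R n)) = \prod_(i < n) mu (A i))%E.
Proof.
move=> mA; rewrite -lebesgue_tuple_prod//; congr (lebesgue_tuple _ _ _).
by apply/seteqP; split => t h i; have := h i; rewrite mxE.
Qed.

Definition rects n : set (set (borelRn R n)) :=
  [set row_rect A | A in [set A : 'I_n -> set R | forall i, measurable (A i)]].
Arguments rects : clear implicits.

Definition cube n (k : nat) : set (borelRn R n) :=
  row_rect (fun _ : 'I_n => `[- k%:R, k%:R]%classic).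
Arguments cube : clear implicits.

Lemma rects_cube n k : rects n (cube n k).
Proof. by exists (fun=> `[- k%:R, k%:R]%classic) => //= i; exact: measurable_itv. Qed.

Lemma lebesgue_cube_fin n k : (lebesgue_Rn (cube n k) < +oo)%E.
Proof.
rewrite lebesgue_Rn_rect//.
rewrite ltey_eq; apply/orP; left.
elim/big_ind : _ => [//|x y|i _]; first exact: fin_numM.
by rewrite /= lebesgue_measure_itv/=; case: ifP.
Qed.

Lemma cube_enorm n (x : 'rV[R]_n) (k : nat) : enorm x <= k%:R -> cube n k x.
Proof.
move=> xk i; rewrite /= in_itv/= -ler_norml.
exact: le_trans (coord_le_enorm _ _) xk.
Qed.

Lemma cube_cover n : \bigcup_k cube n k = setT.
Proof.
rewrite -subTset => x _; exists (Num.bound (enorm (x : 'rV[R]_n))) => //.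
by apply: cube_enorm; exact/ltW/archi_boundP/enorm_ge0.
Qed.

(** That open sets are generated by rectangles amounts to the measurability of the identity between
    the two sigma-algebras, which [measurable_rowP] checks on coordinates. *)
Lemma borelRn_rects n : @measurable _ (borelRn R n) = <<s rects n >>.
Proof.
apply/seteqP; split.
  apply: smallest_sub; first exact: smallest_sigma_algebra.
  move=> U oU.
  pose T := g_sigma_algebraType (rects n).
  have : measurable_fun [set: T] (id : T -> borelRn R n).
    apply: measurable_rowP => i _ A mA; rewrite setTI.
    apply: sub_sigma_algebra.
    exists (fun j => if j == i then A else setT).
      by move=> j; case: ifP.
    apply/seteqP; split => [x /(_ i)|x xA j]; first by rewrite eqxx.
    by case: ifPn => // /eqP ->.
  by move=> /(_ measurableT U (open_borelRn oU)); rewrite setTI.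
apply: smallest_sub; first exact: smallest_sigma_algebra.
by move=> _ [A mA <-]; exact: measurable_row_rect.
Qed.

(** Rectangles form a generating class stable under intersection, and the cubes exhaust the space by
    sets of finite measure. *)
Lemma lebesgue_Rn_unique n (nu : {measure set (borelRn R n) -> \bar R}) :
  (forall A, (forall i, measurable (A i)) ->
    nu (row_rect A) = (\prod_(i < n) mu (A i))%E) ->
  forall B, measurable B -> lebesgue_Rn B = nu B.
Proof.
move=> nuE B mB; apply: (measure_unique (rects n) (cube n)) => //.
- exact: borelRn_rects.
- move=> _ _ [A mA <-] [A' mA' <-]; exists (fun i => A i `&` A' i).
    by move=> i; exact: measurableI.
  apply/seteqP; split => [x h|x [h h'] i]; last by split.
  by split => i; have [] := h i.
- exact: rects_cube.
- exact: cube_cover.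
- by move=> _ [A mA <-]; rewrite nuE//; exact: lebesgue_Rn_rect.
- exact: lebesgue_cube_fin.
Qed.

Lemma lebesgue_Rn_sigma_finite n : sigma_finite setT (@lebesgue_Rn R n).
Proof.
exists (cube n) => [|k]; first by rewrite cube_cover.
split; last exact: lebesgue_cube_fin.
by apply: measurable_row_rect => i; exact: measurable_itv.
Qed.

HB.instance Definition _ n := Measure_isSigmaFinite.Build _ _ _
  (@lebesgue_Rn R n) (lebesgue_Rn_sigma_finite n).

Lemma lebesgue_Rn_bounded n (A : set (borelRn R n)) (r : R) : measurable A ->
  (forall x, A x -> enorm (x : 'rV[R]_n) <= r) -> (lebesgue_Rn A < +oo)%E.
Proof.
move=> mA Ar; have [r0|r0] := leP 0 r; last first.
  rewrite (_ : A = set0) ?measure0 ?ltry//; rewrite -subset0 => x /Ar xr.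
  by have := enorm_ge0 x; rewrite leNgt (le_lt_trans xr).
apply: le_lt_trans (lebesgue_cube_fin n (Num.bound r)).
apply: le_measure; rewrite ?inE//.
  by apply: measurable_row_rect => i; exact: measurable_itv.
move=> x Ax; apply: cube_enorm; apply: le_trans (Ar x Ax) _.
exact/ltW/archi_boundP.
Qed.

Lemma measurable_Rn_affine n (c : R) (b : 'rV[R]_n) :
  measurable_fun [set: borelRn R n] ((fun x : borelRn R n => c *: (x : 'rV[R]_n) + b) : _ -> borelRn R n).
Proof.
apply: measurable_rowP => i.
rewrite (_ : (fun _ => _) = fun x : borelRn R n => c * (x : 'rV[R]_n) 0 i + b 0 i).
  apply: measurable_funD => //; apply: measurable_funM => //.
  exact: measurable_coord.
by apply/funext => x; rewrite !mxE.
Qed.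

(** The preimage of a rectangle is the rectangle of the preimages of its sides, so each coordinate
    contributes one factor |c|. *)
Lemma lebesgue_Rn_affine n (c : R) (b : 'rV[R]_n) (B : set (borelRn R n)) :
  c != 0 -> measurable B ->
  (lebesgue_Rn B = (`|c| ^+ n)%:E *
    lebesgue_Rn ((fun x : borelRn R n => (c *: (x : 'rV[R]_n) + b)%R : borelRn R n) @^-1` B))%E.
Proof.
move=> c0 mB; have c0' : 0 <= `|c| ^+ n by rewrite exprn_ge0.
have [nu nuE] := scaled_pushforward_measure (@lebesgue_Rn R n) (NngNum c0')
  (measurable_Rn_affine c b).
rewrite -nuE; apply: lebesgue_Rn_unique => // A mA; rewrite nuE.
rewrite (_ : _ @^-1` _ = row_rect (fun i => (fun t => c * t + b 0 i) @^-1` A i)); last first.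
  by apply/seteqP; split => x h i; have := h i; rewrite /= !mxE.
have mA' i : measurable ((fun t => c * t + b 0 i) @^-1` A i).
  by rewrite -[X in measurable X]setTI; apply: measurable_affine => //; exact: mA.
transitivity ((`|c| ^+ n)%:E * \prod_(i < n) mu ((fun t => (c * t + b 0 i)%R) @^-1` A i))%E.
  by congr (_ * _)%E; exact: lebesgue_Rn_rect.
under [RHS]eq_bigr => i _ do rewrite (lebesgue_measure_affine (b 0 i) c0 (mA i)).
rewrite big_split/=; congr (_ * _)%E.
by rewrite prodEFin prodr_const card_ord.
Qed.

Lemma ge0_integral_Rn_affine n (c : R) (b : 'rV[R]_n) (f : borelRn R n -> \bar R) :
  c != 0 -> measurable_fun [set: borelRn R n] f -> (forall x, 0 <= f x)%E ->
  (\int[@lebesgue_Rn R n]_x f x =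
    (`|c| ^+ n)%:E * \int[@lebesgue_Rn R n]_x f (c *: (x : 'rV[R]_n) + b)%R)%E.
Proof.
move=> c0 mf f0; have c0' : 0 <= `|c| ^+ n by rewrite exprn_ge0.
rewrite (@ge0_integral_scaled_pushforward _ _ (borelRn R n) (borelRn R n)
  _ (fun x : borelRn R n => c *: (x : 'rV[R]_n) + b) (@lebesgue_Rn R n) (@lebesgue_Rn R n) (NngNum c0'))//.
  exact: measurable_Rn_affine.
by move=> A mA; exact: lebesgue_Rn_affine.
Qed.

End lebesgue_Rn_theory.

(** * Tonelli's theorem over a product of measurable sets *)

Section tonelli_on.
Local Open Scope ereal_scope.
Context d1 d2 (T1 : measurableType d1) (T2 : measurableType d2) (R : realType).
Variables (m1 : {sigma_finite_measure set T1 -> \bar R})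
  (m2 : {sigma_finite_measure set T2 -> \bar R}).
Variables (A : set T1) (B : set T2) (f : T1 * T2 -> \bar R).
Hypotheses (mA : measurable A) (mB : measurable B)
  (mf : measurable_fun [set: T1 * T2] f) (f0 : forall z, 0 <= f z).

Let g (C : set T1) (D : set T2) := f \_ (C `*` D).

Let mg C D : measurable C -> measurable D -> measurable_fun setT (g C D).
Proof.
move=> mC mD; apply/(measurable_restrictT _ _).1; first exact: measurableX.
exact: measurable_funTS.
Qed.

Let g0 C D z : 0 <= g C D z.
Proof. exact: erestrict_ge0. Qed.

Lemma measurable_integral_snd : measurable_fun [set: T1] (fun x => \int[m2]_(y in B) f (x, y)).
Proof.
have := @measurable_fun_fubini_tonelli_F _ _ _ _ _ m2 (g setT B) (mg measurableT mB) (g0 _ _).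
rewrite /fubini_F; congr (measurable_fun _ _); apply/funext => x.
rewrite [RHS]integral_mkcond; apply: eq_integral => y _.
by rewrite /g /patch in_setX mem_set.
Qed.

Lemma measurable_integral_fst : measurable_fun [set: T2] (fun y => \int[m1]_(x in A) f (x, y)).
Proof.
have := @measurable_fun_fubini_tonelli_G _ _ _ _ _ m1 (g A setT) (mg mA measurableT) (g0 _ _).
rewrite /fubini_G; congr (measurable_fun _ _); apply/funext => y.
rewrite [RHS]integral_mkcond; apply: eq_integral => x _.
by rewrite /g /patch in_setX (mem_set (_ : [set: T2] y)) // andbT.
Qed.

(** Extending [f] by zero outside [A] x [B] reduces this to the theorem on the full product. *)
Lemma tonelli_on : \int[m1]_(x in A) \int[m2]_(y in B) f (x, y) =
  \int[m2]_(y in B) \int[m1]_(x in A) f (x, y).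
Proof.
transitivity (\int[m1]_x fubini_F m2 (g A B) x).
  rewrite integral_mkcond; apply: eq_integral => x _.
  rewrite /fubini_F /patch; case: ifPn => xA.
    rewrite [LHS]integral_mkcond; apply: eq_integral => y _.
    by rewrite /g /patch in_setX xA.
  rewrite [RHS]integral0_eq// => y _; by rewrite /g /patch in_setX (negbTE xA).
rewrite (@fubini_tonelli _ _ _ _ _ m1 m2 _ (mg mA mB) (g0 A B)).
rewrite [RHS]integral_mkcond; apply: eq_integral => y _.
rewrite /fubini_G /patch; case: ifPn => yB.
  rewrite [RHS]integral_mkcond; apply: eq_integral => x _.
  by rewrite /g /patch in_setX yB andbT.
by rewrite [LHS]integral0_eq// => x _; rewrite /g /patch in_setX (negbTE yB) andbF.
Qed.

End tonelli_on.

(** * Arc length and line integrals *)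

Section arc_length.
Context {R : realType} {n : nat}.
Implicit Types (g : R -> 'rV[R]_n) (a b c t u v L : R) (s : seq R).

(** Recursive form of the sum in [arc_length], which indexes the partition with [nth]; it allows
    induction on the partition. *)
Fixpoint chain_length g a s : R :=
  if s is t :: s' then enorm (g t - g a) + chain_length g t s' else 0.

Definition path_length g a b : \bar R :=
  ereal_sup [set (chain_length g a s)%:E | s in itv_partition a b].

Lemma chain_lengthE g a s b :
  \sum_(0 <= i < size s) enorm (g (nth b (a :: s) i.+1) - g (nth b (a :: s) i)) =
  chain_length g a s.
Proof.
elim: s a => [|t s IH] a /=; first by rewrite big_nil.
by rewrite big_nat_recl//= IH.
Qed.

Lemma arc_lengthE (h : curve R n) a b :
  arc_length h a b = path_length (curve_map h) a b.
Proof.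
congr ereal_sup; apply/seteqP; split => _ [s sP <-]; exists s => //.
  by rewrite -(chain_lengthE _ _ _ b).
by rewrite -(chain_lengthE _ _ _ b).
Qed.

Lemma chain_length_ge0 g a s : 0 <= chain_length g a s.
Proof. by elim: s a => //= t s IH a; rewrite addr_ge0 ?enorm_ge0. Qed.

Lemma chain_length_cat g a s1 s2 :
  chain_length g a (s1 ++ s2) = chain_length g a s1 + chain_length g (last a s1) s2.
Proof. by elim: s1 a => [|t s1 IH] a /=; rewrite ?add0r// IH addrA. Qed.

Lemma itv_partition_le a b s : itv_partition a b s -> a <= b.
Proof.
case=> p /eqP <-; case: s p => [_|t s /= /andP[at_ p]]; first exact: lexx.
elim: s t a at_ p => [|u s IH] t a at_ /=; first by move=> _; exact: ltW.
by move=> /andP[tu p]; exact: (IH u a (lt_trans at_ tu)).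
Qed.

Lemma itv_partition_cons a b t s :
  itv_partition a b (t :: s) <-> a < t /\ itv_partition t b s.
Proof.
rewrite /itv_partition /=; split; first by case=> /andP[].
by case=> -> [] ->.
Qed.

Lemma chain_length_le g a b s : itv_partition a b s ->
  ((chain_length g a s)%:E <= path_length g a b)%E.
Proof. by move=> sP; apply: ereal_sup_ubound; exists s. Qed.

Lemma path_length_ge g a b : a <= b -> ((enorm (g b - g a))%:E <= path_length g a b)%E.
Proof.
rewrite le_eqVlt => /orP[/eqP<-|ab].
  rewrite subrr enorm0; apply: (@le_trans _ _ (chain_length g a [::])%:E) => //.
  by apply: chain_length_le; split => //=.
apply: (@le_trans _ _ (chain_length g a [:: b])%:E); first by rewrite /= addr0.
by apply: chain_length_le; split => //=; rewrite andbT.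
Qed.

Lemma path_length_ge0 g a b : a <= b -> (0 <= path_length g a b)%E.
Proof. by move=> ab; apply: le_trans (path_length_ge g ab); rewrite lee_fin enorm_ge0. Qed.

(** Concatenating partitions at c bounds the sum of two chain sums by X. Taking the two suprema one
    after the other needs subtraction, hence the separate case X = +oo and the finiteness checks. *)
Lemma path_length_superadd g a b c : a <= c -> c <= b ->
  (path_length g a c + path_length g c b <= path_length g a b)%E.
Proof.
move=> ac cb; set X := path_length g a b.
have H s (t : seq R) : itv_partition a c s -> itv_partition c b t ->
    ((chain_length g a s)%:E + (chain_length g c t)%:E <= X)%E.
  move=> [ps /eqP ls] [pt lt_]; rewrite -EFinD -{1}ls -chain_length_cat.
  apply: chain_length_le; split; first by rewrite cat_path ps ls.
  by rewrite last_cat ls.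
have X0 : (0 <= X)%E by apply: path_length_ge0; exact: le_trans cb.
have [->|Xoo] := eqVneq X +oo%E; first by rewrite leey.
have Xfin : X \is a fin_num by rewrite ge0_fin_numE// ltey.
rewrite addeC -leeBrDr; last first.
  rewrite ge0_fin_numE ?path_length_ge0//; apply: le_lt_trans (_ : (X < +oo)%E); last by rewrite ltey.
  apply: ge_ereal_sup => _ [s sP <-].
  have [t tP] : exists t : seq R, itv_partition c b t.
    (* A one-point interval has only the empty partition. *)
    have [->|cb'] := eqVneq c b; first by exists [::].
    by exists [:: b]; split => //=; rewrite andbT lt_neqAle cb'.
  apply: le_trans (H s t sP tP); rewrite leeDl// lee_fin; exact: chain_length_ge0.
apply: ge_ereal_sup => _ [t tP <-].
rewrite leeBrDr; last first.
  rewrite ge0_fin_numE ?path_length_ge0//; apply: le_lt_trans (_ : (X < +oo)%E); last by rewrite ltey.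
  apply: ge_ereal_sup => _ [s sP <-].
  apply: le_trans (H s t sP tP); rewrite leeDl// lee_fin; exact: chain_length_ge0.
rewrite addeC -leeBrDr//.
apply: ge_ereal_sup => _ [s sP <-].
by rewrite leeBrDr// H.
Qed.

(** For the upper bound, walk along a partition up to the step that jumps over c and split that
    single step by the triangle inequality. *)
Lemma path_length_add g a b c : a <= c -> c <= b ->
  path_length g a b = (path_length g a c + path_length g c b)%E.
Proof.
move=> ac cb; apply/eqP; rewrite eq_le path_length_superadd// andbT.
apply: ge_ereal_sup => _ [s sP <-].
elim: s a ac sP => [|t s IH] a ac sP.
  by rewrite adde_ge0 ?path_length_ge0.
have [at_ tP] := (itv_partition_cons _ _ _ _).1 sP.
have [tc|ct] := leP t c.
  rewrite /= EFinD.
  apply: le_trans (leeD (path_length_ge g (ltW at_)) (IH t tc tP)) _.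
  by rewrite addeA leeD2r// path_length_superadd// ltW.
apply: (@le_trans _ _ ((enorm (g c - g a))%:E + (chain_length g c (t :: s))%:E)%E).
  rewrite -EFinD lee_fin /= addrA lerD2r [leRHS]addrC; exact: ler_enorm_sub.
apply: leeD; first exact: path_length_ge.
by apply: chain_length_le; apply/itv_partition_cons.
Qed.

Lemma path_length_lipschitz g a b : a <= b ->
  (forall u v, a <= u -> u <= v -> v <= b -> enorm (g v - g u) <= v - u) ->
  (path_length g a b <= (b - a)%:E)%E.
Proof.
move=> ab gL; apply: ge_ereal_sup => _ [s sP <-]; rewrite lee_fin.
elim: s a ab gL sP => [|t s IH] a ab gL sP; first by rewrite /= subr_ge0.
have [at_ tP] := (itv_partition_cons _ _ _ _).1 sP.
have tb := itv_partition_le tP.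
rewrite /= (_ : b - a = (t - a) + (b - t)); last by ring.
apply: lerD; first by apply: gL => //; exact: ltW.
apply: IH => // u v tu uv vb; apply: gL => //; exact: le_trans (ltW at_) tu.
Qed.

Lemma path_length_isometry g a b : a <= b ->
  (forall u v, a <= u -> u <= v -> v <= b -> enorm (g v - g u) = v - u) ->
  path_length g a b = (b - a)%:E.
Proof.
move=> ab gI; apply/eqP; rewrite eq_le path_length_lipschitz//=; last first.
  by move=> u v au uv vb; rewrite gI.
by rewrite -(gI a b)// path_length_ge.
Qed.

(** Parametrization by arc length, stated through the lengths of subarcs and not through distances,
    so that it survives the corners of a polygon. *)
Definition unit_speed g L :=
  forall u v, 0 <= u -> u <= v -> v <= L -> path_length g u v = (v - u)%:E.

Lemma unit_speed_cat g L L' : 0 <= L -> L <= L' -> unit_speed g L ->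
  (forall u v, L <= u -> u <= v -> v <= L' -> path_length g u v = (v - u)%:E) ->
  unit_speed g L'.
Proof.
move=> L0 LL' g1 g2 u v u0 uv vL'.
have [vL|Lv] := leP v L; first exact: g1.
have [Lu|uL] := leP L u; first exact: g2.
rewrite (path_length_add g (ltW uL) (ltW Lv)).
rewrite (g1 u L u0 (ltW uL) (lexx L)) (g2 L v (lexx L) (ltW Lv) vL') -EFinD.
by congr EFin; ring.
Qed.

End arc_length.

Section line_integral_unit_speed.
Context {R : realType} {n : nat}.
Local Notation mu := (@lebesgue_measure R).
Variables (g : R -> 'rV[R]_n) (L : R) (rho : borelRn R n -> \bar R).
Hypotheses (gU : unit_speed g L)
  (mg : measurable_fun [set: R] (g : R -> borelRn R n))
  (mrho : measurable_fun [set: borelRn R n] rho) (rho0 : forall x, (0 <= rho x)%E).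

Let G := Curve `[0, L] g.

(** On a subarc [a, b] the only time at which the length from a equals u is a + u, so the choice
    made by [xget] is forced and the integral becomes an ordinary one over [a, b]. *)
Lemma line_integral_unit_speed :
  (line_integral rho G <= \int[mu]_(t in `[0%R, L]) rho (g t))%E.
Proof.
have mrg : measurable_fun [set: R] (rho \o g) by exact: measurableT_comp.
apply: ge_ereal_sup => _ [a [b [aL bL ab ->]]].
move: aL bL; rewrite !in_itv/= => /andP[a0 _] /andP[_ bL].
rewrite /line_integral_seg arc_lengthE/= gU//=.
apply: (@le_trans _ _ (\int[mu]_(t in `[a, b]) rho (g t))%E); last first.
  apply: ge0_subset_integral => //.
    exact: measurable_funTS.
  by move=> t /=; rewrite !in_itv/= => /andP[at_ tb]; rewrite (le_trans a0)//= (le_trans tb).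
rewrite [leRHS](_ : _ = \int[mu]_(t in `[(1 * 0 + a)%R, (1 * (b - a) + a)%R]) rho (g t))%E; last first.
  by rewrite !mul1r add0r subrK.
rewrite (@ge0_integral_itv_affine _ 1 a 0 (b - a) (rho \o g)) ?mul1e//.
  rewrite le_eqVlt; apply/orP; left; apply/eqP.
  apply: eq_integral => u; rewrite inE /= in_itv/= => /andP[u0 ub].
  rewrite /arc_length_param mul1r /=; congr (rho (g _)).
  apply: xget_unique => [|t [/andP[at_ tb]]].
    split; first by apply/andP; split; lra.
    by rewrite arc_lengthE gU//=; first (by congr EFin; lra); lra.
  rewrite arc_lengthE gU//=; last by lra.
  by move=> [] /eqP; rewrite subr_eq => /eqP.
by move=> t; exact: rho0.
Qed.

End line_integral_unit_speed.

(** * Continuity of arc length along a rectifiable curve *)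

Section arc_length_continuity.
Context {R : realType} {n : nat}.
Variables (g : R -> 'rV[R]_n) (a b : R).
Hypotheses (ab : a <= b) (cg : {within `[a, b], continuous g})
  (goo : (path_length g a b < +oo)%E).

Let gP t : a <= t <= b -> forall e : R, 0 < e -> exists2 d : R, 0 < d &
  forall u, a <= u <= b -> `|t - u| < d -> enorm (g t - g u) < e.
Proof.
move=> tab e e0; have /within_continuous_pathP := cg.
move=> /(_ t); rewrite /= in_itv/= => /(_ tab e e0)[d d0 H].
by exists d => // u uab; apply: H; rewrite /= in_itv.
Qed.

Lemma path_length_fin t u : a <= t -> t <= u -> u <= b ->
  path_length g t u \is a fin_num.
Proof.
move=> at_ tu ub; rewrite ge0_fin_numE ?path_length_ge0//.
apply: le_lt_trans goo; rewrite (path_length_add g at_ (le_trans tu ub)).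
rewrite (path_length_add g tu ub) addeCA leeDl// adde_ge0 ?path_length_ge0//.
Qed.

(** Take a partition of [t, b] whose chain sum is within e/2 of the length, and start it at a point
    t' close to t instead. The sum drops by at most |g t' - g t| < e/2, so the length of [t', b] is
    within e of that of [t, b]. *)
Lemma path_length_right t e : a <= t -> t < b -> 0 < e ->
  exists2 t', t < t' <= b & (path_length g t t' <= e%:E)%E.
Proof.
move=> at_ tb e0; have e20 : 0 < e / 2 by rewrite divr_gt0.
have tbfin := path_length_fin at_ (ltW tb) (lexx b).
have [_ [s sP <-]] := ub_ereal_sup_adherent e20 tbfin.
rewrite -/(path_length g t b).
case: s sP => [/itv_partition_nil tb'|t1 s]; first by move: tb; rewrite tb' ltxx.
move=> /itv_partition_cons [tt1 sP] hs.
have t1b := itv_partition_le sP.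
have [|d d0 H] := @gP t _ (e / 2) e20; first by rewrite at_ ltW.
pose t' := t + Num.min (d / 2) ((t1 - t) / 2).
have m0 : 0 < Num.min (d / 2) ((t1 - t) / 2) by rewrite lt_min !divr_gt0// subr_gt0.
have m1 : Num.min (d / 2) ((t1 - t) / 2) <= d / 2 by rewrite ge_min lexx.
have m2 : Num.min (d / 2) ((t1 - t) / 2) <= (t1 - t) / 2 by rewrite ge_min lexx orbT.
have tt' : t < t' by rewrite /t'; lra.
have t't1 : t' < t1 by rewrite /t'; lra.
exists t'; first by rewrite tt' (le_trans (ltW t't1)).
have t'b : t' <= b by rewrite (le_trans (ltW t't1)).
have tt'fin := path_length_fin at_ (ltW tt') t'b.
have t'bfin := path_length_fin (le_trans at_ (ltW tt')) t'b (lexx b).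
have h1 : enorm (g t' - g t) < e / 2.
  rewrite enormBC; apply: H; first by rewrite (le_trans at_ (ltW tt')).
  by rewrite /t' opprD addNKr normrN gtr0_norm//; lra.
have h2 : ((chain_length g t' (t1 :: s))%:E <= path_length g t' b)%E.
  by apply: chain_length_le; apply/itv_partition_cons.
have h3 := ler_enorm_sub (g t') (g t1) (g t).
move: hs h2; rewrite (path_length_add g (ltW tt') t'b) /=.
rewrite -(fineK tt'fin) -(fineK t'bfin) -!EFinD lte_fin !lee_fin; lra.
Qed.

(** The witness m is the last partition point before t: all steps up to m are kept, and the final
    step is made to end at t' instead of t. *)
Let left_approx t s c : itv_partition c t s -> c < t -> a <= c -> t <= b ->
  exists2 m, c <= m < t & forall t', m <= t' -> t' < t ->
    ((chain_length g c s)%:E <= path_length g c t' + (enorm (g t - g t'))%:E)%E.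
Proof.
elim: s c => [|t1 s IH] c.
  by move=> /itv_partition_nil -> ; rewrite ltxx.
move=> /itv_partition_cons [ct1 sP] ct ac tb.
have [t1t|] := ltP t1 t; last first.
  have t1t := itv_partition_le sP; move=> tt1.
  have {t1t}{}tt1 : t1 = t by apply/eqP; rewrite eq_le t1t.
  subst t1; case: s {IH} sP => [_|u s /itv_partition_cons[tu /itv_partition_le]]; last first.
    by rewrite leNgt tu.
  exists c; first by rewrite lexx.
  move=> t' ct' t't; apply: (@le_trans _ _ ((enorm (g t' - g c))%:E + (enorm (g t - g t'))%:E)%E).
    by rewrite -EFinD lee_fin /= addr0 [leRHS]addrC; exact: ler_enorm_sub.
  by rewrite leeD2r// path_length_ge.
have [m /andP[t1m mt] Hm] := IH t1 sP t1t (le_trans ac (ltW ct1)) tb.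
exists m; first by rewrite mt andbT (le_trans (ltW ct1)).
move=> t' mt' t't; rewrite /= EFinD.
apply: le_trans (leeD (path_length_ge g (ltW ct1)) (Hm t' mt' t't)) _.
rewrite addeA leeD2r// path_length_superadd//; first exact: ltW.
exact: le_trans mt'.
Qed.

Lemma path_length_left t e : a < t -> t <= b -> 0 < e ->
  exists2 t', a <= t' < t & (path_length g t' t <= e%:E)%E.
Proof.
move=> at_ tb e0; have e20 : 0 < e / 2 by rewrite divr_gt0.
have atfin := path_length_fin (lexx a) (ltW at_) tb.
have [_ [s sP <-]] := ub_ereal_sup_adherent e20 atfin.
rewrite -/(path_length g a t) => hs.
have [m /andP[am mt] Hm] := left_approx sP at_ (lexx a) tb.
have [|d d0 H] := @gP t _ (e / 2) e20; first by rewrite ltW.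
pose t' := t - Num.min (d / 2) (t - m).
have m0 : 0 < Num.min (d / 2) (t - m) by rewrite lt_min divr_gt0//= subr_gt0.
have m1 : Num.min (d / 2) (t - m) <= d / 2 by rewrite ge_min lexx.
have m2 : Num.min (d / 2) (t - m) <= t - m by rewrite ge_min lexx orbT.
have t't : t' < t by rewrite /t'; lra.
have mt' : m <= t' by rewrite /t'; lra.
have at' := le_trans am mt'.
exists t'; first by rewrite at'.
have at'fin := path_length_fin (lexx a) at' (le_trans (ltW t't) tb).
have t'tfin := path_length_fin at' (ltW t't) tb.
have h1 : enorm (g t - g t') < e / 2.
  apply: H; first by rewrite at' (le_trans (ltW t't)).
  by rewrite /t' opprB addrC subrK gtr0_norm//; lra.
move: hs (Hm t' mt' t't); rewrite (path_length_add g at' (ltW t't)).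
rewrite -(fineK at'fin) -(fineK t'tfin) -!EFinD lte_fin !lee_fin; lra.
Qed.

(** Intermediate value theorem for arc length. It guarantees that [arc_length_param] never falls
    back on the default value of [xget]. *)
Lemma path_length_onto u : 0 <= u -> (u%:E <= path_length g a b)%E ->
  exists2 t, a <= t <= b & path_length g a t = u%:E.
Proof.
move=> u0 ub; pose T := [set t | a <= t <= b /\ (path_length g a t <= u%:E)%E].
have W t : a <= t -> t <= b -> path_length g a t = (fine (path_length g a t))%:E.
  by move=> at_ tb; rewrite fineK// path_length_fin.
have aa : path_length g a a = 0%E.
  rewrite path_length_isometry// ?subrr// => x y ax xy ya.
  have -> : x = y by apply/eqP; rewrite eq_le xy (le_trans ya ax).
  by rewrite !subrr enorm0.
have Ta : T a by split; rewrite ?lexx//= aa lee_fin.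
have hT : has_sup T by split; [exists a|exists b => t [/andP[]]].
pose t := sup T.
have at_ : a <= t by apply: ub_le_sup => //; case: hT.
have tb : t <= b by apply: ge_sup; [exists a|move=> ? [/andP[]]].
exists t; first by rewrite at_.
rewrite W//; congr EFin; apply/eqP; rewrite eq_le; apply/andP; split.
- rewrite leNgt; apply/negP => ut.
  have at' : a < t.
    rewrite lt_neqAle at_ andbT; apply/eqP => ta; move: ut; rewrite -ta aa /=; lra.
  have e0 : 0 < (fine (path_length g a t) - u) / 2 by lra.
  have [t' /andP[at1 t't] h] := path_length_left at' tb e0.
  have [t1 [/andP[at1' t1b] ht1] t't1] := sup_gt hT.1 t't.
  have t1t : t1 <= t by apply: (ub_le_sup hT.2); split; rewrite ?at1'.
  move: ht1 h; rewrite (W t1)// => ht1.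
  rewrite -(fineK (path_length_fin at1 (ltW t't) tb)) => h.
  move: ut; have := path_length_add g at1' t1t.
  have := path_length_add g (ltW t't1) t1t.
  have e1 := fineK (path_length_fin at1 (ltW t't1) t1b).
  have e2 := fineK (path_length_fin at1' t1t tb).
  have := path_length_ge0 g (ltW t't1).
  rewrite (W t)// (W t1)// -e1 -e2 -(fineK (path_length_fin at1 (ltW t't) tb)).
  rewrite -!EFinD lee_fin => h0 [h1] [h2] h3; move: ht1 h; rewrite !lee_fin; lra.
- rewrite leNgt; apply/negP => tu.
  have tb' : t < b.
    rewrite lt_neqAle tb andbT; apply/eqP => tb'; move: ub; rewrite -tb' W// lee_fin; lra.
  have e0 : 0 < u - fine (path_length g a t) by lra.
  have [t' /andP[tt' t'b] h] := path_length_right at_ tb' e0.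
  have : T t'.
    split; first by rewrite t'b (le_trans at_ (ltW tt')).
    rewrite (path_length_add g at_ (ltW tt')) (W t)//.
    by rewrite -leeBrDl// -EFinB.
  move=> /(ub_le_sup hT.2); rewrite leNgt => /negP; apply; exact: tt'.
Qed.

End arc_length_continuity.

Section ge0_le_integral_general.
Local Open Scope ereal_scope.
Context d (T : measurableType d) (R : realType) (mu : {measure set T -> \bar R}).

(** The integral of a nonnegative function is a supremum over simple functions below it. This covers
    integrands built from [arc_length_param], whose measurability is not established. *)
Lemma ge0_le_integral_sup (D : set T) (f1 f2 : T -> \bar R) :
  (forall x, D x -> 0 <= f1 x) -> (forall x, D x -> f1 x <= f2 x) ->
  \int[mu]_(x in D) f1 x <= \int[mu]_(x in D) f2 x.
Proof.
move=> f10 f12; rewrite !(integral_mkcond D).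
have h0 x : 0 <= (f1 \_ D) x by exact: erestrict_ge0.
have h20 x : 0 <= (f2 \_ D) x.
  by apply: erestrict_ge0 => t Dt; exact: le_trans (f10 t Dt) (f12 t Dt).
rewrite !ge0_integralTE//; apply: le_ereal_sup => _ [h hf <-].
by exists h => // x; apply: le_trans (hf x) _; exact: lee_restrict.
Qed.

End ge0_le_integral_general.

(** * First and last times at a given level *)

Section first_hit.
Context {R : realType}.
Implicit Types (p : R -> R) (a b c : R).

Definition continuous_on_itv p a b := forall t, a <= t <= b ->
  forall e : R, 0 < e -> exists2 d : R, 0 < d &
    forall u, a <= u <= b -> `|t - u| < d -> `|p t - p u| < e.

Lemma first_hit p a b c : a <= b -> continuous_on_itv p a b -> p a <= c -> c <= p b ->
  exists2 t, a <= t <= b & p t = c /\ forall u, a <= u -> u < t -> p u < c.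
Proof.
move=> ab cp pa pb; pose T := [set t | a <= t <= b /\ c <= p t].
have Tb : T b by rewrite /T /= ab lexx.
have hT : has_inf T by split; [exists b|exists a => t [/andP[]]].
pose t := inf T.
have tb : t <= b by apply: ge_inf => //; case: hT.
have at_ : a <= t by apply: lb_le_inf; [exists b|move=> ? [/andP[]]].
have before u : a <= u -> u < t -> p u < c.
  move=> au ut; rewrite ltNge; apply/negP => cu.
  have : T u by split; rewrite // au (le_trans (ltW ut)).
  by move=> /(ge_inf hT.2); rewrite leNgt ut.
exists t; first by rewrite at_.
split => //; apply/eqP; rewrite eq_le; apply/andP; split; rewrite leNgt; apply/negP => h.
- have e0 : 0 < p t - c by rewrite subr_gt0.
  have at' : a < t by rewrite lt_neqAle at_ andbT; apply/eqP => at'; move: h; rewrite -at'; lra.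
  have [|d d0 H] := cp t _ _ e0; first by rewrite at_.
  pose u := t - Num.min (d / 2) (t - a).
  have m0 : 0 < Num.min (d / 2) (t - a) by rewrite lt_min divr_gt0//= subr_gt0.
  have m1 : Num.min (d / 2) (t - a) <= d / 2 by rewrite ge_min lexx.
  have m2 : Num.min (d / 2) (t - a) <= t - a by rewrite ge_min lexx orbT.
  have ut : u < t by rewrite /u; lra.
  have au : a <= u by rewrite /u; lra.
  have := H u; rewrite au (le_trans (ltW ut) tb) => /(_ erefl).
  rewrite {1}/u opprB addrC subrK gtr0_norm// => /(_ _); rewrite ltr_norml.
  have := before u au ut; move=> pu; case/(_ _)/andP => [|]; lra.
- have e0 : 0 < c - p t by rewrite subr_gt0.
  have [|d d0 H] := cp t _ _ e0; first by rewrite at_.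
  have tt : t < t + d by lra.
  have [u [/andP[au ub] cu] ut] := inf_lt hT.1 tt.
  have tu : t <= u by apply: (ge_inf hT.2); split; rewrite ?au.
  have := H u; rewrite au ub => /(_ erefl).
  rewrite ler0_norm ?subr_le0// ltr_norml => /(_ _)/andP; case; lra.
Qed.

(** This is [first_hit] after reversing both time and sign. *)
Lemma last_exit p a b c : a <= b -> continuous_on_itv p a b -> p a <= c -> c <= p b ->
  exists2 t, a <= t <= b & p t = c /\ forall u, t < u -> u <= b -> c < p u.
Proof.
move=> ab cp pa pb; pose p' t := - p (a + b - t).
have cp' : continuous_on_itv p' a b.
  move=> t /andP[at_ tb] e e0.
  have [|d d0 H] := cp (a + b - t) _ e e0; first by apply/andP; split; lra.
  exists d => // u /andP[au ub] tu.
  rewrite /p' -opprD normrN; apply: H; first by apply/andP; split; lra.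
  by rewrite (_ : _ - _ = - (t - u)) ?normrN//; ring.
have [||t /andP[at_ tb] [pt H]] := @first_hit p' a b (- c) ab cp'.
- by rewrite /p' lerN2 addrAC subrr add0r.
- by rewrite /p' lerN2 addrK.
exists (a + b - t); first by apply/andP; split; lra.
split; first by move: pt; rewrite /p'; lra.
move=> u tu ub; have := H (a + b - u).
by rewrite /p' opprB addrCA subrr addr0 ltrN2; apply; lra.
Qed.

(** Take for t2 the first time at level r2, and for t1 the last time at level r1 before t2. *)
Lemma shell_crossing p a b r1 r2 : a <= b -> continuous_on_itv p a b ->
  r1 < r2 -> p a <= r1 -> r2 <= p b ->
  exists t1 t2, [/\ a <= t1, t1 <= t2, t2 <= b, p t1 = r1 /\ p t2 = r2 &
    forall t, t1 < t -> t < t2 -> r1 < p t < r2].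
Proof.
move=> ab cp r12 pa pb.
have [|t2 /andP[at2 t2b] [pt2 H2]] := first_hit ab cp _ pb; first by lra.
have cp' : continuous_on_itv p a t2.
  move=> t /andP[at_ tt2] e e0.
  have [|d d0 H] := cp t _ e e0; first by rewrite at_ (le_trans tt2).
  by exists d => // u /andP[au ut2]; apply: H; rewrite au (le_trans ut2).
have [|t1 /andP[at1 t12] [pt1 H1]] := last_exit at2 cp' pa; first by lra.
exists t1, t2; split => // t t1t tt2.
by rewrite H1 ?(ltW tt2)// H2// (le_trans at1)// ltW.
Qed.

End first_hit.

(** * Line integrals along curves that cross shells *)

Section crossing.
Context {R : realType} {n : nat}.
Local Notation mu := (@lebesgue_measure R).
Variables (g : curve R n) (a b : R) (z : 'rV[R]_n) (B : set 'rV[R]_n).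
Hypotheses (ab : a <= b) (cg : {within `[a, b], continuous (curve_map g)})
  (goo : (arc_length g a b < +oo)%E)
  (gB : forall t, a <= t <= b -> B (curve_map g t)).

Let Goo : (path_length (curve_map g) a b < +oo)%E.
Proof. by rewrite -arc_lengthE. Qed.

Let V t := fine (path_length (curve_map g) a t).

Let VE t : a <= t -> t <= b -> path_length (curve_map g) a t = (V t)%:E.
Proof. by move=> at_ tb; rewrite /V fineK//; apply: (path_length_fin Goo). Qed.

Let V_mono t u : a <= t -> t <= u -> u <= b ->
  V t + enorm (curve_map g u - curve_map g t) <= V u.
Proof.
move=> at_ tu ub; rewrite -lee_fin EFinD -!VE ?(le_trans at_ tu)//; last exact: le_trans tu ub.
by rewrite (path_length_add _ at_ tu) leeD2l// path_length_ge.
Qed.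

Let dist_continuous : continuous_on_itv (fun t => enorm (curve_map g t - z)) a b.
Proof.
move=> t tab e e0; have /within_continuous_pathP/(_ t) := cg.
rewrite /= in_itv/= => /(_ tab e e0)[d d0 H]; exists d => // u uab tu.
apply: le_lt_trans (ler_dist_enorm _ _) _.
by rewrite subr_subrr; apply: H => //=; rewrite in_itv.
Qed.

(** The witnesses are the lengths V t1 and V t2 at the ends of a crossing; a crossing is at least as
    long as the shell is wide. The time that [xget] selects for a length strictly between them lies
    strictly between t1 and t2, because V is monotone. *)
Lemma crossing_interval (r1 r2 : R) : r1 < r2 ->
  enorm (curve_map g a - z) <= r1 -> r2 <= enorm (curve_map g b - z) ->
  exists u1 u2 : R, [/\ 0 <= u1, r2 - r1 <= u2 - u1, u2 <= fine (arc_length g a b) &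
    forall u, u1 < u < u2 ->
      B (arc_length_param g a b u) /\ r1 < enorm (arc_length_param g a b u - z) < r2].
Proof.
move=> r12 ha hb.
have [t1 [t2 [at1 t12 t2b [e1 e2] H]]] := shell_crossing ab dist_continuous r12 ha hb.
have t1b := le_trans t12 t2b; have at2 := le_trans at1 t12.
have Va : 0 <= V t1 by rewrite fine_ge0// path_length_ge0.
have Vb : V t2 <= V b.
  by apply: le_trans (V_mono at2 t2b (lexx b)); rewrite lerDl enorm_ge0.
exists (V t1), (V t2); split => //.
- rewrite lerBrDl; apply: le_trans (V_mono at1 t12 t2b); rewrite lerD2l -e1 -e2.
  exact: ler_enorm_center.
- by rewrite arc_lengthE.
move=> u /andP[Vu uV].
have /= [||t /andP[at_ tb] tu] := @path_length_onto _ _ (curve_map g) a b ab cg Goo u.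
- exact: le_trans Va (ltW Vu).
- by rewrite VE// lee_fin (le_trans (ltW uV)).
have /= := @xgetPex _ a [set t | a <= t <= b /\ arc_length g a t = u%:E].
case; first by exists t; rewrite /= arc_lengthE at_ tb.
rewrite /arc_length_param; set t' := xget _ _ => /andP[at' t'b].
rewrite arc_lengthE VE// => -[t'u].
split; first by apply: gB; rewrite at'.
apply: H.
  rewrite ltNge; apply/negP => t't1; move: Vu; rewrite -t'u.
  by have := V_mono at' t't1 t1b; have := enorm_ge0 (curve_map g t1 - curve_map g t'); lra.
rewrite ltNge; apply/negP => t2t'; move: uV; rewrite -t'u.
by have := V_mono at2 t2t' t'b; have := enorm_ge0 (curve_map g t' - curve_map g t2); lra.
Qed.

(** The density along the curve is bounded below by indicators of the parameter intervals of
    [crossing_interval], which are measurable and can be integrated. *)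
Lemma crossing_integral (M : nat) (c r r' : nat -> R) :
  (forall k, (k < M)%N -> [/\ 0 <= c k, r k < r' k,
    enorm (curve_map g a - z) <= r k & r' k <= enorm (curve_map g b - z)]) ->
  ((\sum_(k < M) c k * (r' k - r k))%:E <=
    line_integral_seg (fun x => (\sum_(k < M) c k *
      \1_[set y | B y /\ r k < enorm (y - z) < r' k] (x : 'rV[R]_n))%:E) g a b)%E.
Proof.
move=> H.
have /choice[u1 /choice[u2 uP]] : forall k : 'I_M, exists u1 u2 : R,
  [/\ 0 <= u1, r' k - r k <= u2 - u1, u2 <= fine (arc_length g a b) &
    forall u, u1 < u < u2 ->
      B (arc_length_param g a b u) /\ r k < enorm (arc_length_param g a b u - z) < r' k].
  by move=> k; have [ck rr ha hb] := H k (ltn_ord k); exact: crossing_interval.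
rewrite /line_integral_seg.
apply: (@le_trans _ _ (\int[mu]_(u in `[0%R, fine (arc_length g a b)])
    (\sum_(k < M) (c k * \1_`]u1 k, u2 k[ u)%:E))%E); last first.
  apply: ge0_le_integral_sup => u _.
    by apply: sume_ge0 => k _; rewrite lee_fin mulr_ge0//; have [] := H k (ltn_ord k).
  rewrite sumEFin lee_fin; apply: ler_sum => k _.
  have [ck _ _ _] := H k (ltn_ord k).
  apply: ler_wpM2l => //; rewrite !indicE ler_nat.
  have [uk|//] := boolP (u \in `]u1 k, u2 k[%classic).
  rewrite mem_set//; have [_ _ _] := uP k; apply.
  by move: uk; rewrite inE /= in_itv.
rewrite ge0_integral_sum//; last 2 first.
- by move=> k; apply/measurable_EFinP; apply: measurable_funM.
- move=> k u _; rewrite lee_fin mulr_ge0//; have [//] := H k (ltn_ord k).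
rewrite -sumEFin; apply: lee_sum => k _.
have [ck rr _ _] := H k (ltn_ord k); have [u10 u12 u2L _] := uP k.
under eq_integral do rewrite EFinM.
rewrite ge0_integralZl//; last first.
  by apply/measurable_EFinP.
rewrite integral_indic//.
rewrite setIidl; last first.
  move=> u /=; rewrite !in_itv/= => /andP[uu1 uu2].
  by rewrite (le_trans u10 (ltW uu1)) (le_trans (ltW uu2)).
rewrite /= lebesgue_measure_itv/= lte_fin ifT; last by lra.
by rewrite -EFinB -EFinM lee_fin ler_wpM2l.
Qed.

End crossing.

(** * Upper bound for the modulus of curves leaving a boundary point *)

Section shells.
Context {R : realType} {n : nat}.
Local Notation vol := (@lebesgue_Rn R n).
Implicit Types (r c : R) (a z : 'rV[R]_n).

Definition shell r r' : set (borelRn R n) := [set y | r < enorm (y : 'rV[R]_n) < r'].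

Lemma measurable_enorm_sub z :
  measurable_fun [set: borelRn R n] (fun x : borelRn R n => enorm ((x : 'rV[R]_n) - z)).
Proof.
have := measurableT_comp (@measurable_enorm R n) (measurable_Rn_affine 1 (- z)).
by congr measurable_fun; apply/funext => x /=; rewrite scale1r.
Qed.

Lemma measurable_dotp a : measurable_fun [set: borelRn R n] (fun x : borelRn R n => dotp a x).
Proof.
apply: measurable_sum => i; apply: measurable_funM => //; exact: measurable_coord.
Qed.

Lemma measurable_shell_sub r r' z :
  measurable ([set y | r < enorm (y - z) < r'] : set (borelRn R n)).
Proof.
have := measurable_enorm_sub z measurableT (measurable_itv `]r, r'[).
by rewrite setTI; congr measurable; apply/seteqP; split => x /=; rewrite in_itv.
Qed.

Lemma measurable_shell r r' : measurable (shell r r').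
Proof.
have := measurable_shell_sub r r' 0; congr measurable.
by apply/seteqP; split => x /=; rewrite /shell /= subr0.
Qed.

Lemma measurable_halfspace a : measurable ([set y | dotp a y < 0] : set (borelRn R n)).
Proof.
have := measurable_dotp a measurableT (measurable_itv `]-oo, 0[).
by rewrite setTI; congr measurable; apply/seteqP; split => x /=; rewrite in_itv.
Qed.

Lemma measurable_unit_ball : measurable (@unit_ball R n : set (borelRn R n)).
Proof.
have := @measurable_enorm R n measurableT _ (measurable_itv `]-oo, 1[).
by rewrite setTI; congr measurable; apply/seteqP; split => x /=; rewrite in_itv.
Qed.

Lemma lebesgue_shell_fin r r' : (vol (shell r r') < +oo)%E.
Proof.
apply: (@lebesgue_Rn_bounded _ _ _ r'); first exact: measurable_shell.
by move=> x /= /andP[_ /ltW].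
Qed.

Lemma lebesgue_translate z (A : set (borelRn R n)) : measurable A ->
  vol [set x | A ((x : 'rV[R]_n) - z)] = vol A.
Proof.
move=> mA; rewrite [RHS](@lebesgue_Rn_affine _ _ 1 (- z))// ?oner_neq0//.
rewrite normr1 expr1n mul1e; congr (vol _); apply/seteqP; split => x /=;
  by rewrite scale1r.
Qed.

Lemma lebesgue_scale c (A : set (borelRn R n)) : 0 < c -> measurable A ->
  (vol [set x | A (c^-1 *: (x : 'rV[R]_n))] = (c ^+ n)%:E * vol A)%E.
Proof.
move=> c0 mA; rewrite [in RHS](@lebesgue_Rn_affine _ _ c^-1 0)// ?invr_eq0 ?gt_eqF//.
rewrite muleA -EFinM gtr0_norm ?invr_gt0// -exprMn divff ?gt_eqF// expr1n mul1e.
by congr (vol _); apply/seteqP; split => x /=; rewrite addr0.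
Qed.

Lemma lebesgue_shell_scale c r r' : 0 < c ->
  (vol (shell (c * r)%R (c * r')%R) = (c ^+ n)%:E * vol (shell r r'))%E.
Proof.
move=> c0; rewrite -lebesgue_scale//; last exact: measurable_shell.
congr (vol _); apply/seteqP; split => x; rewrite /shell /= enormZ;
  by rewrite gtr0_norm ?invr_gt0// (mulrC c^-1) ltr_pdivlMr// ltr_pdivrMr// !(mulrC c).
Qed.

Lemma lebesgue_opp (A : set (borelRn R n)) : measurable A ->
  vol [set x | A (- (x : 'rV[R]_n))] = vol A.
Proof.
move=> mA; rewrite [RHS](@lebesgue_Rn_affine _ _ (-1) 0)// ?oppr_eq0 ?oner_neq0//.
rewrite normrN1 expr1n mul1e; congr (vol _); apply/seteqP; split => x /=;
  by rewrite scaleN1r addr0.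
Qed.

(** The half shell and its reflection through the origin are disjoint and have the same volume. *)
Lemma lebesgue_half_shell a r r' :
  (2%:E * vol (shell r r' `&` [set y | dotp a y < 0]%R) <= vol (shell r r'))%E.
Proof.
set H := _ `&` _.
have mH : measurable H by apply: measurableI; [exact: measurable_shell|exact: measurable_halfspace].
have mH' : measurable [set x : borelRn R n | H (- (x : 'rV[R]_n))].
  rewrite (_ : mkset _ = shell r r' `&` [set y | dotp (- a) y < 0]).
    by apply: measurableI; [exact: measurable_shell|exact: measurable_halfspace].
  by apply/seteqP; split => x; rewrite /H /shell /= enormN dotpNr dotpNl.
rewrite (_ : 2%:E = 1%:E + 1%:E)%E; last by rewrite -EFinD.
rewrite ge0_muleDl// !mul1e -[X in (_ + X <= _)%E](lebesgue_opp mH) -measureU//.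
  apply: le_measure; rewrite ?inE//; [exact: measurableU|exact: measurable_shell|].
  by move=> x [[]//|[]]; rewrite /shell /= enormN.
rewrite -subset0 => x [[_ h1] [_ h2]]; move: h1 h2 => /=; rewrite dotpNr; lra.
Qed.

End shells.

Section modulus_upper.
Context {R : realType} {n : nat}.
Local Notation vol := (@lebesgue_Rn R n).
Variables (q r : R) (M : nat) (xi : 'rV[R]_n) (Gam : set (curve R n)).
Hypotheses (n0 : (0 < n)%N) (q1 : 1 < q) (M0 : (0 < M)%N) (xi1 : enorm xi = 1)
  (rM : r <= q ^- M)
  (GamP : forall g, Gam g -> curve_in (@unit_ball R n) g /\
    exists a b, [/\ a \in curve_dom g, b \in curve_dom g, a <= b,
      enorm (curve_map g a - xi) <= r & 1 <= enorm (curve_map g b - xi)]).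

Let q0 : 0 < q. Proof. exact: lt_trans q1. Qed.
Let qM1 : 0 < M%:R * (q - 1). Proof. by rewrite mulr_gt0 ?ltr0n// subr_gt0. Qed.

(** The k-th shell has width (q - 1) q^-(k+1); this density makes each of the M shells contribute
    1/M to a line integral. *)
Let c (k : nat) := (M%:R * (q - 1) * q ^- k.+1)^-1.
Let S (k : nat) : set 'rV[R]_n :=
  [set y | unit_ball y /\ q ^- k.+1 < enorm (y - xi) < q ^- k].

Let c0 k : 0 <= c k.
Proof. by rewrite invr_ge0 mulr_ge0 ?(ltW qM1)// invr_ge0 exprn_ge0// ltW. Qed.

Let mS k : measurable (S k : set (borelRn R n)).
Proof.
rewrite (_ : S k = @unit_ball R n `&` [set y | q ^- k.+1 < enorm (y - xi) < q ^- k])//.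
apply: measurableI; last exact: measurable_shell_sub.
exact: measurable_unit_ball.
Qed.

Let rho : borelRn R n -> \bar R := fun x => (\sum_(k < M) c k * \1_(S k) (x : 'rV[R]_n))%:E.

Let mrho : measurable_fun [set: borelRn R n] rho.
Proof.
apply/measurable_EFinP; apply: measurable_sum => k; exact: measurable_funM.
Qed.

Let shell_width k : q ^- k - q ^- k.+1 = (q - 1) * q ^- k.+1.
Proof.
have qk : q ^+ k != 0 by rewrite expf_neq0 ?gt_eqF.
rewrite exprS invfM mulrBl mulrA divff ?gt_eqF// mul1r; field.
by rewrite qk gt_eqF.
Qed.

Let admissible_rho : admissible Gam rho.
Proof.
split; first exact: mrho.
  by move=> x; rewrite lee_fin sumr_ge0// => k _; rewrite mulr_ge0.
move=> g Gg grect.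
have [[_ cg gB] [a [b [aD bD ab ha hb]]]] := GamP Gg.
apply: ereal_sup_ge; exists (line_integral_seg rho g a b); first by exists a, b.
have abD : [set` `[a, b]] `<=` [set` curve_dom g].
  move=> t /=; rewrite in_itv/= => tab.
  exact: (interval_is_interval aD bD tab).
have -> : 1%E = (\sum_(k < M) c k * (q ^- k - q ^- k.+1))%:E :> \bar R.
  congr EFin; rewrite (eq_bigr (fun=> M%:R^-1)) => [|k _].
    by rewrite sumr_const card_ord -[RHS]mulr_natl divff// pnatr_eq0 -lt0n.
  rewrite shell_width /c -!mulrA invfM -mulrA -[RHS]mulr1; congr (_ * _).
  by rewrite mulVf// mulf_neq0// ?subr_eq0 ?gt_eqF// invr_gt0 exprn_gt0.
apply: (@crossing_integral _ _ g a b xi (@unit_ball R n) ab _ _ _ M c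
  (fun k => q ^- k.+1) (fun k => q ^- k)).
- exact: continuous_subspaceW abD cg.
- exact: grect.
- by move=> t tab; apply: gB; exists t => //; apply: abD; rewrite /= in_itv.
- move=> k kM; split => //.
  + by rewrite -subr_gt0 shell_width mulr_gt0 ?subr_gt0// invr_gt0 exprn_gt0.
  + apply: le_trans ha (le_trans rM _).
    by rewrite lef_pV2 ?posrE ?exprn_gt0// ler_eXn2l.
  + apply: le_trans hb; rewrite invf_le1 ?exprn_gt0//; exact: exprn_ege1 (ltW q1).
Qed.

(** The shells are disjoint, so at most one term of the sum is nonzero at x. *)
Let rho_pow x : (rho x ^+ n <= \sum_(k < M) (c k ^+ n * \1_(S k) (x : 'rV[R]_n))%:E)%E.
Proof.
rewrite /rho sumEFin -EFin_expe lee_fin.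
have [[k xS]|xS] := pselect (exists k : 'I_M, S k x); last first.
  rewrite big1 ?expr0n ?gtn_eqF//=; last first.
    by move=> k _; rewrite indicE memNset ?mulr0// => Sx; apply: xS; exists k.
  by rewrite sumr_ge0// => k _; rewrite mulr_ge0// exprn_ge0.
have xS' (j : 'I_M) : j != k -> \1_(S j) (x : 'rV[R]_n) = 0 :> R.
  move=> jk; rewrite indicE memNset// => -[_ /andP[j1 j2]].
  have [_ /andP[k1 k2]] := xS.
  move: jk; rewrite neq_ltn => /orP[jk|kj].
    have : q ^- k <= q ^- j.+1 by rewrite lef_pV2 ?posrE ?exprn_gt0// ler_eXn2l.
    lra.
  have : q ^- j <= q ^- k.+1 by rewrite lef_pV2 ?posrE ?exprn_gt0// ler_eXn2l.
  lra.
rewrite (bigD1 k)//= big1 ?addr0 => [|j jk]; last by rewrite xS' ?mulr0.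
rewrite (bigD1 k)//= big1 ?addr0 => [|j jk]; last by rewrite xS' ?mulr0.
by rewrite indicE mem_set// !mulr1.
Qed.

(* Since |xi| = 1, the points y of the unit ball satisfy y.xi < 1, so only half
   of each shell around xi counts. *)
Let vol_S k : (vol (S k) <= (2^-1 * fine (vol (shell 1 q)) * (q ^- k.+1) ^+ n)%:E)%E.
Proof.
have qk : 0 < q ^- k.+1 by rewrite invr_gt0 exprn_gt0.
have : (vol (S k) <= vol (shell (q ^- k.+1) (q ^- k) `&` [set y | dotp xi y < 0]%R))%E.
  rewrite -[leRHS](lebesgue_translate xi); last first.
    by apply: measurableI; [exact: measurable_shell|exact: measurable_halfspace].
  apply: le_measure; rewrite ?inE//.
    rewrite (_ : mkset _ = [set y | q ^- k.+1 < enorm (y - xi) < q ^- k] `&`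
       [set y | dotp xi (y - xi) < 0])//.
    apply: measurableI; first exact: measurable_shell_sub.
    have := measurable_dotp xi measurableT (measurable_itv `]-oo, 1[).
    rewrite setTI; congr measurable; apply/seteqP; split => x /=; rewrite in_itv /=;
      by rewrite dotpDr dotpNr -sqr_enorm xi1 expr1n subr_lt0.
  move=> x [Bx Sx]; split => //=; move: Bx; rewrite /unit_ball /= enorm_lt_sqr//.
  have := dotp_ge0 (x - xi); rewrite !(dotpDl, dotpDr, dotpNl, dotpNr).
  rewrite (dotpC x xi) -(sqr_enorm xi) xi1; lra.
move=> h; have := lebesgue_half_shell xi (q ^- k.+1) (q ^- k).
have -> : shell (q ^- k.+1) (q ^- k) = shell (q ^- k.+1 * 1) (q ^- k.+1 * q) :> set (borelRn R n).
  congr shell; first by rewrite mulr1.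
  by rewrite exprS invfM mulrAC mulVf ?mul1r// gt_eqF.
rewrite lebesgue_shell_scale//.
have vfin : vol (shell 1 q) \is a fin_num by rewrite ge0_fin_numE// lebesgue_shell_fin.
set w := fine _; have -> : vol (shell 1 q) = w%:E by rewrite fineK.
rewrite -EFinM -lee_pdivlMl// -EFinM => h'.
apply: le_trans (_ : _ <= vol (shell (q ^- k.+1) (q ^- k) `&` [set y | dotp xi y < 0]%R))%E _ => //.
apply: le_trans (_ : _ <= (2^-1 * (q ^- k.+1 ^+ n * w))%:E)%E _.
  move: h'; congr (vol (_ `&` _) <= _)%E; congr shell; first by rewrite mulr1.
  by rewrite exprS invfM mulrAC mulVf ?mul1r// gt_eqF.
rewrite lee_fin.
by rewrite mulrA mulrAC.
Qed.

(** The n-th power of the density scales inversely to the volume, so all M shells contribute the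
    same amount. *)
Lemma modulus_ring_upper :
  (modulus Gam <= (2^-1 * fine (vol (shell 1 q)) * M%:R / (M%:R * (q - 1)) ^+ n)%:E)%E.
Proof.
apply: (@le_trans _ _ (\int[vol]_x (rho x ^+ n))%E).
  by apply: ereal_inf_lbound; exists rho.
apply: (@le_trans _ _ (\int[vol]_x (\sum_(k < M) (c k ^+ n * \1_(S k) (x : 'rV[R]_n))%:E))%E).
  apply: ge0_le_integral_sup => x _; last exact: rho_pow.
  by apply: expe_ge0; rewrite lee_fin sumr_ge0// => k _; rewrite mulr_ge0.
rewrite ge0_integral_sum//; last 2 first.
- by move=> k; apply/measurable_EFinP; exact: measurable_funM.
- by move=> k x _; rewrite lee_fin mulr_ge0// exprn_ge0.
apply: (@le_trans _ _ (\sum_(k < M) (2^-1 * fine (vol (shell 1 q)) / (M%:R * (q - 1)) ^+ n)%:E)%E).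
  apply: lee_sum => k _.
  under eq_integral do rewrite EFinM.
  rewrite ge0_integralZl//; last 2 first.
  - by apply/measurable_EFinP.
  - by rewrite lee_fin exprn_ge0.
  rewrite integral_indic// setIT.
  apply: le_trans (lee_wpmul2l _ (vol_S k)) _; first by rewrite lee_fin exprn_ge0.
  rewrite -EFinM lee_fin /c invfM exprMn invrK !exprVn.
  have qk : (q ^+ k.+1) ^+ n / (q ^+ k.+1) ^+ n = 1.
    by rewrite divff// !expf_neq0// gt_eqF.
  by rewrite mulrACA qk mulr1 mulrC.
by rewrite sumEFin lee_fin sumr_const card_ord -[leLHS]mulr_natr mulrAC.
Qed.

End modulus_upper.

(** * Segments and polygons *)

Section integral_subadditive.
Local Open Scope ereal_scope.
Context d (T : measurableType d) (R : realType) (mu : {measure set T -> \bar R}).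

Lemma ge0_integral_cover (A B C : set T) (f : T -> \bar R) :
  measurable B -> measurable C -> A `<=` B `|` C ->
  measurable_fun [set: T] f -> (forall x, 0 <= f x) ->
  \int[mu]_(x in A) f x <= \int[mu]_(x in B) f x + \int[mu]_(x in C) f x.
Proof.
move=> mB mC ABC mf f0; rewrite !(integral_mkcond _ f) -ge0_integralD//.
- apply: ge0_le_integral_sup => x _; first exact: erestrict_ge0.
  rewrite /patch; case: ifPn => [|_].
    rewrite inE => /ABC[Bx|Cx].
      by rewrite (mem_set Bx) leeDl//; case: ifP.
    by rewrite (mem_set Cx) leeDr//; case: ifP.
  by rewrite adde_ge0//; case: ifP.
- by move=> x _; exact: erestrict_ge0.
- by apply/(measurable_restrictT _ _).1 => //; exact: measurable_funTS.
- by move=> x _; exact: erestrict_ge0.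
- by apply/(measurable_restrictT _ _).1 => //; exact: measurable_funTS.
Qed.

End integral_subadditive.

Section segments.
Context {R : realType} {n : nat}.
Local Notation mu := (@lebesgue_measure R).
Implicit Types (x y u a : 'rV[R]_n) (rho : borelRn R n -> \bar R).

(** The integral of [rho] with respect to length along the segment from x to y. The time interval
    [0, 1] is the same for all endpoints, which permits exchanging it with integrals over the
    endpoints. *)
Definition segment_integral rho x y : \bar R :=
  ((enorm (y - x))%:E * \int[mu]_(t in `[0%R, 1%R]) rho (x + t *: (y - x))%R)%E.

Definition clamp (l t : R) : R := Num.min (Num.max t 0) l.

Lemma clamp_mono l s t : s <= t -> clamp l s <= clamp l t.
Proof.
move=> st; rewrite /clamp le_min !ge_min lexx orbT andbT.
by rewrite !ge_max !le_max st lexx orbT.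
Qed.

Lemma clamp_lip l s t : `|clamp l s - clamp l t| <= `|s - t|.
Proof.
wlog st : s t / s <= t.
  move=> H; have [st|ts] := leP s t; first exact: H.
  by rewrite distrC (distrC s); apply: H; exact: ltW.
rewrite distrC (distrC s) !ger0_norm ?subr_ge0 ?clamp_mono//.
have sm : s <= Num.max s 0 by rewrite le_max lexx.
have m0 : 0 <= Num.max s 0 by rewrite le_max lexx orbT.
rewrite lerBlDr /clamp addr_minr le_min !ge_min ge_max; apply/andP; split.
  by apply/orP; left; apply/andP; split; lra.
by apply/orP; right; lra.
Qed.

Lemma clamp_ge0 l t : 0 <= l -> 0 <= clamp l t.
Proof. by move=> l0; rewrite /clamp le_min le_max lexx orbT. Qed.

Lemma clamp_le l t : clamp l t <= l.
Proof. by rewrite /clamp ge_min lexx orbT. Qed.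

Lemma clamp_lo l t : 0 <= l -> t <= 0 -> clamp l t = 0.
Proof. by move=> l0 t0; rewrite /clamp max_r// min_l. Qed.

Lemma clamp_id l t : 0 <= t -> t <= l -> clamp l t = t.
Proof. by move=> t0 tl; rewrite /clamp max_l// min_l. Qed.

Lemma clamp_hi l t : 0 <= l -> l <= t -> clamp l t = l.
Proof. by move=> l0 lt_; rewrite /clamp max_l ?(le_trans l0)// min_r. Qed.

Lemma measurable_clamp l : measurable_fun [set: R] (clamp l).
Proof.
by apply: nondecreasing_measurable => // s t; exact: clamp_mono.
Qed.

Lemma ball_segment x y r t : enorm x < r -> enorm y < r -> 0 <= t -> t <= 1 ->
  enorm (x + t *: (y - x)) < r.
Proof.
move=> xr yr t0 t1.
have -> : x + t *: (y - x) = (1 - t) *: x + t *: y.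
  by apply/rowP => i; rewrite !mxE; ring.
apply: le_lt_trans (ler_enormD _ _) _; rewrite !enormZ !ger0_norm ?subr_ge0//.
have [->|tp] := eqVneq t 0; first by rewrite subr0 mul0r addr0 mul1r.
have {}tp : 0 < t by rewrite lt_neqAle eq_sym tp.
rewrite (_ : r = (1 - t) * r + t * r); last by ring.
apply: ler_ltD; last by rewrite ltr_pM2l.
by apply: ler_wpM2l (ltW xr); rewrite subr_ge0.
Qed.

(** When x = y the direction is the first basis vector, so polygons with repeated vertices need no
    special treatment. *)
Lemma unit_direction x y : (0 < n)%N ->
  exists2 u, enorm u = 1 & y - x = enorm (y - x) *: u.
Proof.
move=> n0; have [->|xy] := eqVneq (y - x) 0.
  exists (\row_j (j == Ordinal n0)%:R); last by rewrite enorm0 scale0r.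
  rewrite /enorm (bigD1 (Ordinal n0))//= mxE eqxx expr1n big1 ?addr0 ?sqrtr1//.
  by move=> j j0; rewrite mxE (negbTE j0) expr0n.
have e0 : enorm (y - x) != 0 by rewrite enorm_eq0.
exists ((enorm (y - x))^-1 *: (y - x)).
  by rewrite enormZ ger0_norm ?invr_ge0 ?enorm_ge0// mulVf.
by rewrite scalerA mulfV// scale1r.
Qed.

Lemma measurable_line x u : measurable_fun [set: R] ((fun t => x + t *: u) : R -> borelRn R n).
Proof.
apply: measurable_rowP => i.
rewrite (_ : (fun _ => _) = fun t => x 0 i + t * u 0 i).
  by apply: measurable_funD => //; exact: measurable_funM.
by apply/funext => t; rewrite !mxE.
Qed.

Lemma integral_segment rho (g : R -> 'rV[R]_n) x y u (s : R) :
  measurable_fun [set: borelRn R n] rho -> (forall z, 0 <= rho z)%E ->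
  y - x = enorm (y - x) *: u ->
  (forall t, s <= t -> t <= s + enorm (y - x) -> g t = x + (t - s) *: u) ->
  (\int[mu]_(t in `[s, (s + enorm (y - x))%R]) rho (g t) = segment_integral rho x y)%E.
Proof.
move=> mrho rho0 xyu gE; rewrite /segment_integral.
transitivity (\int[mu]_(t in `[s, (s + enorm (y - x))%R]) rho (x + (t - s) *: u)%R)%E.
  by apply: eq_integral => t; rewrite inE /= in_itv/= => /andP[st ts]; rewrite gE.
have [l0|l0] := eqVneq (enorm (y - x)) 0.
  by rewrite l0 mul0e addr0 set_itv1 integral_set1.
have {}l0 : 0 < enorm (y - x) by rewrite lt_neqAle eq_sym l0 enorm_ge0.
set l := enorm (y - x) in l0 *.
have -> : `[s, (s + l)%R]%classic = `[(l * 0 + s)%R, (l * 1 + s)%R]%classic :> set R.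
  by rewrite mulr0 add0r mulr1 addrC.
have mline : measurable_fun [set: R] (fun t => rho (x + (t - s) *: u)).
  rewrite (_ : (fun _ => _) = rho \o (fun t => (x - s *: u) + t *: u)).
    by apply: measurableT_comp => //; exact: measurable_line.
  by apply/funext => t /=; rewrite scalerBl addrA addrAC.
rewrite ge0_integral_itv_affine//; congr (_ * _)%E.
by apply: eq_integral => t _; rewrite addrK xyu -/l scalerA mulrC.
Qed.

End segments.

Section polygon.
Context {R : realType} {n : nat}.
Local Notation mu := (@lebesgue_measure R).
Variables (a0 a1 a2 a3 u1 u2 u3 : 'rV[R]_n).
Hypotheses (U1 : enorm u1 = 1) (U2 : enorm u2 = 1) (U3 : enorm u3 = 1).
Let l1 := enorm (a1 - a0).
Let l2 := enorm (a2 - a1).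
Let l3 := enorm (a3 - a2).
Hypotheses (E1 : a1 - a0 = l1 *: u1) (E2 : a2 - a1 = l2 *: u2)
  (E3 : a3 - a2 = l3 *: u3).
Let L := l1 + l2 + l3.

(** Each clamped term runs along its own side and then stops. One formula serves all times, and even
    off [0, L] the polygon stays on its sides. *)
Definition polygon (t : R) : 'rV[R]_n :=
  a0 + clamp l1 t *: u1 + clamp l2 (t - l1) *: u2 + clamp l3 (t - (l1 + l2)) *: u3.

Let l1_ge0 : 0 <= l1. Proof. exact: enorm_ge0. Qed.
Let l2_ge0 : 0 <= l2. Proof. exact: enorm_ge0. Qed.
Let l3_ge0 : 0 <= l3. Proof. exact: enorm_ge0. Qed.

Let a1E : a0 + l1 *: u1 = a1. Proof. by rewrite -E1 addrC subrK. Qed.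
Let a2E : a1 + l2 *: u2 = a2. Proof. by rewrite -E2 addrC subrK. Qed.
Let a3E : a2 + l3 *: u3 = a3. Proof. by rewrite -E3 addrC subrK. Qed.

Lemma polygon1 t : t <= l1 -> polygon t = a0 + clamp l1 t *: u1.
Proof.
move=> t1; have t2 : t <= l1 + l2 by apply: le_trans t1 _; rewrite lerDl.
by rewrite /polygon (@clamp_lo _ l2) ?(@clamp_lo _ l3) ?subr_le0// !scale0r !addr0.
Qed.

Lemma polygon2 t : l1 <= t -> t <= l1 + l2 -> polygon t = a1 + clamp l2 (t - l1) *: u2.
Proof.
move=> t1 t2; rewrite /polygon (clamp_hi l1_ge0 t1) a1E.
by rewrite (@clamp_lo _ l3) ?subr_le0// scale0r addr0.
Qed.

Lemma polygon3 t : l1 + l2 <= t -> polygon t = a2 + clamp l3 (t - (l1 + l2)) *: u3.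
Proof.
move=> t12; have t1 : l1 <= t by apply: le_trans t12; rewrite lerDl.
rewrite /polygon (clamp_hi l1_ge0 t1) a1E.
by rewrite (@clamp_hi _ l2) ?a2E// lerBrDl.
Qed.

Lemma polygon_start : polygon 0 = a0.
Proof. by rewrite polygon1// clamp_lo// scale0r addr0. Qed.

Lemma polygon_end : polygon L = a3.
Proof.
rewrite polygon3 /L ?lerDl// (_ : _ - _ = l3); last by ring.
by rewrite clamp_hi.
Qed.

Lemma polygon_ball r t : enorm a0 < r -> enorm a1 < r -> enorm a2 < r -> enorm a3 < r ->
  enorm (polygon t) < r.
Proof.
move=> h0 h1 h2 h3.
have H (x y u : 'rV[R]_n) c : enorm x < r -> enorm y < r -> y - x = enorm (y - x) *: u ->
    0 <= c -> c <= enorm (y - x) -> enorm (x + c *: u) < r.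
  move=> hx hy xyu c0 cl; have [l0|l0] := eqVneq (enorm (y - x)) 0.
    have -> : c = 0 by apply/eqP; rewrite eq_le c0 andbT -l0.
    by rewrite scale0r addr0.
  have lp : 0 < enorm (y - x) by rewrite lt_neqAle eq_sym l0 enorm_ge0.
  have -> : c *: u = (c / enorm (y - x)) *: (y - x).
    transitivity ((c / enorm (y - x)) *: (enorm (y - x) *: u)); last by rewrite -xyu.
    by rewrite scalerA divfK.
  apply: ball_segment => //; first by rewrite divr_ge0 ?enorm_ge0.
  by rewrite ler_pdivrMr// mul1r.
have [t1|/ltW t1] := leP t l1.
  by rewrite polygon1//; apply: (H a0 a1) => //; [exact: clamp_ge0|exact: clamp_le].
have [t2|/ltW t2] := leP t (l1 + l2).
  by rewrite polygon2//; apply: (H a1 a2) => //; [exact: clamp_ge0|exact: clamp_le].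
by rewrite polygon3//; apply: (H a2 a3) => //; [exact: clamp_ge0|exact: clamp_le].
Qed.

(** One unit for each side: a crude constant, used for continuity only. *)
Lemma polygon_lip s t : enorm (polygon s - polygon t) <= 3 * `|s - t|.
Proof.
have -> : polygon s - polygon t = (clamp l1 s - clamp l1 t) *: u1 +
   (clamp l2 (s - l1) - clamp l2 (t - l1)) *: u2 +
   (clamp l3 (s - (l1 + l2)) - clamp l3 (t - (l1 + l2))) *: u3.
  by rewrite /polygon; apply/rowP => i; rewrite !mxE; ring.
apply: le_trans (ler_enormD _ _) _.
have -> : 3 * `|s - t| = (`|s - t| + `|s - t|) + `|s - t| by ring.
apply: lerD; first (apply: le_trans (ler_enormD _ _) _; apply: lerD).
- by rewrite enormZ U1 mulr1 clamp_lip.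
- rewrite enormZ U2 mulr1; apply: le_trans (clamp_lip _ _ _) _.
  by rewrite subr_subrr.
- rewrite enormZ U3 mulr1; apply: le_trans (clamp_lip _ _ _) _.
  by rewrite subr_subrr.
Qed.

Lemma measurable_polygon : measurable_fun [set: R] (polygon : R -> borelRn R n).
Proof.
have mcl l b c : measurable_fun [set: R] (fun t => clamp l (t - b) * c : R).
  apply: measurable_funM => //.
  by apply: (measurableT_comp (measurable_clamp l)); exact: measurable_funB.
apply: measurable_rowP => i.
rewrite (_ : (fun _ => _) = fun t => a0 0 i + clamp l1 (t - 0) * u1 0 i +
   clamp l2 (t - l1) * u2 0 i + clamp l3 (t - (l1 + l2)) * u3 0 i).
  by do 3 apply: measurable_funD => //.
by apply/funext => t; rewrite /polygon !mxE subr0.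
Qed.

Lemma polygon_unit_speed : unit_speed polygon L.
Proof.
have H (x u : 'rV[R]_n) b c : enorm u = 1 -> (forall t, b <= t -> t <= c -> polygon t = x + (t - b) *: u) ->
    forall s t, b <= s -> s <= t -> t <= c -> path_length polygon s t = (t - s)%:E.
  move=> u_1 gE s t bs st tc; apply: path_length_isometry => // v w sv vw wt.
  have vc := le_trans vw (le_trans wt tc); have bv := le_trans bs sv.
  rewrite !gE ?(le_trans bv vw) ?(le_trans wt tc)//.
  have -> : x + (w - b) *: u - (x + (v - b) *: u) = (w - v) *: u.
    by apply/rowP => i; rewrite !mxE; ring.
  by rewrite enormZ u_1 mulr1 ger0_norm// subr_ge0.
apply: (@unit_speed_cat _ _ _ (l1 + l2)); rewrite ?addr_ge0 ?lerDl//.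
  apply: (@unit_speed_cat _ _ _ l1); rewrite ?lerDl//.
    apply: (H a0 u1) => // t t0 t1; rewrite polygon1// clamp_id ?subr0//.
  apply: (H a1 u2) => // t t0 t1; rewrite polygon2// clamp_id ?subr_ge0//; lra.
apply: (H a2 u3) => // t t0 t1; rewrite polygon3// clamp_id ?subr_ge0//.
by rewrite /L in t1; lra.
Qed.

Lemma integral_polygon rho :
  measurable_fun [set: borelRn R n] rho -> (forall z, 0 <= rho z)%E ->
  (\int[mu]_(t in `[0%R, L]) rho (polygon t) <= segment_integral rho a0 a1 +
    (segment_integral rho a1 a2 + segment_integral rho a2 a3))%E.
Proof.
move=> mrho rho0.
have mr : measurable_fun [set: R] (rho \o polygon).
  by apply: measurableT_comp => //; exact: measurable_polygon.
have i1 := @integral_segment _ _ rho polygon a0 a1 u1 0 mrho rho0 E1.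
have i2 := @integral_segment _ _ rho polygon a1 a2 u2 l1 mrho rho0 E2.
have i3 := @integral_segment _ _ rho polygon a2 a3 u3 (l1 + l2) mrho rho0 E3.
rewrite -i1; last first.
  by move=> t t0; rewrite add0r => t1; rewrite polygon1// clamp_id ?subr0.
rewrite -i2; last first.
  move=> t t0 t1; rewrite polygon2// clamp_id ?subr_ge0//; rewrite -/l2 in t1; lra.
rewrite -i3; last first.
  move=> t t0 t1; rewrite polygon3// clamp_id ?subr_ge0//; rewrite -/l3 in t1; lra.
rewrite -/l1 -/l2 -/l3 add0r.
have r0 t : (0 <= (rho \o polygon) t)%E by exact: rho0.
have c1 : `[0, L]%classic `<=` `[0, l1]%classic `|` `[l1, L]%classic.
  move=> t /=; rewrite !in_itv/= => /andP[t1 tL].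
  by have [t2|/ltW t2] := leP t l1; [left|right]; rewrite ?t1 ?t2.
have c2 : `[l1, L]%classic `<=` `[l1, (l1 + l2)]%classic `|` `[(l1 + l2), (l1 + l2 + l3)]%classic.
  move=> t /=; rewrite !in_itv/= => /andP[t1 tL].
  by have [t2|/ltW t2] := leP t (l1 + l2); [left|right]; rewrite ?t1 ?t2.
apply: le_trans (ge0_integral_cover mu _ _ c1 mr r0) _ => //.
by apply: leeD2l; exact: (ge0_integral_cover mu _ _ c2 mr r0).
Qed.

End polygon.

Section polygonal_curve.
Context {R : realType} {n : nat}.

(** The bound of the line integral by three segment integrals is what turns admissibility into a
    lower bound for their sum. The ball contains [g t] at all times because the curve families of
    [distortion_step] demand it. *)
Lemma polygonal_curve (a0 a1 a2 a3 : 'rV[R]_n) : (0 < n)%N ->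
  unit_ball a0 -> unit_ball a1 -> unit_ball a2 -> unit_ball a3 ->
  exists (g : R -> 'rV[R]_n) (L : R), let G := Curve `[0, L] g in
  [/\ 0 <= L, g 0 = a0, g L = a3,
    [/\ forall t, unit_ball (g t), forall J, {within J, continuous g} & locally_rectifiable G] &
    forall rho, measurable_fun [set: borelRn R n] rho -> (forall z, 0 <= rho z)%E ->
      (line_integral rho G <= segment_integral rho a0 a1 +
        (segment_integral rho a1 a2 + segment_integral rho a2 a3))%E].
Proof.
move=> n0 h0 h1 h2 h3.
have [u1 U1 E1] := unit_direction a0 a1 n0.
have [u2 U2 E2] := unit_direction a1 a2 n0.
have [u3 U3 E3] := unit_direction a2 a3 n0.
pose L := enorm (a1 - a0) + enorm (a2 - a1) + enorm (a3 - a2).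
pose g := polygon a0 a1 a2 a3 u1 u2 u3.
have us : unit_speed g L by exact: polygon_unit_speed.
exists g, L => G; split.
- by rewrite !addr_ge0// enorm_ge0.
- exact: polygon_start.
- exact: polygon_end.
- split; first by move=> t; exact: polygon_ball.
    move=> J; apply/within_continuous_pathP => t _ e e0; exists (e / 3) => [|s _ ts].
      by rewrite divr_gt0.
    apply: le_lt_trans (polygon_lip _ _ _ _ U1 U2 U3 _ _) _.
    by rewrite mulrC -ltr_pdivlMr.
  move=> a b; rewrite !in_itv/= => /andP[a_ge0 _] /andP[_ bL] ab.
  by rewrite arc_lengthE us// ltry.
- move=> rho mrho rho0; apply: le_trans (integral_polygon E1 E2 E3 mrho rho0).
  apply: line_integral_unit_speed => //; exact: measurable_polygon.
Qed.

End polygonal_curve.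

(** * Lower bound for the modulus of curves joining two paths *)

Section root_weight.
Context {R : realType}.
Local Notation mu := (@lebesgue_measure R).

Lemma integral_powR_le (n : nat) : (0 < n)%N ->
  (\int[mu]_(t in `]0%R, 1%R]) (t `^ (n%:R^-1 - 1))%:E <= n%:R%:E)%E.
Proof.
move=> n0; have n0' : n%:R != 0 :> R by rewrite pnatr_eq0 -lt0n.
pose f (t : R) := t `^ (n%:R^-1 - 1).
have f0 t : (0 <= (f t)%:E)%E by rewrite lee_fin powR_ge0.
have mf D : measurable_fun D (fun t => (f t)%:E).
  by apply/measurable_EFinP; apply: measurable_funTS; exact: measurable_powR.
have fin_int (e : R) : 0 < e -> e < 1 ->
    (\int[mu]_(t in `[e, 1%R]) (f t)%:E <= n%:R%:E)%E.
  move=> e0 e1; pose F (t : R) := n%:R * t `^ (n%:R^-1).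
  have dF (t : R) : 0 < t -> is_derive t 1 F (f t).
    move=> t0; have hd := is_derive1_powR (n%:R^-1) t0.
    have -> : F = n%:R \*: (@powR R ^~ (n%:R^-1)) by [].
    have -> : f t = n%:R *: (n%:R^-1 * t `^ (n%:R^-1 - 1)).
      by rewrite /f /GRing.scale /= mulrA mulfV// mul1r.
    exact: is_deriveZ.
  have cF (t : R) : 0 < t -> {for t, continuous F}.
    move=> t0; apply: differentiable_continuous; apply/derivable1_diffP.
    by have [] := dF t t0.
  rewrite (@continuous_FTC2 _ f F)//.
  - by rewrite -EFinB lee_fin /F powR1 mulr1 lerBlDr lerDl mulr_ge0// powR_ge0.
  - apply: derivable_within_continuous => t; rewrite in_itv/= => /andP[et _].
    by apply: derivable_powR; rewrite in_itv/= andbT (lt_le_trans e0).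
  - split.
    + move=> t; rewrite in_itv/= => /andP[et _].
      by have [] := dF t (lt_trans e0 et).
    + by apply: cvg_at_right_filter; exact: cF.
    + by apply: cvg_at_left_filter; exact: cF.
  - move=> t; rewrite in_itv/= => /andP[et _].
    by rewrite derive1E; have [_ ->] := dF t (lt_trans e0 et).
pose A k : set R := `[k.+2%:R^-1, 1]%classic.
have -> : `]0, 1]%classic = \bigcup_k A k :> set R.
  apply/seteqP; split => [t /=|t [k _] /=]; rewrite !in_itv/=.
    move=> /andP[t0 t1]; exists (Num.bound t^-1) => //; rewrite /A /= in_itv/= t1 andbT.
    rewrite invf_ple ?posrE//; apply: ltW; apply: lt_le_trans (archi_boundP _) _.
      by rewrite invr_ge0 ltW.
    by rewrite ler_nat -addn2 leq_addr.
  by rewrite /A /= in_itv/= => /andP[kt ->]; rewrite andbT (lt_le_trans _ kt)// invr_gt0.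
have ndA : nondecreasing_seq A.
  apply/nondecreasing_seqP => k; rewrite subsetEset => t; rewrite /A /= !in_itv/=.
  move=> /andP[kt ->]; rewrite andbT (le_trans _ kt)// lef_pV2 ?posrE//.
  by rewrite ler_nat.
have := @ge0_nondecreasing_set_cvg_integral _ (measurableTypeR R) _ A (fun t => (f t)%:E) mu ndA
  (fun=> measurable_itv _) (fun=> mf _) (fun _ _ _ => f0 _).
move=> /cvg_lim <-//; apply: lime_le.
  apply: ereal_nondecreasing_is_cvgn.
  move=> i j ij; apply: ge0_subset_integral => //; try exact: measurable_itv.
    exact: mf.
  exact/subsetPset/ndA.
apply: nearW => k; apply: fin_int; first by rewrite invr_gt0.
by rewrite invf_lt1// ltr1n.
Qed.

(** The weight is t^(-1/n). It serves in [link_integral], where it balances two terms so that both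
    become integrable at t = 0. *)
Lemma root_weight (n : nat) : (0 < n)%N -> exists w : R -> R,
  [/\ measurable_fun [set: R] w, forall t, 0 < t -> 0 < w t,
      forall t, 0 < t -> w t ^+ n * t = 1 &
      (\int[mu]_(t in `]0%R, 1%R]) (w t ^+ n.-1)%:E <= n%:R%:E)%E].
Proof.
move=> n0; have n0' : n%:R != 0 :> R by rewrite pnatr_eq0 -lt0n.
exists (fun t => t `^ (- n%:R^-1)); split.
- exact: measurable_powR.
- by move=> t t0; rewrite powR_gt0.
- move=> t t0; rewrite -powR_mulrn ?powR_ge0// -powRrM mulNr mulVf//.
  by rewrite powR_inv1 ?(ltW t0)// mulVf// gt_eqF.
apply: le_trans (integral_powR_le n0); apply: ge0_le_integral_sup => t _.
  by rewrite lee_fin exprn_ge0// powR_ge0.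
rewrite lee_fin -powR_mulrn ?powR_ge0// -powRrM mulNr.
suff -> : - (n%:R^-1 * n.-1%:R) = n%:R^-1 - 1 :> R by [].
by case: n n0 n0' => // m _ m0; rewrite /= -natr1 in m0 *; field.
Qed.

End root_weight.

(** Either x <= c, or (x / c)^(n-1) >= 1. This stands in for Hoelder's inequality and leaves c free
    to depend on other variables. *)
Lemma le_expe_linear {R : realType} (n : nat) (c : R) (x : \bar R) : (0 < n)%N ->
  0 < c -> (0 <= x)%E -> (x <= (c ^- n.-1)%:E * x ^+ n + c%:E)%E.
Proof.
move=> n0 c0; have cn : 0 < c ^- n.-1 by rewrite invr_gt0 exprn_gt0.
case: x => [x| |//]; last first.
  move=> _; case: n n0 cn => // m _ cm.
  have -> : (+oo ^+ m.+1 = +oo :> \bar R)%E.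
    elim: m {cm} => [|m IH]; first by rewrite expeS expe0 mule1.
    by rewrite expeS IH mulyy.
  by rewrite gt0_muley ?lte_fin.
rewrite lee_fin -EFin_expe -EFinM -EFinD lee_fin => x0.
have [xc|cx] := leP x c.
  by rewrite ler_wpDl// mulr_ge0 ?(ltW cn)// exprn_ge0.
rewrite ler_wpDr ?(ltW c0)// mulrC ler_pdivlMr ?exprn_gt0//.
case: n n0 {cn} => // m _ /=; rewrite exprS ler_wpM2l//.
by apply: lerXn2r; rewrite ?nnegrE ?(ltW c0)// ltW.
Qed.

Lemma measurable_expe d (T : measurableType d) {R : realType} (n : nat) (f : T -> \bar R) :
  measurable_fun [set: T] f -> measurable_fun [set: T] (fun x => (f x ^+ n)%E).
Proof.
move=> mf; elim: n => [|n IH].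
  by under eq_fun do rewrite expe0; exact: measurable_cst.
by under eq_fun do rewrite expeS; exact: emeasurable_funM.
Qed.

Section triple_tonelli.
Local Open Scope ereal_scope.
Context d1 d2 d3 (T1 : measurableType d1) (T2 : measurableType d2)
  (T3 : measurableType d3) (R : realType).
Variables (m1 : {sigma_finite_measure set T1 -> \bar R})
  (m2 : {sigma_finite_measure set T2 -> \bar R})
  (m3 : {sigma_finite_measure set T3 -> \bar R}).
Variables (A : set T1) (B : set T2) (C : set T3) (g : T1 * (T2 * T3) -> \bar R).
Hypotheses (mA : measurable A) (mB : measurable B) (mC : measurable C)
  (mg : measurable_fun [set: T1 * (T2 * T3)] g) (g0 : forall p, 0 <= g p).

Lemma tonelli_on3 :
  \int[m1]_(x in A) \int[m2]_(y in B) \int[m3]_(z in C) g (x, (y, z)) =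
  \int[m3]_(z in C) \int[m2]_(y in B) \int[m1]_(x in A) g (x, (y, z)).
Proof.
transitivity (\int[m1]_(x in A) \int[m3]_(z in C) \int[m2]_(y in B) g (x, (y, z))).
  apply: eq_integral => x _.
  apply: (@tonelli_on _ _ _ _ _ m2 m3 B C (fun p => g (x, p)) mB mC) => //.
  by apply: (measurableT_comp mg); exact: measurable_fun_pair.
have mG : measurable_fun [set: T1 * T3] (fun p => \int[m2]_(y in B) g (p.1, (y, p.2))).
  apply: (@measurable_integral_snd _ _ _ _ _ m2 B
    (fun q : (T1 * T3) * T2 => g (q.1.1, (q.2, q.1.2))) mB) => //.
  apply: (measurableT_comp mg); apply: measurable_fun_pair.
    exact: measurableT_comp.
  by apply: measurable_fun_pair => //; exact: measurableT_comp.
rewrite (@tonelli_on _ _ _ _ _ m1 m3 A C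
  (fun p => \int[m2]_(y in B) g (p.1, (y, p.2))) mA mC mG); last first.
  by move=> p; exact: integral_ge0.
apply: eq_integral => z _.
apply: (@tonelli_on _ _ _ _ _ m1 m2 A B (fun p => g (p.1, (p.2, z))) mA mB) => //.
apply: (measurableT_comp mg); apply: measurable_fun_pair => //.
exact: measurable_fun_pair.
Qed.

End triple_tonelli.

(** * Averaged cost of the segments that link a path to a set *)

Section link.
Context {R : realType} {n : nat}.
Local Notation mu := (@lebesgue_measure R).
Local Notation vol := (@lebesgue_Rn R n).
Variables (rho : borelRn R n -> \bar R) (e : R -> 'rV[R]_n) (S Rad c0 : R)
  (z : 'rV[R]_n) (D : set (borelRn R n)).
Hypotheses (n0 : (0 < n)%N) (mrho : measurable_fun [set: borelRn R n] rho)
  (rho0 : forall x, (0 <= rho x)%E)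
  (me : measurable_fun [set: R] (e : R -> borelRn R n))
  (S0 : 0 <= S) (R0 : 0 < Rad) (c0_gt0 : 0 < c0)
  (eS : forall s, 0 <= s <= S -> enorm (e s - z) = s)
  (mD : measurable D)
  (DR : forall x s, D x -> 0 <= s <= S -> enorm ((x : 'rV[R]_n) - e s) <= Rad).

Let I : set R := `[0, S]%classic.
Let P : \bar R := (\int[vol]_x (rho x ^+ n))%E.

Let psi (p : borelRn R n * (R * R)) : borelRn R n :=
  e p.2.1 + p.2.2 *: ((p.1 : 'rV[R]_n) - e p.2.1).

Let mpsi : measurable_fun [set: borelRn R n * (R * R)] psi.
Proof.
apply: measurable_rowP => i.
have mei : measurable_fun [set: borelRn R n * (R * R)] (fun p => e p.2.1 0 i).
  have h := measurableT_comp (@measurable_coord R n i) me.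
  by apply: (measurableT_comp h); exact: measurableT_comp.
rewrite (_ : (fun _ => _) = fun p : borelRn R n * (R * R) =>
    e p.2.1 0 i + p.2.2 * ((p.1 : 'rV[R]_n) 0 i - e p.2.1 0 i)).
  apply: measurable_funD => //; apply: measurable_funM => //.
    exact: measurableT_comp.
  apply: measurable_funB => //.
  by apply: (measurableT_comp (@measurable_coord R n i)).
by apply/funext => p; rewrite !mxE.
Qed.

Let f p := rho (psi p).
Let mf : measurable_fun [set: borelRn R n * (R * R)] f.
Proof. exact: measurableT_comp. Qed.
Let f0 p : (0 <= f p)%E. Proof. exact: rho0. Qed.

Let mrhon : measurable_fun [set: borelRn R n] (fun x => (rho x ^+ n)%E).
Proof. exact: measurable_expe. Qed.
Let rhon0 x : (0 <= rho x ^+ n)%E. Proof. exact: expe_ge0. Qed.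

(* Only y with | |y - z| - s | <= t Rad are of the form e s + t (x - e s). *)
Let inner_bound (t s : R) : 0 < t -> 0 <= s <= S ->
  (\int[vol]_(x in D) (f (x, (s, t)) ^+ n) <=
   (t ^- n)%:E * \int[vol]_x ((rho x ^+ n) *
     (\1_[set y : borelRn R n | `|enorm ((y : 'rV[R]_n) - z) - s| <= t * Rad] x)%:E))%E.
Proof.
move=> t0 sS.
set A := [set y : borelRn R n | _].
have mA : measurable A.
  have := measurable_enorm_sub z measurableT (measurable_itv `[s - t * Rad, s + t * Rad]).
  rewrite setTI; congr measurable; apply/seteqP; split => x; rewrite /A /= in_itv/=;
    by rewrite ler_distl.
have mg : measurable_fun [set: borelRn R n] (fun x => (rho x ^+ n) * (\1_A x)%:E)%E.
  apply: emeasurable_funM; first exact: mrhon.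
  by apply/measurable_EFinP; exact: measurable_indic.
rewrite [in leRHS](@ge0_integral_Rn_affine _ _ t (e s - t *: e s))//; last 2 first.
- by rewrite gt_eqF.
- by move=> x; rewrite mule_ge0// lee_fin.
rewrite muleA -EFinM gtr0_norm// mulVf ?expf_neq0 ?gt_eqF// mul1e.
rewrite [leLHS]integral_mkcond; apply: ge0_le_integral_sup => x _.
  by apply: erestrict_ge0 => y _; exact: expe_ge0.
rewrite /patch; case: ifPn => xD; last by rewrite mule_ge0// lee_fin.
have xE : t *: (x : 'rV[R]_n) + (e s - t *: e s) = e s + t *: ((x : 'rV[R]_n) - e s).
  by rewrite scalerBr addrCA.
rewrite xE indicE mem_set ?mule1// /A /=.
rewrite -[in X in _ - X](eS sS); apply: le_trans (ler_dist_enorm _ _) _.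
rewrite subr_subrr addrAC subrr add0r enormZ gtr0_norm//.
by apply: ler_wpM2l; [exact: ltW|apply: DR => //; rewrite inE in xD].
Qed.

(** For given y, the relevant s fill an interval around |y - z|. This gains one power of t over the
    factor t^-n of [inner_bound], without which no weight would make the integral in t converge. *)
Let time_bound (y : borelRn R n) (t : R) : 0 < t ->
  (\int[mu]_(s in I) (\1_[set y : borelRn R n | `|enorm ((y : 'rV[R]_n) - z) - s| <= t * Rad] y)%:E
    <= (2 * (t * Rad))%:E)%E.
Proof.
move=> t0; set d := enorm ((y : 'rV[R]_n) - z).
apply: (@le_trans _ _ (\int[mu]_s (\1_`[d - t * Rad, d + t * Rad]%classic s)%:E)%E).
  rewrite integral_mkcond; apply: ge0_le_integral_sup => s _.
    by apply: erestrict_ge0 => u _; rewrite lee_fin.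
  rewrite /patch; case: ifPn => _; last by rewrite lee_fin.
  rewrite lee_fin !indicE ler_nat; case: (boolP (y \in _)) => //.
  rewrite inE /= => h; rewrite mem_set//= in_itv/=.
  by move: h; rewrite distrC ler_distl.
rewrite integral_indic//= setIT lebesgue_measure_itv/= lte_fin.
have tR : 0 < t * Rad by rewrite mulr_gt0.
rewrite ifT; last by lra.
by rewrite -EFinB lee_fin; lra.
Qed.

Let J (t : R) : \bar R := (\int[mu]_(s in I) \int[vol]_(x in D) f (x, (s, t)))%E.

Let mI : measurable I. Proof. exact: measurable_itv. Qed.

(** After [le_expe_linear], the constant term gives the volume and [inner_bound] controls the power
    term for each s; exchanging s and y then lets [time_bound] act for each y. *)
Let J_bound (t c : R) : 0 < t -> 0 < c ->
  (J t <= (c * S)%:E * vol D + (c ^- n.-1 * t ^- n * (2 * (t * Rad)))%:E * P)%E.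
Proof.
move=> t0 c_0; have cn : 0 <= c ^- n.-1 by rewrite invr_ge0 exprn_ge0// ltW.
have tn : 0 <= t ^- n by rewrite invr_ge0 exprn_ge0// ltW.
set A := fun s => [set y : borelRn R n | `|enorm ((y : 'rV[R]_n) - z) - s| <= t * Rad].
have mft s : measurable_fun [set: borelRn R n] (fun x => f (x, (s, t))).
  by apply: (measurableT_comp mf); apply: measurable_fun_pair.
have mA : measurable_fun [set: R * borelRn R n] (fun p => \1_(A p.1) p.2 : R).
  pose B := [set p : R * borelRn R n | A p.1 p.2].
  rewrite (_ : (fun _ => _) = \1_B); last first.
    by apply/funext => p; rewrite !indicE; congr (_%:R); rewrite /B;
      apply/idP/idP; rewrite !inE.
  apply: measurable_indic.
  pose h (p : R * borelRn R n) : R := enorm ((p.2 : 'rV[R]_n) - z) - p.1.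
  have mh : measurable_fun setT h.
    apply: measurable_funB => //.
    by apply: (measurableT_comp (measurable_enorm_sub z)).
  have := mh measurableT _ (measurable_itv `[(- (t * Rad)), (t * Rad)]).
  by rewrite setTI; congr measurable; apply/seteqP; split => p; rewrite /= in_itv/= -ler_norml.
have mG : measurable_fun [set: R * borelRn R n]
    (fun p => (rho p.2 ^+ n) * (\1_(A p.1) p.2)%:E)%E.
  apply: emeasurable_funM; first exact: (measurableT_comp mrhon).
  exact/measurable_EFinP.
have G0 p : (0 <= (rho p.2 ^+ n) * (\1_(A p.1) p.2)%:E)%E.
  by rewrite mule_ge0// lee_fin.
pose H s : \bar R := (\int[vol]_x ((rho x ^+ n) * (\1_(A s) x)%:E))%E.
have H0 s : (0 <= H s)%E by apply: integral_ge0 => x _; exact: G0 (s, x).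
have mH : measurable_fun [set: R] H.
  exact: (@measurable_integral_snd _ _ _ _ _ vol setT _ measurableT mG G0).
pose Q := (\int[mu]_(s in I) \int[vol]_x ((rho x ^+ n) * (\1_(A s) x)%:E))%E.
have QP : (Q <= (2 * (t * Rad))%:E * P)%E.
  rewrite /Q (@tonelli_on _ _ _ _ _ mu vol I setT _ mI measurableT mG G0).
  rewrite /P -ge0_integralZl//; last by rewrite lee_fin !mulr_ge0// ltW.
  apply: ge0_le_integral_sup => y _.
    by apply: integral_ge0 => s _; exact: G0 (s, y).
  rewrite /= ge0_integralZl//; last first.
    apply/measurable_EFinP; apply: measurable_funTS.
    exact: (measurableT_comp mA (pair2_measurable y)).
  by rewrite muleC; apply: lee_wpmul2r => //; exact: time_bound.
pose k := c ^- n.-1 * t ^- n.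
have k0 : 0 <= k by rewrite mulr_ge0.
have volD0 : (0 <= c%:E * vol D)%E by rewrite mule_ge0// lee_fin ltW.
have inner s : I s -> (\int[vol]_(x in D) f (x, (s, t)) <= k%:E * H s + c%:E * vol D)%E.
  rewrite /I /= in_itv/= => sS.
  apply: (@le_trans _ _ (\int[vol]_(x in D) ((c ^- n.-1)%:E * f (x, (s, t)) ^+ n + c%:E))%E).
    by apply: ge0_le_integral_sup => x _ //; exact: le_expe_linear.
  rewrite ge0_integralD//; last 3 first.
  - by move=> x _; rewrite mule_ge0// ?lee_fin// expe_ge0.
  - by apply: emeasurable_funM => //; apply: measurable_funTS; exact: measurable_expe.
  - by move=> x _; rewrite lee_fin ltW.
  rewrite integral_cst// leeD2r// ge0_integralZl//; last 2 first.
  - by apply: measurable_funTS; exact: measurable_expe.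
  - by move=> x _; rewrite expe_ge0.
  rewrite /k EFinM -muleA; apply: lee_wpmul2l; first by rewrite lee_fin.
  exact: inner_bound.
apply: (@le_trans _ _ (\int[mu]_(s in I) (k%:E * H s + c%:E * vol D))%E).
  by apply: ge0_le_integral_sup => s Is; [exact: integral_ge0|exact: inner].
rewrite ge0_integralD//; last 2 first.
- by move=> s _; rewrite mule_ge0// lee_fin.
- by apply: emeasurable_funM => //; exact: measurable_funTS.
rewrite integral_cst//= lebesgue_measure_itv/= lte_fin.
rewrite addeC; apply: leeD.
  have [S_0|] := ltP 0 S; last first.
    by move=> S_0; rewrite mule0 mule_ge0// lee_fin mulr_ge0// ltW.
  by rewrite oppr0 addr0 muleAC -EFinM.
rewrite ge0_integralZl//; last exact: measurable_funTS.
apply: le_trans (lee_wpmul2l _ QP) _; first by rewrite lee_fin.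
by rewrite muleA -EFinM.
Qed.

(** Here t = w^-n, so the exponent of w is n (n - 1) - (n - 1)^2 = n - 1. *)
Let weight (w t : R) : 0 < w -> 0 < t -> w ^+ n * t = 1 ->
  (c0 * w ^+ n.-1) ^- n.-1 * t ^- n * (2 * (t * Rad)) = w ^+ n.-1 * (2 * Rad * c0 ^- n.-1).
Proof.
move=> w0 t0 wt; case: n n0 wt => // m _ wt /=.
have h : w ^+ m * ((w ^+ m) ^+ m * t ^+ m) = 1.
  by rewrite mulrA -exprS -exprM mulnC exprM -exprMn wt expr1n.
have w'0 : w ^+ m != 0 by rewrite expf_neq0// gt_eqF.
have t'0 : t ^+ m != 0 by rewrite expf_neq0// gt_eqF.
have c'0 : c0 ^+ m != 0 by rewrite expf_neq0// gt_eqF.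
have t_neq0 : t != 0 by rewrite gt_eqF.
have {}w'0 : (w ^+ m) ^+ m != 0 by rewrite expf_neq0.
rewrite exprMn exprS; move: h w'0 t'0 c'0.
set W := w ^+ m; set X := W ^+ m; set Y := t ^+ m; set Z := c0 ^+ m => h X0 Y0 Z0.
have -> : W = (X * Y)^-1 by apply: (mulIf (mulf_neq0 X0 Y0)); rewrite h mulVf// mulf_neq0.
by field; rewrite X0 Y0 Z0 t_neq0.
Qed.

(* Substitute y = e s + t (x - e s) for fixed t and let the constant of
   [le_expe_linear] be c0 t ^ (- (n - 1) / n), so that the integral in t
   converges. *)
Lemma link_integral :
  (\int[vol]_(x in D) \int[mu]_(s in I) segment_integral rho (e s) x <=
   n%:R%:E * ((Rad * (c0 * S))%:E * vol D + (Rad * (2 * Rad * c0 ^- n.-1))%:E * P))%E.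
Proof.
have P0 : (0 <= P)%E by exact: integral_ge0.
have [w [mw w0 wn wint]] := @root_weight R n n0.
have Rad0 : 0 <= Rad by exact: ltW.
have v0 : (0 <= vol D)%E by [].
have c00 : 0 <= c0 ^- n.-1 by rewrite invr_ge0 exprn_ge0// ltW.
have a1 : 0 <= c0 * S by rewrite mulr_ge0// ltW.
have a2 : 0 <= 2 * Rad * c0 ^- n.-1 by rewrite !mulr_ge0.
pose T : set R := `]0, 1]%classic.
pose g p : \bar R := (Rad%:E * f p)%E.
have mg : measurable_fun setT g by exact: measurable_funeM.
have g0 p : (0 <= g p)%E by rewrite mule_ge0// lee_fin.
have mT : measurable T by exact: measurable_itv.
set B := (X in (_ <= n%:R%:E * X)%E).
have B0 : (0 <= B)%E by rewrite adde_ge0// mule_ge0// lee_fin mulr_ge0.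
apply: (@le_trans _ _ (\int[vol]_(x in D) \int[mu]_(s in I) \int[mu]_(t in T) g (x, (s, t)))%E).
  apply: ge0_le_integral_sup => x Dx.
    apply: integral_ge0 => s _; apply: mule_ge0; first by rewrite lee_fin enorm_ge0.
    by apply: integral_ge0.
  apply: ge0_le_integral_sup => s; rewrite /I /= in_itv/= => sS.
    by apply: mule_ge0; [rewrite lee_fin enorm_ge0|exact: integral_ge0].
  have mfs (D' : set R) : measurable_fun D' (fun t : R => f (x, (s, t))).
    apply: measurable_funTS; apply: (measurableT_comp mf).
    by apply: measurable_fun_pair => //; exact: measurable_fun_pair.
  rewrite /g ge0_integralZl//; last exact: mfs.
  rewrite /segment_integral -(@integral_itv_obnd_cbnd _ _ _ (fun t => f (x, (s, t)))); last exact: mfs.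
  apply: lee_pmul; rewrite ?lee_fin ?enorm_ge0//; first exact: integral_ge0.
  exact: DR.
rewrite (@tonelli_on3 _ _ _ _ _ _ _ vol mu mu D I T g mD mI mT mg g0).
apply: (@le_trans _ _ (\int[mu]_(t in T) ((w t ^+ n.-1)%:E * B))%E); last first.
  rewrite ge0_integralZr//; last 2 first.
  - by apply/measurable_EFinP; apply: measurable_funTS; exact: measurable_funX.
  - move=> t; rewrite /T /= in_itv/= => /andP[t0 _].
    by rewrite lee_fin exprn_ge0//; apply: ltW; exact: w0.
  by apply: lee_wpmul2r.
apply: ge0_le_integral_sup => t; rewrite /T /= in_itv/= => /andP[t0 _].
  by apply: integral_ge0 => s _; exact: integral_ge0.
have wt := w0 t t0.
apply: (@le_trans _ _ (Rad%:E * J t)%E).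
  rewrite /J -ge0_integralZl//; last 2 first.
  - apply: measurable_funTS.
    apply: (@measurable_integral_snd _ _ _ _ _ vol D (fun p : R * borelRn R n => f (p.2, (p.1, t))) mD) => //.
    apply: (measurableT_comp mf); apply: measurable_fun_pair => //.
    exact: measurable_fun_pair.
  - by move=> s _; exact: integral_ge0.
  apply: ge0_le_integral_sup => s _; first exact: integral_ge0.
  rewrite /g ge0_integralZl//.
  apply: measurable_funTS; apply: (measurableT_comp mf).
  exact: measurable_fun_pair.
have wn0 : 0 < w t ^+ n.-1 by rewrite exprn_gt0.
have cw : 0 < c0 * w t ^+ n.-1 by rewrite mulr_gt0.
apply: (@le_trans _ _ (Rad%:E * (((c0 * w t ^+ n.-1) * S)%:E * vol D +
   ((c0 * w t ^+ n.-1) ^- n.-1 * t ^- n * (2 * (t * Rad)))%:E * P))%E).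
  by apply: lee_wpmul2l; [rewrite lee_fin|exact: J_bound].
rewrite (weight wt t0 (wn t t0)) /B.
have b1 : 0 <= c0 * w t ^+ n.-1 * S by rewrite mulr_ge0// ltW.
have b2 : 0 <= w t ^+ n.-1 * (2 * Rad * c0 ^- n.-1) by rewrite mulr_ge0// ltW.
rewrite ge0_muleDr; [|by rewrite mule_ge0// lee_fin..].
have p1 : (0 <= (Rad * (c0 * S))%:E * vol D)%E by rewrite mule_ge0// lee_fin mulr_ge0.
have p2 : (0 <= (Rad * (2 * Rad / c0 ^+ n.-1))%:E * P)%E by rewrite mule_ge0// lee_fin mulr_ge0.
rewrite (ge0_muleDr _ p1 p2).
rewrite !muleA -!EFinM; apply: leeD; rewrite le_eqVlt; apply/orP; left; apply/eqP;
  congr (_%:E * _)%E; ring.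
Qed.

End link.

(** * Measurable choice of path points at each distance from the start *)

Section hitting.
Context {R : realType} {n : nat}.
Variables (g : R -> 'rV[R]_n) (S : R).
Hypotheses (cg : {within `[0, 1], continuous g})
  (S1 : S <= enorm (g 1 - g 0)).

Let h t := enorm (g t - g 0).

Let ch : continuous_on_itv h 0 1.
Proof.
move=> t t01 e e0; have /within_continuous_pathP/(_ t) := cg.
rewrite /= in_itv/= => /(_ t01 e e0)[d d0 H]; exists d => // u u01 tu.
apply: le_lt_trans (ler_dist_enorm _ _) _.
by rewrite subr_subrr; apply: H => //=; rewrite in_itv.
Qed.

(** Clamping s to at most S keeps 1 in every [T s] and makes [tau] monotone on the whole line. *)
Let T s := [set t | 0 <= t <= 1 /\ clamp S s <= h t].
Let tau s := inf (T s).

Let T1 s : T s 1.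
Proof. by split; rewrite ?ler01 ?lexx// (le_trans (clamp_le _ _)). Qed.

Let has_infT s : has_inf (T s).
Proof. by split; [exists 1; exact: T1|exists 0 => t [/andP[]]]. Qed.

Let tau_mono : {homo tau : s t / s <= t}.
Proof.
move=> s t st; apply: lb_le_inf; first by exists 1; exact: T1.
move=> u [u01 tu]; apply: ge_inf; first by case: (has_infT s).
by split => //; apply: le_trans tu; exact: clamp_mono.
Qed.

Let tauP s : 0 <= s <= S -> 0 <= tau s <= 1 /\ h (tau s) = s.
Proof.
move=> /andP[s0 sS]; have [|||t /andP[t0 t1] [ht Ht]] := @first_hit _ h 0 1 s _ ch.
- exact: ler01.
- by rewrite /h subrr enorm0.
- exact: le_trans S1.
suff -> : tau s = t by rewrite t0 t1.
apply/eqP; rewrite eq_le; apply/andP; split.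
  apply: ge_inf; first by case: (has_infT s).
  by split; rewrite ?t0 ?t1// clamp_id// ht.
apply: lb_le_inf; first by exists 1; exact: T1.
move=> u [/andP[u0 u1]]; rewrite clamp_id// => su.
by rewrite leNgt; apply/negP => ut; have := Ht u u0 ut; rewrite ltNge su.
Qed.

(** The first time at which the path is at distance s from its start is monotone in s, hence
    measurable, however wild the path is. *)
Lemma hitting_selection : exists e : R -> 'rV[R]_n,
  [/\ measurable_fun [set: R] (e : R -> borelRn R n),
      forall s, 0 <= s <= S -> enorm (e s - g 0) = s &
      forall s, 0 <= s <= S -> exists2 t, 0 <= t <= 1 & e s = g t].
Proof.
(* The path is continuous only on [0, 1]; clamping the time gives a map continuous on the whole
   line. *)
exists (fun s => g (clamp 1 (tau s))); split.
- have mgc : measurable_fun [set: R] ((fun t => g (clamp 1 t)) : R -> borelRn R n).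
    apply: measurable_rowP => i; apply: continuous_measurable_fun => t.
    apply/cvgrPdist_lt => e e0.
    have c01 (u : R) : clamp 1 u \in `[0, 1] by rewrite in_itv/= clamp_ge0 ?clamp_le.
    have /within_continuous_pathP/(_ _ (c01 t) e e0)[d d0 H] := cg.
    apply/nbhs_ballP; exists d => // u tu.
    have := coord_le_enorm (g (clamp 1 t) - g (clamp 1 u)) i.
    rewrite !mxE => /le_lt_trans; apply; apply: H; first exact: c01.
    exact: le_lt_trans (clamp_lip _ _ _) tu.
  by apply: (measurableT_comp mgc); exact: nondecreasing_measurable.
- move=> s sS; have [/andP[t0 t1] ht] := tauP sS.
  by rewrite clamp_id.
- move=> s sS; have [/andP[t0 t1] ht] := tauP sS.
  by exists (tau s); rewrite ?t0 ?t1// clamp_id.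
Qed.

End hitting.

Section segment_integral_theory.
Context {R : realType} {n : nat}.
Local Notation mu := (@lebesgue_measure R).
Local Notation vol := (@lebesgue_Rn R n).
Variable rho : borelRn R n -> \bar R.
Hypotheses (mrho : measurable_fun [set: borelRn R n] rho)
  (rho0 : forall x, (0 <= rho x)%E).

Lemma segment_integral_ge0 x y : (0 <= segment_integral rho x y)%E.
Proof.
by apply: mule_ge0; [rewrite lee_fin enorm_ge0|exact: integral_ge0].
Qed.

Lemma segment_integralC x y : segment_integral rho x y = segment_integral rho y x.
Proof.
rewrite /segment_integral enormBC; congr (_ * _)%E.
have ml u : measurable_fun [set: R] (fun t => rho (x + t *: u)).
  by apply: (measurableT_comp mrho); exact: measurable_line.
rewrite (ge0_integral_itv_opp _ _ (ml _))//.
have -> : `[(- 1)%R, (- 0)%R]%classic = `[(1 * 0 + -1)%R, (1 * 1 + -1)%R]%classic :> set R.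
  by rewrite oppr0 mulr0 add0r mulr1 subrr.
rewrite ge0_integral_itv_affine// ?mul1e.
  apply: eq_integral => t _; congr (rho _).
  by apply/rowP => i; rewrite !mxE; ring.
by apply: (measurableT_comp (ml (y - x))); exact: measurable_funN.
Qed.

Lemma measurable_segment_integral :
  measurable_fun [set: borelRn R n * borelRn R n]
    (fun p => segment_integral rho p.1 p.2).
Proof.
have mp (i : 'I_n) d (T : measurableType d) (h : T -> borelRn R n) : measurable_fun setT h ->
    measurable_fun [set: T] (fun t => (h t : 'rV[R]_n) 0 i).
  by move=> mh; exact: (measurableT_comp (@measurable_coord R n i) mh).
apply: emeasurable_funM.
  apply/measurable_EFinP.
  have mB : measurable_fun [set: borelRn R n * borelRn R n]
      ((fun p => (p.2 : 'rV[R]_n) - p.1) : _ -> borelRn R n).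
    apply: measurable_rowP => i.
    rewrite (_ : (fun _ => _) = fun p : borelRn R n * borelRn R n =>
      (p.2 : 'rV[R]_n) 0 i - (p.1 : 'rV[R]_n) 0 i).
      by apply: measurable_funB; exact: mp.
    by apply/funext => p; rewrite !mxE.
  exact: (measurableT_comp (@measurable_enorm R n) mB).
apply: (@measurable_integral_snd _ _ _ _ _ mu `[0%R, 1%R]%classic
  (fun q : (borelRn R n * borelRn R n) * R =>
    rho ((q.1.1 : 'rV[R]_n) + q.2 *: ((q.1.2 : 'rV[R]_n) - q.1.1)))) => //.
apply: (measurableT_comp mrho); apply: measurable_rowP => i.
rewrite (_ : (fun _ => _) = fun q : (borelRn R n * borelRn R n) * R =>
  (q.1.1 : 'rV[R]_n) 0 i + q.2 * ((q.1.2 : 'rV[R]_n) 0 i - (q.1.1 : 'rV[R]_n) 0 i)).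
  have m1 : measurable_fun setT (fun q : (borelRn R n * borelRn R n) * R => (q.1.1 : 'rV[R]_n) 0 i).
    by apply: mp; exact: measurableT_comp.
  have m2 : measurable_fun setT (fun q : (borelRn R n * borelRn R n) * R => (q.1.2 : 'rV[R]_n) 0 i).
    by apply: mp; exact: measurableT_comp.
  by apply: measurable_funD => //; apply: measurable_funM => //; exact: measurable_funB.
by apply/funext => q; rewrite !mxE.
Qed.

End segment_integral_theory.

Section bernoulli.
Context {R : realType}.

Lemma bernoulli (n : nat) (x : R) : 0 <= x -> 1 + n%:R * (x - 1) <= x ^+ n.
Proof.
move=> x0; elim: n => [|n IH]; first by rewrite mul0r addr0 expr0.
rewrite exprS -natr1; apply: le_trans (ler_wpM2l x0 IH).
have : 0 <= n%:R * (x - 1) ^+ 2 by rewrite mulr_ge0// sqr_ge0.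
nra.
Qed.

(* Unlike [le_expe_linear], this is sharp at x = c. *)
Lemma le_expe_tangent (n : nat) (c : R) (x : \bar R) : (0 < n)%N -> 0 < c ->
  (0 <= x)%E -> (n%:R%:E * x <= (c ^- n.-1)%:E * x ^+ n + (n.-1%:R * c)%:E)%E.
Proof.
move=> n0 c0; have cn : 0 < c ^- n.-1 by rewrite invr_gt0 exprn_gt0.
case: x => [x| |//]; last first.
  move=> _; have -> : (+oo ^+ n = +oo :> \bar R)%E.
    case: n n0 {cn} => // m _.
    elim: m => [|m IH]; first by rewrite expeS expe0 mule1.
    by rewrite expeS IH mulyy.
  by rewrite [X in (_ <= X + _)%E]gt0_muley ?lte_fin// addye// leey.
rewrite lee_fin -EFin_expe -!EFinM -EFinD lee_fin => x0.
case: n n0 {cn} => // m _ /=.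
have c1 : c != 0 by rewrite gt_eqF.
have h := ler_wpM2r (ltW c0) (bernoulli m.+1 (divr_ge0 x0 (ltW c0))).
rewrite -subr_ge0 in h.
rewrite -subr_ge0; apply: le_trans h _.
rewrite le_eqVlt; apply/orP; left; apply/eqP.
rewrite expr_div_n !exprS -!natr1; field.
by rewrite c1 expf_neq0.
Qed.

End bernoulli.

Lemma EFin_expeM {R : realType} (n : nat) (a : R) (x : \bar R) :
  ((a%:E * x) ^+ n = (a ^+ n)%:E * x ^+ n)%E.
Proof.
elim: n => [|n IH]; first by rewrite !expe0 mule1.
by rewrite !expeS IH exprS EFinM muleACA.
Qed.

(** * Lower bound of the energy from radial segments *)

Section radial.
Context {R : realType} {n : nat}.
Local Notation mu := (@lebesgue_measure R).
Local Notation vol := (@lebesgue_Rn R n).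
Variables (rho : borelRn R n -> \bar R) (p : 'rV[R]_n) (sg q kap : R) (N : nat)
  (C : set (borelRn R n)).
Hypotheses (n0 : (0 < n)%N) (mrho : measurable_fun [set: borelRn R n] rho)
  (rho0 : forall x, (0 <= rho x)%E) (sg0 : 0 < sg) (q1 : 1 < q) (kap0 : 0 < kap)
  (N0 : (0 < N)%N) (mC : measurable C) (Cq : C `<=` shell 1 q).

Let P : \bar R := (\int[vol]_x (rho x ^+ n))%E.
Let V := fine (vol C).
Let q0 : 0 < q. Proof. exact: lt_trans q1. Qed.

Hypothesis kapV : ((kap * V)%:E <= \int[vol]_(v in C)
  segment_integral rho (p + sg *: (v : 'rV[R]_n)) (p + (q ^+ N * sg) *: (v : 'rV[R]_n)))%E.

Let VE : vol C = V%:E.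
Proof.
rewrite /V fineK// ge0_fin_numE//; apply: (@lebesgue_Rn_bounded _ _ _ q) => //.
by move=> x /Cq /= /andP[_ /ltW].
Qed.

(** The density on the k-th block of the ray in direction v, where the times between q^k and q^(k+1)
    are rescaled to [1, q], so that all blocks share one time variable. *)
Let f (k : nat) (z : borelRn R n * R) : \bar R :=
  rho (p + (q ^+ k * z.2 * sg) *: (z.1 : 'rV[R]_n)).

Let f0 k z : (0 <= f k z)%E. Proof. exact: rho0. Qed.

Let mf k : measurable_fun [set: borelRn R n * R] (f k).
Proof.
apply: (measurableT_comp mrho); apply: measurable_rowP => i.
rewrite (_ : (fun _ => _) = fun z : borelRn R n * R =>
  p 0 i + q ^+ k * z.2 * sg * (z.1 : 'rV[R]_n) 0 i).
  apply: measurable_funD => //; apply: measurable_funM.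
    by apply: measurable_funM => //; exact: measurable_funM.
  exact: (measurableT_comp (@measurable_coord R n i)).
by apply/funext => z; rewrite !mxE.
Qed.

(** Cut [1, q^N] at the powers of q and rescale the pieces. The extra factor q bounds |v|. *)
Let segment_blocks (v : 'rV[R]_n) : 1 < enorm v < q ->
  (segment_integral rho (p + sg *: v) (p + (q ^+ N * sg) *: v) <=
   \sum_(k < N) (q * (q ^+ k * sg))%:E * \int[mu]_(t in `[1%R, q]) f k (v, t))%E.
Proof.
move=> /andP[v1 vq]; have qN : 1 < q ^+ N by rewrite exprn_egt1// -lt0n.
have dE : p + (q ^+ N * sg) *: v - (p + sg *: v) = ((q ^+ N - 1) * sg) *: v.
  by apply/rowP => i; rewrite !mxE; ring.
have ml : measurable_fun [set: R] (fun t => rho (p + (t * sg) *: v)).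
  rewrite (_ : (fun _ => _) = rho \o (fun t => p + t *: (sg *: v))).
    by apply: (measurableT_comp mrho); exact: measurable_line.
  by apply/funext => t /=; rewrite scalerA.
have -> : segment_integral rho (p + sg *: v) (p + (q ^+ N * sg) *: v) =
    ((sg * enorm v)%:E * \int[mu]_(t in `[1%R, (q ^+ N)%R]) rho (p + (t * sg) *: v)%R)%E.
  rewrite /segment_integral dE enormZ ger0_norm ?mulr_ge0 ?subr_ge0 ?(ltW sg0) ?(ltW qN)//.
  have -> : `[1%R, q ^+ N]%classic =
      `[((q ^+ N - 1) * 0 + 1)%R, ((q ^+ N - 1) * 1 + 1)%R]%classic :> set R.
    by rewrite mulr0 add0r mulr1 subrK.
  rewrite (@ge0_integral_itv_affine _ _ _ _ _ (fun t => rho (p + (t * sg) *: v)))//; last by rewrite subr_gt0.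
  rewrite muleA -EFinM; congr (_%:E * _)%E; first by ring.
  apply: eq_integral => t _; congr (rho _).
  by apply/rowP => i; rewrite !mxE; ring.
have cover m : (\int[mu]_(t in `[1%R, (q ^+ m)%R]) rho (p + (t * sg) *: v)%R <=
    \sum_(k < m) (q ^+ k)%:E * \int[mu]_(t in `[1%R, q]) f k (v, t))%E.
  elim: m => [|m IH]; first by rewrite expr0 set_itv1 integral_set1 big_ord0.
  rewrite big_ord_recr/=.
  apply: le_trans (@ge0_integral_cover _ _ _ mu _ `[1, q ^+ m]%classic
    `[q ^+ m, q ^+ m.+1]%classic _ _ _ _ ml _) _ => //.
    move=> t /=; rewrite !in_itv/= => /andP[t1 tq].
    by have [tm|/ltW tm] := leP t (q ^+ m); [left|right]; rewrite ?t1 ?tm.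
  apply: leeD => //.
  have -> : `[q ^+ m, q ^+ m.+1]%classic = `[(q ^+ m * 1 + 0)%R, (q ^+ m * q + 0)%R]%classic :> set R.
    by rewrite mulr1 !addr0 -exprSr.
  rewrite (@ge0_integral_itv_affine _ _ _ _ _ (fun t => rho (p + (t * sg) *: v)))// ?exprn_gt0//.
  rewrite le_eqVlt; apply/orP; left; apply/eqP; congr (_ * _)%E.
  by apply: eq_integral => t _; rewrite /f /= addr0.
have sv0 : 0 <= sg * enorm v by rewrite mulr_ge0 ?enorm_ge0// ltW.
apply: le_trans (lee_wpmul2l _ (cover N)) _; first by rewrite lee_fin.
rewrite ge0_sume_distrr; last first.
  move=> k _; apply: mule_ge0; first by rewrite lee_fin exprn_ge0// ltW.
  by apply: integral_ge0.
apply: lee_sum => k _; rewrite muleA -EFinM; apply: lee_wpmul2r.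
  by apply: integral_ge0.
rewrite lee_fin (_ : q * _ = sg * q * q ^+ k); last by ring.
by rewrite ler_wpM2r ?exprn_ge0 ?(ltW q0)// ler_wpM2l ?(ltW sg0)// ltW.
Qed.

Let G (z : borelRn R n * R) : \bar R := (\sum_(k < N) (q ^+ k * sg)%:E * f k z)%E.

Let qsg k : 0 < q ^+ k * sg. Proof. by rewrite mulr_gt0// exprn_gt0. Qed.

Let G0 z : (0 <= G z)%E.
Proof. by apply: sume_ge0 => k _; rewrite mule_ge0// lee_fin ltW. Qed.

Let mG : measurable_fun [set: borelRn R n * R] G.
Proof. by apply: emeasurable_sum => k; exact: measurable_funeM. Qed.

Let P0 : (0 <= P)%E.
Proof. by apply: integral_ge0 => x _; exact: expe_ge0. Qed.

Let annulus (t : R) (k : nat) : set (borelRn R n) :=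
  [set x | q ^+ k * t * sg < enorm ((x : 'rV[R]_n) - p) < q ^+ k.+1 * t * sg].

Let mannulus t k : measurable_fun [set: borelRn R n] (fun y => (rho y ^+ n * (\1_(annulus t k) y)%:E)%E).
Proof.
apply: emeasurable_funM; first exact: measurable_expe.
by apply/measurable_EFinP; apply: measurable_indic; exact: measurable_shell_sub.
Qed.

Let annulus0 t k y : (0 <= rho y ^+ n * (\1_(annulus t k) y)%:E)%E.
Proof. by rewrite mule_ge0// ?lee_fin// expe_ge0. Qed.

(** Substitute y = p + q^k t sg v: the Jacobian (q^k t sg)^n dominates the n-th power of q^k sg
    because t >= 1, and the image of [C] lies in the annulus because [C] lies in the shell. *)
Let annulus_piece (t : R) (k : nat) : 1 <= t ->
  (\int[vol]_(v in C) (((q ^+ k * sg)%:E * f k (v, t)) ^+ n) <=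
   \int[vol]_y ((rho y ^+ n) * (\1_(annulus t k) y)%:E))%E.
Proof.
move=> t1; have t0 : 0 < t by apply: lt_le_trans t1.
have l0 : 0 < q ^+ k * t * sg by rewrite mulrAC mulr_gt0.
have ln0 : 0 <= (q ^+ k * t * sg) ^+ n by rewrite exprn_ge0// ltW.
have mh := measurableT_comp (mannulus t k) (measurable_Rn_affine (q ^+ k * t * sg) p).
rewrite [leRHS](@ge0_integral_Rn_affine _ _ (q ^+ k * t * sg) p _ _ (mannulus t k) (annulus0 t k)); last first.
  by rewrite gt_eqF.
rewrite gtr0_norm//.
have -> : ((((q ^+ k * t * sg) ^+ n)%:E * \int[vol]_x (rho ((q ^+ k * t * sg) *: x + p)%R ^+ n *
    (\1_(annulus t k) ((q ^+ k * t * sg) *: x + p))%:E)) =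
    \int[vol]_x (((q ^+ k * t * sg) ^+ n)%:E * (rho ((q ^+ k * t * sg) *: x + p)%R ^+ n *
    (\1_(annulus t k) ((q ^+ k * t * sg) *: x + p))%:E)))%E.
  by rewrite ge0_integralZl// => x _; exact: annulus0.
rewrite [leLHS]integral_mkcond; apply: ge0_le_integral_sup => v _.
  by apply: erestrict_ge0 => u _; rewrite expe_ge0// mule_ge0// lee_fin ltW.
rewrite /patch; case: ifPn => vC; last by rewrite mule_ge0// ?lee_fin//; exact: annulus0.
have := Cq (set_mem vC); rewrite /shell /= => /andP[v1 vq].
rewrite indicE mem_set/=; last first.
  rewrite /annulus /= addrK enormZ gtr0_norm// ltr_pMr// v1 /=.
  rewrite (_ : q ^+ k.+1 * t * sg = q ^+ k * t * sg * q); last by rewrite exprS; ring.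
  by rewrite ltr_pM2l.
rewrite mule1 /f /= addrC EFin_expeM; apply: lee_wpmul2r; first exact: expe_ge0.
rewrite lee_fin lerXn2r ?nnegrE ?(ltW (qsg k)) ?(ltW l0)//.
by rewrite mulrAC ler_peMr// ltW.
Qed.

Let sum_annulus (t : R) (y : borelRn R n) : 1 <= t -> \sum_(k < N) \1_(annulus t k) y <= 1 :> R.
Proof.
move=> t1; have t0 : 0 < t * sg by rewrite mulr_gt0// (lt_le_trans _ t1).
have [[k yk]|yk] := pselect (exists k : 'I_N, annulus t k y); last first.
  rewrite big1 ?ler01// => k _; rewrite indicE memNset// => h; apply: yk; by exists k.
rewrite (bigD1 k)//= big1 ?addr0 => [|j jk]; first by rewrite indicE; case: (_ \in _).
rewrite indicE memNset// => /andP[]; move: yk => /andP[]; rewrite -!(mulrA _ t) => k1 k2 j1 j2.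
have le (a b : nat) : (a < b)%N -> q ^+ a.+1 * (t * sg) <= q ^+ b * (t * sg).
  by move=> ab; rewrite ler_pM2r// ler_eXn2l.
move: jk; rewrite neq_ltn => /orP[/le|/le]; lra.
Qed.

(** For fixed t the annuli are disjoint, so the power terms of all blocks together cost P once,
    while the constant terms are added N times. *)
Let slice (t c : R) : 1 <= t -> 0 < c ->
  (n%:R%:E * \int[vol]_(v in C) G (v, t) <=
   (c ^- n.-1)%:E * P + (n.-1%:R * c * N%:R * V)%:E)%E.
Proof.
move=> t1 c_0; have n0' : 0 <= (n%:R : R) by [].
have cn : 0 <= c ^- n.-1 by rewrite invr_ge0 exprn_ge0// ltW.
have mft k : measurable_fun [set: borelRn R n] (fun v => f k (v, t)).
  exact: (measurableT_comp (mf k) (pair2_measurable t)).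
have mF k : measurable_fun [set: borelRn R n] (fun v => ((q ^+ k * sg)%:E * f k (v, t))%E).
  exact: measurable_funeM.
have F0 k v : (0 <= (q ^+ k * sg)%:E * f k (v, t))%E by rewrite mule_ge0// lee_fin ltW.
have c1 : 0 <= n.-1%:R * c by rewrite mulr_ge0// ltW.
rewrite -ge0_integralZl//; last first.
  by apply: measurable_funTS; exact: (measurableT_comp mG (pair2_measurable t)).
apply: (@le_trans _ _ (\int[vol]_(v in C) \sum_(k < N)
    ((c ^- n.-1)%:E * ((q ^+ k * sg)%:E * f k (v, t)) ^+ n + (n.-1%:R * c)%:E))%E).
  apply: ge0_le_integral_sup => v _; first by rewrite mule_ge0.
  rewrite /G ge0_sume_distrr; last by move=> k _; exact: F0.
  by apply: lee_sum => k _; exact: le_expe_tangent n0 c_0 (F0 k v).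
have mFn k : measurable_fun C (fun v => ((q ^+ k * sg)%:E * f k (v, t)) ^+ n)%E.
  by apply: measurable_funTS; exact: measurable_expe.
have Fn0 k v : (0 <= (c ^- n.-1)%:E * ((q ^+ k * sg)%:E * f k (v, t)) ^+ n)%E.
  by rewrite mule_ge0// ?lee_fin// expe_ge0.
rewrite ge0_integral_sum//; last 2 first.
- by move=> k; apply: emeasurable_funD => //; exact: measurable_funeM.
- by move=> k v _; rewrite adde_ge0// lee_fin.
apply: (@le_trans _ _ (\sum_(k < N) ((c ^- n.-1)%:E *
    \int[vol]_y ((rho y ^+ n) * (\1_(annulus t k) y)%:E) + (n.-1%:R * c * V)%:E))%E).
  apply: lee_sum => k _; rewrite ge0_integralD//; last first.
    exact: measurable_funeM.
  rewrite integral_cst// [X in (_ + _ * X <= _)%E]VE -EFinM; apply: leeD => //.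
  rewrite ge0_integralZl//; last by move=> v _; rewrite expe_ge0.
  by apply: lee_wpmul2l; rewrite ?lee_fin//; exact: annulus_piece.
rewrite big_split/= sumEFin sumr_const card_ord -[_ *+ N]mulr_natr.
apply: leeD; last by rewrite lee_fin mulrAC.
have I0 k : (0 <= \int[vol]_y ((rho y ^+ n) * (\1_(annulus t k) y)%:E))%E.
  by apply: integral_ge0.
rewrite -ge0_sume_distrr//; apply: lee_wpmul2l; first by rewrite lee_fin.
rewrite -ge0_integral_sum//; apply: ge0_le_integral_sup => y _.
  by apply: sume_ge0.
rewrite -ge0_sume_distrr//.
rewrite sumEFin -[leRHS]mule1; apply: lee_wpmul2l; first exact: expe_ge0.
by rewrite lee_fin sum_annulus.
Qed.

(* The tangent inequality is applied to the density on the k-th ring scaled by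
   q^k sg, at the constant value c that an extremal density takes there. *)
Lemma radial_lower : ((kap ^+ n * V)%:E <= ((q * (q - 1)) ^+ n * N%:R ^+ n.-1)%:E * P)%E.
Proof.
have qq : 0 < q * (q - 1) by rewrite mulr_gt0// subr_gt0.
have N0' : 0 < N%:R :> R by rewrite ltr0n.
(* If all N scaled densities equal c, then q times the integral over [1, q] of their sum is q (q -
   1) N c, which is to be kap. *)
pose c := kap / (q * (q - 1) * N%:R).
have c_0 : 0 < c by rewrite divr_gt0// mulr_gt0.
have n0' : (0 <= (n%:R)%:E :> \bar R)%E by rewrite lee_fin.
have qE : (0 <= q%:E)%E by rewrite lee_fin ltW.
have V0 : 0 <= V by apply: fine_ge0.
have h1 : ((kap * V)%:E <= q%:E * \int[mu]_(t in `[1%R, q]) \int[vol]_(v in C) G (v, t))%E.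
  apply: le_trans kapV _.
  apply: (@le_trans _ _ (\int[vol]_(v in C) (q%:E * \int[mu]_(t in `[1%R, q]) G (v, t)))%E).
    apply: ge0_le_integral_sup => v Cv; first exact: segment_integral_ge0.
    apply: le_trans (segment_blocks (Cq Cv)) _.
    have mfv k : measurable_fun `[1%R, q]%classic (fun t => f k (v, t)).
      by apply: measurable_funTS; exact: (measurableT_comp (mf k) (pair1_measurable v)).
    rewrite /G ge0_integral_sum//; last 2 first.
    - by move=> k; apply: emeasurable_funM; [exact: measurable_cst|exact: mfv].
    - by move=> k t _; rewrite mule_ge0// lee_fin ltW.
    rewrite ge0_sume_distrr; last first.
      by move=> k _; apply: integral_ge0 => t _; rewrite mule_ge0// lee_fin ltW.
    apply: lee_sum => k _; rewrite ge0_integralZl//; last 2 first.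
    - exact: mfv.
    - by rewrite lee_fin ltW.
    by rewrite muleA -EFinM.
  rewrite ge0_integralZl//; last 2 first.
  - apply: measurable_funTS.
    exact: (@measurable_integral_snd _ _ _ _ _ mu `[1%R, q]%classic G (measurable_itv _) mG G0).
  - by move=> v _; apply: integral_ge0.
  by rewrite (@tonelli_on _ _ _ _ _ vol mu C `[1%R, q]%classic G mC (measurable_itv _) mG G0).
have h2 : ((n%:R * (kap * V))%:E <= (q * (q - 1))%:E *
    ((c ^- n.-1)%:E * P + (n.-1%:R * c * N%:R * V)%:E))%E.
  rewrite EFinM; apply: le_trans (lee_wpmul2l n0' h1) _.
  rewrite muleCA EFinM -muleA; apply: lee_wpmul2l => //.
  rewrite -ge0_integralZl//; last 2 first.
  - apply: measurable_funTS.
    exact: (@measurable_integral_fst _ _ _ _ _ vol C G mC mG G0).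
  - by move=> t _; apply: integral_ge0.
  apply: (@le_trans _ _ (\int[mu]_(t in `[1%R, q])
     ((c ^- n.-1)%:E * P + (n.-1%:R * c * N%:R * V)%:E))%E).
    apply: ge0_le_integral_sup => t /=.
      by move=> _; rewrite mule_ge0//; apply: integral_ge0.
    by rewrite in_itv/= => /andP[t1 _]; exact: slice.
  rewrite integral_cst//= lebesgue_measure_itv/= lte_fin q1 -EFinB muleC; exact: lexx.
have [Poo|Pfin] := eqVneq P +oo%E.
  rewrite Poo gt0_muley ?leey// lte_fin mulr_gt0// exprn_gt0//.
have : P \is a fin_num by rewrite ge0_fin_numE// ltey.
move=> PF; rewrite -(fineK PF) in h2 *; set X := fine P in h2 *.
move: h2; rewrite -(EFinM _ X) -EFinD -!EFinM !lee_fin.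
have nq : q != 0 by rewrite gt_eqF.
have nq1 : q - 1 != 0 by rewrite gt_eqF// subr_gt0.
have nN : N%:R != 0 :> R by rewrite gt_eqF.
have nk : kap != 0 by rewrite gt_eqF.
have cE : q * (q - 1) * (n.-1%:R * c * N%:R * V) = n.-1%:R * (kap * V).
  by rewrite /c; field; rewrite nq nq1 nN.
rewrite mulrDr cE -lerBlDr.
have -> : n%:R * (kap * V) - n.-1%:R * (kap * V) = kap * V.
  by rewrite -mulrBl; case: n n0 => // m _; rewrite -natr1; ring.
move=> h3.
have kn : 0 <= kap ^+ n.-1 by rewrite exprn_ge0// ltW.
have := ler_wpM2l kn h3; congr (_ <= _).
  by rewrite mulrA -exprSr prednK.
rewrite /c expr_div_n !exprMn; case: n n0 => // m _ /=.
rewrite !exprS; field.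
by rewrite !expf_neq0.
Qed.

End radial.

(** * Cones that fill almost half of a shell *)

Section cone_volume.
Context {R : realType} {n : nat}.
Local Notation vol := (@lebesgue_Rn R n).
Implicit Types (e r : R) (a : 'rV[R]_n).

Lemma measurable_ball r : measurable ([set x | enorm x < r] : set (borelRn R n)).
Proof.
have := @measurable_enorm R n measurableT _ (measurable_itv `]-oo, r[).
by rewrite setTI; congr measurable; apply/seteqP; split => x /=; rewrite in_itv.
Qed.

Lemma measurable_slab a e : measurable ([set x | `|dotp a x| < e] : set (borelRn R n)).
Proof.
have := measurable_dotp a measurableT (measurable_itv `](- e), e[).
by rewrite setTI; congr measurable; apply/seteqP; split => x /=; rewrite in_itv/= -ltr_norml.
Qed.

(* The translates of the slab by multiples of 2e a are disjoint. *)
Lemma slab_volume a e r (m : nat) : enorm a = 1 -> 0 < e ->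
  (m%:R%:E * vol ([set x | enorm x < r]%R `&` [set x | `|dotp a x| < e]%R) <=
   vol [set x | enorm x < r + 2 * e * m%:R]%R)%E.
Proof.
move=> a1 e0; set A : set (borelRn R n) := _ `&` _.
have mA : measurable A by apply: measurableI; [exact: measurable_ball|exact: measurable_slab].
pose b (k : nat) := (2 * e * k%:R) *: a.
pose B (k : nat) : set (borelRn R n) := [set x | A ((x : 'rV[R]_n) - b k)].
have mB k : measurable (B k).
  have := measurable_Rn_affine 1 (- b k) measurableT mA.
  rewrite setTI; congr measurable; apply/seteqP; split => x; rewrite /B /= scale1r//.
have volB k : (\int[vol]_x (\1_(B k) x)%:E = vol A)%E.
  by rewrite integral_indic// setIT; exact: lebesgue_translate.
have -> : (m%:R%:E * vol A = \sum_(k < m) \int[vol]_x (\1_(B k) x)%:E)%E.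
  rewrite (eq_bigr (fun=> vol A)) => [|k _]; last exact: volB.
  by rewrite sumr_const card_ord mule_natl.
rewrite -ge0_integral_sum//; last first.
  by move=> k; apply/measurable_EFinP; exact: measurable_indic.
have -> : vol [set x | enorm x < r + 2 * e * m%:R] =
    (\int[vol]_x (\1_([set x | (enorm x < r + 2 * e * m%:R)%R]) x)%:E)%E.
  by rewrite integral_indic// ?setIT//; exact: measurable_ball.
have dB k x : B k x -> `|dotp a x - 2 * e * k%:R| < e /\ enorm x < r + 2 * e * k%:R.
  move=> [/= xr]; rewrite dotpDr dotpNr dotpZr -sqr_enorm a1 expr1n mulr1 => xe; split => //.
  have ek : 0 <= 2 * e * k%:R by rewrite !mulr_ge0// ltW.
  have := ler_enormD (x - b k) (b k); rewrite subrK enormZ a1 mulr1 ger0_norm//; lra.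
apply: ge0_le_integral_sup => x _; first by apply: sume_ge0 => k _; rewrite lee_fin.
rewrite sumEFin lee_fin.
have [[k xk]|xk] := pselect (exists k : 'I_m, B k x); last first.
  rewrite big1 ?lee_fin// => k _; rewrite indicE memNset// => h; apply: xk; by exists k.
have [xk1 xk2] := dB _ _ xk.
rewrite [leRHS]indicE mem_set/=; last first.
  apply: lt_le_trans xk2 _; rewrite lerD2l ler_pM2l ?ler_nat ?(ltnW (ltn_ord k))//.
  by rewrite mulr_gt0.
rewrite (bigD1 k)//= big1 ?addr0 => [|j jk]; first by rewrite indicE; case: (_ \in _).
rewrite indicE memNset// => /dB[] xj1 _.
have le (c d : nat) : (c < d)%N -> 2 * e * c%:R + 2 * e <= 2 * e * d%:R.
  by move=> cd; rewrite -[X in _ + X <= _]mulr1 -mulrDr natr1 ler_pM2l ?ler_nat ?mulr_gt0.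
move: xj1 xk1; rewrite !ltr_norml => /andP[? ?] /andP[? ?].
move: jk; rewrite neq_ltn => /orP[/le|/le]; lra.
Qed.

Lemma lebesgue_Rn_open_gt0 (w : 'rV[R]_n) (r : R) : 0 < r ->
  (0 < vol [set x | enorm (x - w) < r]%R)%E.
Proof.
move=> r0; pose d := r / (n.+1)%:R.
have d0 : 0 < d by rewrite divr_gt0.
have mI i : measurable (`](w 0 i - d), (w 0 i + d)[%classic : set R) by exact: measurable_itv.
apply: (@lt_le_trans _ _ (vol (row_rect (fun i => `](w 0 i - d), (w 0 i + d)[%classic)))).
  rewrite lebesgue_Rn_rect//.
  have dd i : w 0 i - d < w 0 i + d by lra.
  rewrite (eq_bigr (fun=> (2 * d)%:E)) => [|i _]; last first.
    by rewrite lebesgue_measure_itv/= lte_fin dd -EFinB; congr EFin; lra.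
  rewrite (_ : (\prod_(i < n) _ = ((2 * d) ^+ n)%:E)%E).
    by rewrite lte_fin exprn_gt0// mulr_gt0.
  by rewrite -(big_morph EFin EFinM erefl) prodr_const card_ord.
apply: le_measure; rewrite ?inE//.
- exact: measurable_row_rect.
- have := measurable_enorm_sub w measurableT (measurable_itv `]-oo, r[).
  by rewrite setTI; congr measurable; apply/seteqP; split => x /=; rewrite in_itv.
move=> x h /=.
apply: le_lt_trans (enorm_le_normr _) _.
apply: (@le_lt_trans _ _ (n%:R * d)).
  apply: ler_wpM2l => //; rewrite -[`|x - w|]/(mx_norm (x - w)) /mx_norm.
  rewrite -[X in _ <= X]/((NngNum (ltW d0))%:num) num_le.
  apply/bigmax_leP; split => [|[i j] _]; first by rewrite -num_le/= ltW.
  rewrite -num_le/= ord1 !mxE; have := h j.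
  by rewrite /= in_itv/= ler_norml => /andP[? ?]; apply/andP; split; lra.
by rewrite /d mulrA ltr_pdivrMr// mulrC ltr_pM2l// ltr_nat.
Qed.

Lemma lebesgue_shell_gt0 (q : R) : (0 < n)%N -> 1 < q -> 0 < fine (vol (shell 1 q)).
Proof.
move=> n0 q1; apply: fine_gt0; rewrite lebesgue_shell_fin andbT.
have [u [u1 _]] := unit_direction (0 : 'rV[R]_n) 0 n0.
pose w := ((1 + q) / 2) *: u; pose d := (q - 1) / 2.
have d0 : 0 < d by rewrite divr_gt0// subr_gt0.
apply: lt_le_trans (lebesgue_Rn_open_gt0 w d0) _.
apply: le_measure; rewrite ?inE//; [|exact: measurable_shell|].
  have := measurable_enorm_sub w measurableT (measurable_itv `]-oo, d[).
  by rewrite setTI; congr measurable; apply/seteqP; split => x /=; rewrite in_itv.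
move=> x /= xw; have wE : enorm w = (1 + q) / 2.
  by rewrite /w enormZ u1 mulr1 ger0_norm// divr_ge0// addr_ge0// ltW// (lt_trans _ q1).
have := ler_dist_enorm x w; rewrite wE => h; have := le_lt_trans h xw.
rewrite /shell /= ltr_norml /d => /andP[? ?]; apply/andP; split; lra.
Qed.

(** Nearly the half shell in direction a. The margin e keeps the directions off the hyperplane
    orthogonal to a, so that small dilates based close to the sphere fit into the ball
    ([cone_in_ball]). *)
Definition cone a e q : set (borelRn R n) :=
  shell 1 q `&` [set v | e * enorm (v : 'rV[R]_n) < dotp a v].

Lemma measurable_cone a e q : measurable (cone a e q).
Proof.
apply: measurableI; first exact: measurable_shell.
have mh : measurable_fun [set: borelRn R n]
    (fun v : borelRn R n => dotp a v - e * enorm (v : 'rV[R]_n)).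
  apply: measurable_funB; first exact: measurable_dotp.
  by apply: measurable_funM => //; exact: measurable_enorm.
have := mh measurableT _ (measurable_itv `]0, +oo[).
by rewrite setTI; congr measurable; apply/seteqP; split => x /=; rewrite in_itv/= andbT subr_gt0.
Qed.

(** The cone, its reflection and a slab around the hyperplane cover the shell. *)
Lemma shell_cone_volume a e q : 0 <= e ->
  (vol (shell 1 q) <= 2%:E * vol (cone a e q) +
    vol ([set x | enorm x < q]%R `&` [set x | `|dotp a x| <= e * q]%R))%E.
Proof.
move=> e0; set A : set (borelRn R n) := _ `&` [set x | `|dotp a x| <= e * q].
have mA : measurable A.
  apply: measurableI; first exact: measurable_ball.
  have := measurable_dotp a measurableT (measurable_itv `[- (e * q), e * q]).
  by rewrite setTI; congr measurable; apply/seteqP; split => x /=; rewrite in_itv/= -ler_norml.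
have mC := measurable_cone a e q.
have mC' : measurable [set v : borelRn R n | cone a e q (- (v : 'rV[R]_n))].
  have := measurable_Rn_affine (-1) 0 measurableT mC.
  by rewrite setTI; congr measurable; apply/seteqP; split => x /=; rewrite scaleN1r addr0.
rewrite (_ : 2%:E = 1%:E + 1%:E)%E; last by rewrite -EFinD.
rewrite ge0_muleDl// !mul1e -[X in (_ + X + _)%E](lebesgue_opp mC).
apply: (@le_trans _ _ (vol (cone a e q `|` [set v : borelRn R n | cone a e q (- (v : 'rV[R]_n))] `|` A))).
  apply: le_measure; rewrite ?inE//; [exact: measurable_shell|by apply: measurableU => //; exact: measurableU|].
  move=> v /[dup] qv /= /andP[v1 vq].
  have [h|h] := ltP (e * enorm v) (dotp a v); first by left; left.
  have [h'|h'] := ltP (e * enorm v) (- dotp a v).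
    by left; right; split; rewrite /shell /= enormN ?v1// dotpNr.
  right; split => //=; rewrite ler_norml.
  have := ler_wpM2l e0 (ltW vq); move=> ?; apply/andP; split; lra.
apply: le_trans (measureU2 _ _ _) _ => //; first exact: measurableU.
by apply: leeD => //; exact: measureU2.
Qed.

(** By [slab_volume] a thin slab has small volume, with a bound that is uniform in a; hence one
    margin e serves all directions. *)
Lemma cone_volume (q eta : R) : (0 < n)%N -> 1 < q -> q <= 2 -> 0 < eta -> exists2 e : R,
  0 < e <= 2^-1 & forall a, enorm a = 1 ->
    (((1 - eta) / 2 * fine (vol (shell 1 q)))%:E <= vol (cone a e q))%E.
Proof.
move=> n0 q1 q2 eta0; set w := fine _; have w0 : 0 < w by exact: lebesgue_shell_gt0.
have wE : vol (shell 1 q) = w%:E by rewrite fineK// ge0_fin_numE// lebesgue_shell_fin.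
pose B3 : set (borelRn R n) := [set x : 'rV[R]_n | enorm x < 3].
have B3fin : (vol B3 < +oo)%E.
  by apply: (@lebesgue_Rn_bounded _ _ _ 3); [exact: measurable_ball|move=> x /ltW].
pose W := fine (vol B3).
have WE : vol B3 = W%:E by rewrite fineK// ge0_fin_numE.
have W0 : 0 <= W by exact: fine_ge0.
(* If m disjoint translates of the slab fit into the ball of radius 3, its volume is at most W / m
   <= eta w. *)
pose m := (Num.bound (W / (eta * w))).+1.
have m0 : 0 < m%:R :> R by [].
have Wm : W <= m%:R * (eta * w).
  rewrite -ler_pdivrMr ?mulr_gt0//; apply/ltW.
  apply: lt_le_trans (archi_boundP _) _; first by rewrite divr_ge0// mulr_ge0// ltW.
  by rewrite ler_nat.
have m1 : 1 <= m%:R :> R by rewrite ler1n.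
(* With 8 e m = 1, the m translates of a slab of half-width 4 e in the ball of radius 2 reach radius
   2 + 8 e m = 3. The half-width 4 e exceeds e q <= 2 e. *)
exists (8 * m%:R)^-1.
  rewrite invr_gt0 mulr_gt0//=; rewrite lef_pV2 ?posrE ?mulr_gt0//; lra.
move=> a a1; set e := (8 * m%:R)^-1; have e0 : 0 < e by rewrite invr_gt0 mulr_gt0.
have em : 8 * e * m%:R = 1 by rewrite /e; field; rewrite gt_eqF.
pose S : set (borelRn R n) := [set x : 'rV[R]_n | enorm x < 2] `&` [set x | `|dotp a x| < 4 * e].
have mS : measurable S by apply: measurableI; [exact: measurable_ball|exact: measurable_slab].
have h1 : (m%:R%:E * vol S <= W%:E)%E.
  rewrite -WE; have e4 : 0 < 4 * e by rewrite mulr_gt0.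
  have := slab_volume 2 m a1 e4; congr (_ <= vol _)%E.
  by apply/seteqP; split => x; rewrite /B3 /=; have -> : 2 + 2 * (4 * e) * m%:R = 3 by lra.
have h2 : (vol S <= (eta * w)%:E)%E.
  move: h1; rewrite -lee_pdivlMl// -EFinM => h1; apply: le_trans h1 _.
  by rewrite lee_fin mulrC ler_pdivrMr// mulrC.
have h3 := shell_cone_volume a q (ltW e0).
rewrite wE in h3.
have h4 : (w%:E <= 2%:E * vol (cone a e q) + (eta * w)%:E)%E.
  apply: le_trans h3 _; apply: leeD => //; apply: le_trans h2.
  apply: le_measure; rewrite ?inE//.
    apply: measurableI; first exact: measurable_ball.
    have := measurable_dotp a measurableT (measurable_itv `[- (e * q), e * q]).
    by rewrite setTI; congr measurable; apply/seteqP; split => x /=; rewrite in_itv/= -ler_norml.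
  move=> x [/= xq xa]; split => /=; first exact: lt_le_trans q2.
  apply: le_lt_trans xa _; nra.
have Cfin : vol (cone a e q) \is a fin_num.
  rewrite ge0_fin_numE//; apply: le_lt_trans (lebesgue_shell_fin 1 q).
  by apply: le_measure; rewrite ?inE//; [exact: measurable_cone|exact: measurable_shell|move=> x []].
move: h4; rewrite -(fineK Cfin) -EFinM -EFinD !lee_fin; lra.
Qed.

End cone_volume.

Section lower_tools.
Context {R : realType} {n : nat}.
Local Notation mu := (@lebesgue_measure R).
Local Notation vol := (@lebesgue_Rn R n).

(** Y may be infinite: it is subtracted only when Y < 1, and otherwise the claim is immediate. *)
Lemma integral_average (F : R -> \bar R) (S : R) (Y : \bar R) : 0 < S ->
  (forall s, 0 <= F s)%E -> (0 <= Y)%E -> (forall s, 0 <= s <= S -> (1 <= F s + Y)%E) ->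
  (1 <= S^-1%:E * \int[mu]_(s in `[0%R, S]) F s + Y)%E.
Proof.
move=> S0 F0 Y0 FY.
have I0 : (0 <= S^-1%:E * \int[mu]_(s in `[0%R, S]) F s)%E.
  by rewrite mule_ge0 ?lee_fin ?invr_ge0 ?(ltW S0)// integral_ge0.
have [Y1|Y1] := leP 1%E Y; first by rewrite -[leLHS]add0e; exact: leeD.
have Yfin : Y \is a fin_num by rewrite ge0_fin_numE// (lt_trans Y1)// ltey.
rewrite -(fineK Yfin) in Y0 Y1 FY *; set y := fine Y in Y0 Y1 FY *.
rewrite -leeBlDr// -EFinB.
have -> : (1 - y)%:E = (S^-1%:E * \int[mu]_(s in `[0%R, S]) (1 - y)%:E)%E.
  rewrite integral_cst//= lebesgue_measure_itv/= lte_fin S0 oppr0 addr0 -!EFinM.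
  by congr EFin; field; rewrite gt_eqF.
apply: lee_wpmul2l; first by rewrite lee_fin invr_ge0 ltW.
apply: ge0_le_integral_sup => s; first by rewrite lee_fin subr_ge0 -lee_fin ltW.
by rewrite /= in_itv/= => /FY; rewrite EFinB leeBlDr.
Qed.

Lemma ge0_integral_affine_preimage (c : R) (b : 'rV[R]_n) (C : set (borelRn R n))
    (f : borelRn R n -> \bar R) : 0 < c -> measurable C ->
  measurable_fun setT f -> (forall x, 0 <= f x)%E ->
  (\int[vol]_(x in [set y | C (c^-1 *: ((y : 'rV[R]_n) - b))%R]) f x =
   (c ^+ n)%:E * \int[vol]_(v in C) f (c *: (v : 'rV[R]_n) + b)%R)%E.
Proof.
move=> c0 mC mf f0; set D : set (borelRn R n) := [set y | _].
have mD : measurable (D : set (borelRn R n)).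
  have := measurable_Rn_affine c^-1 (- (c^-1 *: b)) measurableT mC.
  by rewrite setTI; congr measurable; apply/seteqP; split => x; rewrite /D /= scalerBr.
rewrite [LHS]integral_mkcond (@ge0_integral_Rn_affine _ _ c b)//; last 3 first.
- by rewrite gt_eqF.
- by apply/(measurable_restrictT _ _).1; [exact: mD|exact: measurable_funTS].
- by move=> x; exact: erestrict_ge0.
rewrite gtr0_norm//; congr (_ * _)%E; rewrite [RHS]integral_mkcond.
apply: eq_integral => v _; rewrite /patch; congr (if _ then _ else _).
apply/idP/idP; rewrite !inE /D /= addrK scalerA mulVf ?gt_eqF// scale1r//.
Qed.

End lower_tools.

Section link_cone.
Context {R : realType} {n : nat}.
Local Notation mu := (@lebesgue_measure R).
Local Notation vol := (@lebesgue_Rn R n).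
Variables (rho : borelRn R n -> \bar R) (z b : 'rV[R]_n) (S Rad c0 lam : R)
  (e : R -> 'rV[R]_n) (C : set (borelRn R n)).
Hypotheses (n0 : (0 < n)%N) (mrho : measurable_fun [set: borelRn R n] rho)
  (rho0 : forall x, (0 <= rho x)%E)
  (me : measurable_fun [set: R] (e : R -> borelRn R n))
  (S0 : 0 < S) (R0 : 0 < Rad) (c0_gt0 : 0 < c0) (lam0 : 0 < lam)
  (eS : forall s, 0 <= s <= S -> enorm (e s - z) = s)
  (mC : measurable C)
  (CR : forall v s, C v -> 0 <= s <= S -> enorm (b + lam *: (v : 'rV[R]_n) - e s) <= Rad).

Let H (x : borelRn R n) := (\int[mu]_(s in `[0%R, S]) segment_integral rho (e s) x)%E.

Let H0 x : (0 <= H x)%E.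
Proof. by apply: integral_ge0 => s _; exact: segment_integral_ge0. Qed.

Let mH : measurable_fun [set: borelRn R n] H.
Proof.
have mh : measurable_fun [set: borelRn R n * R] (fun z : borelRn R n * R =>
    ((e z.2 : borelRn R n), z.1)).
  by apply: measurable_fun_pair => //; exact: (measurableT_comp me).
have := @measurable_integral_snd _ _ _ _ _ mu `[0%R, S]%classic _ (measurable_itv _)
  (measurableT_comp (measurable_segment_integral mrho rho0) mh).
by move=> /(_ (fun z => segment_integral_ge0 rho0 _ _)).
Qed.

Lemma measurable_link :
  measurable_fun [set: borelRn R n] (fun v : borelRn R n =>
    \int[mu]_(s in `[0%R, S]) segment_integral rho (e s) (b + lam *: (v : 'rV[R]_n)))%E.
Proof.
rewrite (_ : (fun _ => _) = H \o (fun v : borelRn R n => lam *: (v : 'rV[R]_n) + b)).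
  exact: (measurableT_comp mH (measurable_Rn_affine lam b)).
by apply/funext => v; rewrite /H /= addrC.
Qed.

(** This is [link_integral] for the copy b + lam C of the cone, divided by S lam^n. Taking the mean
    over s removes S from the volume term. *)
Lemma link_cone :
  (\int[vol]_(v in C) (S^-1%:E * \int[mu]_(s in `[0%R, S])
      segment_integral rho (e s) (b + lam *: (v : 'rV[R]_n))) <=
   (n%:R * Rad * c0)%:E * vol C +
   (n%:R * (Rad * (2 * Rad * c0 ^- n.-1)) / (S * lam ^+ n))%:E * \int[vol]_x (rho x ^+ n))%E.
Proof.
set P := (\int[vol]_x _)%E; have P0 : (0 <= P)%E by apply: integral_ge0 => x _; exact: expe_ge0.
pose D : set (borelRn R n) := [set y | C (lam^-1 *: ((y : 'rV[R]_n) - b))].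
have mD : measurable D.
  have := measurable_Rn_affine lam^-1 (- (lam^-1 *: b)) measurableT mC.
  by rewrite setTI; congr measurable; apply/seteqP; split => x; rewrite /D /= scalerBr.
have volD : vol D = ((lam ^+ n)%:E * vol C)%E.
  rewrite -(lebesgue_scale lam0 mC); apply: (@lebesgue_translate _ _ b [set x | C (lam^-1 *: x)]).
  have := measurable_Rn_affine lam^-1 0 measurableT mC.
  by rewrite setTI; congr measurable; apply/seteqP; split => x; rewrite /= addr0.
have ln : 0 < lam ^+ n by rewrite exprn_gt0.
have DR x s : D x -> 0 <= s <= S -> enorm ((x : 'rV[R]_n) - e s) <= Rad.
  move=> Dx sS; have := CR Dx sS.
  by rewrite scalerA divff ?gt_eqF// scale1r (addrC b) subrK.
have := @link_integral _ _ rho e S Rad c0 z D n0 mrho rho0 me (ltW S0) R0 c0_gt0 eS mD DR.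
rewrite -/P -[X in (X <= _)%E]/(\int[vol]_(x in D) H x)%E.
rewrite (ge0_integral_affine_preimage _ lam0 mC mH H0) => h.
rewrite ge0_integralZl//; last 3 first.
- by apply: measurable_funTS; exact: measurable_link.
- by move=> v _; apply: integral_ge0 => s _; exact: segment_integral_ge0.
- by rewrite lee_fin invr_ge0 ltW.
have -> : (\int[vol]_(x in C) \int[mu]_(s in `[0%R, S]) segment_integral rho (e s) (b + lam *: (x : 'rV[R]_n)) =
   \int[vol]_(v in C) H (lam *: (v : 'rV[R]_n) + b)%R)%E.
  by apply: eq_integral => v _; rewrite /H addrC.
move: h; rewrite -lee_pdivlMl// => h.
apply: le_trans (lee_wpmul2l _ h) _; first by rewrite lee_fin invr_ge0 ltW.
rewrite volD !muleA -!EFinM.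
rewrite ge0_muleDr; [|by rewrite mule_ge0// lee_fin !mulr_ge0// ?exprn_ge0 ?invr_ge0 ?exprn_ge0// ltW..].
rewrite !muleA -!EFinM; apply: leeD; rewrite le_eqVlt; apply/orP; left; apply/eqP;
  congr (_%:E * _)%E; field; by rewrite ?expf_neq0 ?gt_eqF.
Qed.

End link_cone.

(** * Two links and a radial segment *)

Section modulus_lower.
Context {R : realType} {n : nat}.
Local Notation mu := (@lebesgue_measure R).
Local Notation vol := (@lebesgue_Rn R n).
Variables (rho : borelRn R n -> \bar R) (p : 'rV[R]_n) (q sg dl X : R) (N : nat)
  (g1 g2 : R -> 'rV[R]_n) (C : set (borelRn R n)).
Let P : \bar R := (\int[vol]_x (rho x ^+ n))%E.
Let V := fine (vol C).
Let lam := q ^+ N * sg.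
(** [th] and [th2] make the volume terms of the two links, 3 n th V and 2 n th2 V, equal to dl V /
    2. The hypotheses [X1] and [X2] keep the energy terms below the same value, X being a bound of
    the energy. *)
Let th := dl / (6 * n%:R).
Let th2 := dl / (4 * n%:R).
Hypotheses (n0 : (0 < n)%N) (mrho : measurable_fun [set: borelRn R n] rho)
  (rho0 : forall x, (0 <= rho x)%E) (q1 : 1 < q) (q2 : q <= 2) (sg0 : 0 < sg)
  (dl0 : 0 < dl) (dl1 : dl < 2^-1) (N0 : (0 < N)%N)
  (mC : measurable C) (Cq : C `<=` shell 1 q)
  (cg1 : {within `[0, 1], continuous g1}) (cg2 : {within `[0, 1], continuous g2})
  (g10 : g1 0 = p) (g20 : g2 0 = 0)
  (g11 : sg <= enorm (g1 1 - g1 0)) (g21 : 2^-1 <= enorm (g2 1 - g2 0))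
  (Cball : forall v, C v -> enorm (p + lam *: (v : 'rV[R]_n)) < 1)
  (adm : forall s t v, 0 <= s <= 1 -> 0 <= t <= 1 -> C v ->
    (1 <= segment_integral rho (g1 s) (p + sg *: (v : 'rV[R]_n)) +
      (segment_integral rho (p + sg *: (v : 'rV[R]_n)) (p + lam *: (v : 'rV[R]_n)) +
       segment_integral rho (g2 t) (p + lam *: (v : 'rV[R]_n))))%E)
  (PX : (P <= X%:E)%E)
  (X1 : 18 * n%:R * th ^- n.-1 * X <= dl / 2 * V)
  (X2 : 16 * n%:R * th2 ^- n.-1 * lam ^- n * X <= dl / 2 * V).

Let VE : vol C = V%:E.
Proof.
rewrite /V fineK// ge0_fin_numE//; apply: (@lebesgue_Rn_bounded _ _ _ q) => //.
by move=> x /Cq /= /andP[_ /ltW].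
Qed.

Let n0' : (n%:R : R) != 0. Proof. by rewrite pnatr_eq0 -lt0n. Qed.
Let n1 : 0 < n%:R :> R. Proof. by rewrite ltr0n. Qed.
Let th0 : 0 < th. Proof. by rewrite divr_gt0// mulr_gt0. Qed.
Let th20 : 0 < th2. Proof. by rewrite divr_gt0// mulr_gt0. Qed.
Let lam0 : 0 < lam. Proof. by rewrite mulr_gt0// exprn_gt0// (lt_trans _ q1). Qed.

Let Y (v : borelRn R n) :=
  segment_integral rho (p + sg *: (v : 'rV[R]_n)) (p + lam *: (v : 'rV[R]_n)).

Let mY : measurable_fun [set: borelRn R n] Y.
Proof.
have mh : measurable_fun [set: borelRn R n] (fun v : borelRn R n =>
    ((sg *: (v : 'rV[R]_n) + p : borelRn R n), (lam *: (v : 'rV[R]_n) + p : borelRn R n))).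
  by apply: measurable_fun_pair; exact: measurable_Rn_affine.
have := measurableT_comp (measurable_segment_integral mrho rho0) mh.
by congr measurable_fun; apply/funext => v /=; rewrite /Y !(addrC p).
Qed.

Let P0 : (0 <= P)%E.
Proof. by apply: integral_ge0 => x _; exact: expe_ge0. Qed.

Let absorb (k c : R) : 0 <= c -> k = dl / 2 -> c * X <= dl / 2 * V ->
  (k%:E * vol C + c%:E * P <= (dl * V)%:E)%E.
Proof.
move=> c_0 -> cX; apply: (@le_trans _ _ ((dl / 2 * V)%:E + (c * X)%:E)%E).
  rewrite VE -EFinM; apply: leeD => //; rewrite [leRHS]EFinM.
  by apply: lee_wpmul2l; rewrite ?lee_fin.
by rewrite -EFinD lee_fin; lra.
Qed.

(* Average the admissibility inequality over the starting points e1 s and e2 s,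
   then integrate over the cone: each of the two links costs at most dl V. *)
Lemma cone_segments_lower : (((1 - 2 * dl) * V)%:E <= \int[vol]_(v in C) Y v)%E.
Proof.
have [e1 [me1 e1S e1g]] := hitting_selection cg1 g11.
have [e2 [me2 e2S e2g]] := hitting_selection cg2 g21.
rewrite g10 in e1S; rewrite g20 in e2S.
pose A1 (v : borelRn R n) := (sg^-1%:E * \int[mu]_(s in `[0%R, sg])
  segment_integral rho (e1 s) (p + sg *: (v : 'rV[R]_n)))%E.
pose A2 (v : borelRn R n) := ((2^-1)^-1%:E * \int[mu]_(s in `[0%R, (2^-1)%R])
  segment_integral rho (e2 s) (p + lam *: (v : 'rV[R]_n)))%E.
have Y0 v : (0 <= Y v)%E by exact: segment_integral_ge0.
have A10 v : (0 <= A1 v)%E.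
  by apply: mule_ge0; [rewrite lee_fin invr_ge0 ltW|apply: integral_ge0 => s _; exact: segment_integral_ge0].
have A20 v : (0 <= A2 v)%E.
  by apply: mule_ge0; [rewrite lee_fin invr_ge0|apply: integral_ge0 => s _; exact: segment_integral_ge0].
have mA1 : measurable_fun [set: borelRn R n] A1.
  by apply: measurable_funeM; apply: measurable_link.
have mA2 : measurable_fun [set: borelRn R n] A2.
  by apply: measurable_funeM; apply: measurable_link.
have pt v : C v -> (1 <= A2 v + (A1 v + Y v))%E.
  move=> Cv; apply: integral_average; first by rewrite invr_gt0.
  - by move=> s; exact: segment_integral_ge0.
  - exact: adde_ge0.
  move=> s /e2g[t t01 ->].
  rewrite addeCA; apply: integral_average => //.
  - by move=> s'; exact: segment_integral_ge0.
  - by apply: adde_ge0 => //; exact: segment_integral_ge0.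
  move=> s' /e1g[t' t'01 ->]; rewrite [X in (_ + X)%E]addeC; exact: adm.
have b1 : (\int[vol]_(v in C) A1 v <= (dl * V)%:E)%E.
  (* Since |sg v| <= 2 sg and |e1 s - p| = s <= sg, these links have length at most 3 sg. All their
     lengths scale with sg, so sg drops out of the energy term. *)
  have sg3 : 0 < 3 * sg by rewrite mulr_gt0.
  have c0 : 0 < th / sg by rewrite divr_gt0.
  apply: le_trans (@link_cone _ _ rho p p sg (3 * sg) (th / sg) sg e1 C n0 mrho rho0 me1 sg0 sg3 c0 sg0 e1S mC _) _.
    move=> v s Cv sS; have := Cq Cv; rewrite /shell /= => /andP[v1 vq].
    have /andP[_ sS'] := sS.
    rewrite (_ : p + sg *: (v : 'rV[R]_n) - e1 s = sg *: (v : 'rV[R]_n) - (e1 s - p)); last first.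
      by rewrite opprB addrA (addrC _ p).
    apply: le_trans (ler_enormB _ _) _; rewrite enormZ gtr0_norm// e1S//.
    have : sg * enorm (v : 'rV[R]_n) <= sg * 2 by rewrite ler_pM2l// (le_trans (ltW vq)).
    by move: sS'; lra.
  apply: absorb.
  - rewrite mulr_ge0 ?invr_ge0 ?mulr_ge0 ?exprn_ge0 ?invr_ge0 ?exprn_ge0//; exact: ltW.
  - by rewrite /th; field; rewrite n0' gt_eqF.
  - suff -> : n%:R * (3 * sg * (2 * (3 * sg) * (th / sg) ^- n.-1)) / (sg * sg ^+ n) =
       18 * n%:R * th ^- n.-1 by [].
    case: n n0 th0 => // m _ th0'; rewrite /= expr_div_n exprS; field.
    by rewrite !expf_neq0 ?gt_eqF.
have b2 : (\int[vol]_(v in C) A2 v <= (dl * V)%:E)%E.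
  (* Both ends lie in the unit ball, so 2 bounds the lengths. The starting points have size 1/2 but
     the cone has size lam, hence a factor lam^-n; later lam = e / q does not depend on N. *)
  apply: le_trans (@link_cone _ _ rho 0 p 2^-1 2 th2 lam e2 C n0 mrho rho0 me2 _ _ th20 lam0 e2S mC _) _ => //.
    move=> v s Cv sS; have := Cball Cv => h.
    apply: le_trans (ler_enormB _ _) _; have := e2S s sS; rewrite subr0 => ->.
    by have /andP[_ ] := sS; move: h; lra.
  apply: absorb.
  - rewrite mulr_ge0 ?invr_ge0 ?mulr_ge0 ?exprn_ge0 ?invr_ge0 ?exprn_ge0//; exact: ltW.
  - by rewrite /th2; field.
  - suff -> : n%:R * (2 * (2 * 2 * th2 ^- n.-1)) / (2^-1 * lam ^+ n) =
       16 * n%:R * th2 ^- n.-1 * lam ^- n by [].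
    by field; rewrite !expf_neq0 ?gt_eqF.
have : (V%:E <= \int[vol]_(v in C) (A2 v + (A1 v + Y v)))%E.
  rewrite -VE -[leLHS]mul1e -integral_cst//; exact: ge0_le_integral_sup.
have m1 : measurable_fun C A1 by exact: measurable_funTS mA1.
have m2 : measurable_fun C A2 by exact: measurable_funTS mA2.
have m3 : measurable_fun C Y by exact: measurable_funTS mY.
have A1Y v : (0 <= A1 v + Y v)%E by exact: adde_ge0 (A10 v) (Y0 v).
rewrite (@ge0_integralD _ _ _ vol C mC A2 (fun v => A1 v + Y v)%E (fun v _ => A20 v) m2
  (fun v _ => A1Y v) (emeasurable_funD m1 m3)).
rewrite (@ge0_integralD _ _ _ vol C mC A1 Y (fun v _ => A10 v) m1 (fun v _ => Y0 v) m3).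
move=> /le_trans/(_ (leeD b2 (leeD b1 (lexx _)))).
case: (\int[_]_(_ in _) _)%E => [I| |]; last 2 first.
- by move=> _; rewrite leey.
- by rewrite !addeNy.
by rewrite -!EFinD !lee_fin; lra.
Qed.

Lemma modulus_cone_lower :
  (((1 - 2 * dl) ^+ n * V)%:E <= ((q * (q - 1)) ^+ n * N%:R ^+ n.-1)%:E * P)%E.
Proof.
have k0 : 0 < 1 - 2 * dl by rewrite subr_gt0 mulrC -ltr_pdivlMr// div1r.
have := @radial_lower _ _ rho p sg q (1 - 2 * dl) N C n0 mrho rho0 sg0 q1 k0 N0 mC Cq.
by apply; exact: cone_segments_lower.
Qed.

End modulus_lower.

(** * The lower bound with constants that depend on n only *)

Section lower_constants.
Context {R : realType} {n : nat}.
Local Notation vol := (@lebesgue_Rn R n).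

(** With r = |p| and s = l |v|, the square of the norm is r^2 - 2 r l (a . v) + s^2, and l (a . v) >
    e s > s^2. So it is at most r^2 + (1 - 2 r) s^2, which is below 1 for r < 1 and s < 1, however
    close p is to the sphere. *)
Lemma cone_in_ball (p a v : 'rV[R]_n) (e q l : R) : enorm a = 1 -> p = - (enorm p *: a) ->
  enorm p < 1 -> 0 < e <= 2^-1 -> cone a e q v -> 0 < l -> l * q <= e ->
  enorm (p + l *: v) < 1.
Proof.
move=> a1 pa p1 /andP[e0 e1] [/= /andP[v1 vq] av] l0 lq.
set r := enorm p in pa p1; have r0 : 0 <= r by exact: enorm_ge0.
pose s := l * enorm v.
have s0 : 0 < s by rewrite mulr_gt0// (lt_trans ltr01).
have se : s < e by apply: lt_le_trans lq; rewrite ltr_pM2l.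
rewrite enorm_lt_sqr// !(dotpDl, dotpDr) (dotpC _ p) -(sqr_enorm p) -(sqr_enorm (l *: v)) -/r.
rewrite enormZ gtr0_norm// -/s [X in dotp X]pa dotpNl dotpZl dotpZr expr1n.
have h : e * s <= l * dotp a v by rewrite /s mulrCA ler_pM2l// ltW.
have h2 := ler_wpM2l r0 h.
have rs : 0 < (1 - r) * (1 - s ^+ 2).
  by rewrite mulr_gt0// subr_gt0// expr_lt1 ?(ltW s0)//; lra.
have r1 : 0 <= r * (1 - r) by rewrite mulr_ge0// subr_ge0 ltW.
have rs2 : 0 <= r * s ^+ 2 by rewrite mulr_ge0// sqr_ge0.
have rse : 0 <= r * (s * (e - s)) by apply: mulr_ge0 => //; apply: mulr_ge0; rewrite ?subr_ge0 ltW.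
by move: h2 rs r1 rs2 rse; rewrite !expr2; lra.
Qed.

(* With this q and dl, q^n <= 4/3 and (1 - 2 dl)^n >= 7/8; the lower bound below
   and [modulus_ring_upper] then differ by a factor less than 2, apart from
   K (N / M)^(n - 1). *)
Let q : R := 1 + (4 * n%:R)^-1.
Let dl : R := (16 * n%:R)^-1.
Let om := fine (vol (shell 1 q)).

(** If the energy is at least a threshold X fixed by n, the claim holds once N is large. Otherwise X
    bounds the energy terms of the links, and [modulus_cone_lower] applies. *)
Lemma polygon_density_lower : (1 < n)%N -> exists (e : R) (N0 : nat), 0 < e <= 2^-1 /\
  forall N p (g1 g2 : R -> 'rV[R]_n) (rho : borelRn R n -> \bar R),
    (N0 <= N)%N -> enorm p < 1 ->
    {within `[0, 1], continuous g1} -> {within `[0, 1], continuous g2} ->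
    g1 0 = p -> g2 0 = 0 ->
    e * q ^- N <= enorm (g1 1 - p) -> 2^-1 <= enorm (g2 1) ->
    measurable_fun [set: borelRn R n] rho -> (forall x, 0 <= rho x)%E ->
    (forall s t x x', 0 <= s <= 1 -> 0 <= t <= 1 -> unit_ball x -> unit_ball x' ->
      (1 <= segment_integral rho (g1 s) x + (segment_integral rho x x' +
         segment_integral rho (g2 t) x'))%E) ->
    ((om / 4)%:E <= ((q - 1) ^+ n * N%:R ^+ n.-1)%:E * \int[vol]_x (rho x ^+ n))%E.
Proof.
move=> n2; have n0 : (0 < n)%N by apply: ltn_trans n2.
have n1 : 1 <= n%:R :> R by rewrite ler1n.
have np : 0 < n%:R :> R by rewrite ltr0n.
have qn : 0 < q - 1 by rewrite /q addrAC subrr add0r invr_gt0 mulr_gt0.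
have q1 : 1 < q by rewrite -subr_gt0.
have q0 : 0 < q by exact: lt_trans q1.
have q2 : q <= 2.
  by rewrite /q [leRHS](_ : 2 = 1 + 1)// lerD2l invf_le1 ?mulr_gt0//; lra.
have om0 : 0 < om by exact: lebesgue_shell_gt0.
have dl0 : 0 < dl by rewrite invr_gt0 mulr_gt0.
have dln : 16 * n%:R * dl = 1 by rewrite divff// gt_eqF// mulr_gt0.
have dl1 : dl < 2^-1 by rewrite ltf_pV2 ?posrE ?mulr_gt0//; lra.
have eta0 : 0 < 8^-1 :> R by rewrite invr_gt0.
have [e /[dup] e01 /andP[e0 e1] coneV] := @cone_volume R n q 8^-1 n0 q1 q2 eta0.
pose th := dl / (6 * n%:R); pose th2 := dl / (4 * n%:R).
have th0 : 0 < th by rewrite divr_gt0// mulr_gt0.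
have th20 : 0 < th2 by rewrite divr_gt0// mulr_gt0.
have eq0 : 0 < e / q by rewrite divr_gt0.
pose c1 := 18 * n%:R * th ^- n.-1; pose c2 := 16 * n%:R * th2 ^- n.-1 * (e / q) ^- n.
have c10 : 0 < c1 by rewrite divr_gt0 ?mulr_gt0 ?exprn_gt0.
have c20 : 0 < c2 by rewrite divr_gt0 ?divr_gt0 ?mulr_gt0 ?exprn_gt0.
pose m := (1 - 8^-1) / 2 * om.
have m0 : 0 < m by rewrite mulr_gt0//; lra.
(* Dividing by c1 + c2 gives the bounds on c1 X and c2 X required by both links; m is the lower
   bound for the volume of the cone. *)
pose X := dl / 2 * m / (c1 + c2).
have X0 : 0 < X by rewrite divr_gt0 ?addr_gt0// mulr_gt0// divr_gt0.
have frac (c d : R) : 0 < c -> 0 < d -> c * (dl / 2 * m / (c + d)) <= dl / 2 * m.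
  move=> c_0 d_0; rewrite mulrCA ler_piMr//.
    by rewrite mulr_ge0 ?divr_ge0 ?(ltW dl0) ?(ltW m0).
  by rewrite ler_pdivrMr ?addr_gt0// mul1r lerDl ltW.
have c1X : c1 * X <= dl / 2 * m by exact: frac.
have c2X : c2 * X <= dl / 2 * m by rewrite /X addrC; exact: frac.
(* N >= Z gives om / 4 <= (q - 1)^n N X, and N <= N^(n-1) because n >= 2. *)
pose Z := om / 4 / ((q - 1) ^+ n * X).
have qX : 0 < (q - 1) ^+ n * X by rewrite mulr_gt0// exprn_gt0.
exists e, (Num.bound Z).+1; split => //.
move=> N p g1 g2 rho N0 p1 cg1 cg2 g10 g20 g11 g21 mrho rho0 adm.
have Np : (0 < N)%N by apply: leq_trans N0.
have N1 : 1 <= N%:R :> R by rewrite ler1n.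
set P := (\int[vol]_x _)%E.
have P0 : (0 <= P)%E by apply: integral_ge0 => x _; exact: expe_ge0.
have QN : 0 <= (q - 1) ^+ n * N%:R ^+ n.-1.
  by rewrite mulr_ge0 ?exprn_ge0 ?(ltW qn)//.
have [XP|PX] := ltP X%:E P.
  apply: le_trans (lee_wpmul2l _ (ltW XP)); last by rewrite lee_fin.
  rewrite -EFinM lee_fin mulrAC -ler_pdivrMl// mulrC -/Z.
  apply: (@le_trans _ _ N%:R).
    apply/ltW/(lt_le_trans (archi_boundP _)).
      by rewrite divr_ge0 ?divr_ge0// ltW.
    by rewrite ler_nat (leq_trans _ N0).
  case: (n) n2 => [|[|k]]//= _; rewrite exprS ler_peMr//; exact: exprn_ege1.
have [u [u1 pu]] : exists u : 'rV[R]_n, enorm u = 1 /\ p = enorm p *: u.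
  have [u [u1]] := unit_direction 0 p n0; rewrite subr0 => pu.
  by exists u.
have [u' u'E] : exists u', u' = - u by exists (- u).
have a1 : enorm u' = 1 by rewrite u'E enormN.
have pa : p = - (enorm p *: u') by rewrite u'E scalerN opprK.
(* The exponent N + 1 makes the outer scale q^N sg equal to e / q, which is independent of N and
   small enough for [cone_in_ball]. *)
pose sg := e * q ^- N.+1.
have sg0 : 0 < sg by rewrite mulr_gt0// invr_gt0 exprn_gt0.
have lamE : q ^+ N * sg = e / q.
  by rewrite /sg exprS; field; rewrite expf_neq0 gt_eqF.
have lq : e / q * q <= e by rewrite divfK// gt_eqF.
have sq : sg * q <= e.
  apply: le_trans lq; rewrite ler_pM2r// -lamE ler_peMl ?(ltW sg0)//.
  by rewrite exprn_ege1// ltW.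
pose C := cone u' e q.
have mC : measurable C by exact: measurable_cone.
have CV : m <= fine (vol C).
  rewrite -lee_fin fineK; first exact: coneV.
  rewrite ge0_fin_numE//; apply: le_lt_trans (lebesgue_shell_fin 1 q).
  by apply: le_measure; rewrite ?inE//; [exact: measurable_shell|move=> x []].
have lower := @modulus_cone_lower R n rho p q sg dl X N g1 g2 C n0 mrho rho0 q1 q2 sg0 dl0 dl1 Np mC.
have {lower} : (((1 - 2 * dl) ^+ n * fine (vol C))%:E <= ((q * (q - 1)) ^+ n * N%:R ^+ n.-1)%:E * P)%E.
  apply: lower => //.
  - by move=> x [].
  - rewrite g10; apply: le_trans g11; rewrite /sg ler_pM2l// lef_pV2 ?posrE ?exprn_gt0//.
    by rewrite ler_eXn2l.
  - by rewrite g20 subr0.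
  - by move=> v Cv; rewrite lamE; exact: (cone_in_ball a1 pa p1 e01 Cv).
  - move=> s t v s01 t01 Cv; apply: adm => //; rewrite /unit_ball /= ?lamE.
      exact: (cone_in_ball a1 pa p1 e01 Cv).
    exact: (cone_in_ball a1 pa p1 e01 Cv).
  - by apply: le_trans c1X _; rewrite ler_pM2l// divr_gt0.
  - by rewrite lamE; apply: le_trans c2X _; rewrite ler_pM2l// divr_gt0.
have k7 : 7 / 8 <= (1 - 2 * dl) ^+ n.
  have h : 0 <= 1 - 2 * dl by lra.
  by apply: le_trans (bernoulli n h); lra.
have q43 : q ^+ n <= 4 / 3.
  have qi : 0 <= q^-1 by rewrite invr_ge0 ltW.
  have : 3 / 4 <= q ^- n.
    rewrite -exprVn; apply: le_trans (bernoulli n qi).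
    have -> : 1 + n%:R * (q^-1 - 1) = 1 - n%:R / (4 * n%:R + 1).
      rewrite /q; field; rewrite !gt_eqF ?addr_gt0 ?mulr_gt0//.
    rewrite lerBrDr -lerBrDl ler_pdivrMr ?addr_gt0 ?mulr_gt0//; lra.
  move=> h; rewrite -[q ^+ n]invrK -[4 / 3]invrK lef_pV2 ?posrE ?invr_gt0 ?exprn_gt0// invf_div//.
rewrite exprMn -[X in (_ <= X%:E * _)%E]mulrA (EFinM (q ^+ n)) -muleA => h.
(* 49/128 is 7/8 times 7/16, the latter being the share of the shell kept by the cone. Dividing it
   by 4/3 leaves more than 1/4. *)
have {}h : ((49 / 128 * om)%:E <= (4 / 3)%:E * (((q - 1) ^+ n * N%:R ^+ n.-1)%:E * P))%E.
  apply: le_trans (le_trans h _).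
    rewrite lee_fin; apply: (@le_trans _ _ (7 / 8 * m)); first by rewrite /m; lra.
    by apply: ler_pM => //; exact: ltW.
  by apply: lee_wpmul2r; rewrite ?lee_fin// mule_ge0// lee_fin.
move: h; rewrite muleC -lee_pdivrMr ?divr_gt0// => h; apply: le_trans h.
by rewrite -EFinM lee_fin; move: om0; lra.
Qed.

End lower_constants.

(** * Boundary behaviour *)

Section distortion.
Context {R : realType} {n : nat}.
Local Notation ball := (@unit_ball R n).
Local Notation vol := (@lebesgue_Rn R n).
Variables (K : R) (f h : 'rV[R]_n -> 'rV[R]_n).
(** [f] and [h] play symmetric roles, so that everything applies to the inverse as well. In [modK]
    the curve maps stay in the ball off their domains too: then [h] and [f] cancel on the whole of
    [curve_map], and the image families are equal as sets of records. *)
Hypotheses (n2 : (1 < n)%N) (K1 : 1 <= K)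
  (cf : {within ball, continuous f}) (ch : {within ball, continuous h})
  (fB : forall x, ball x -> ball (f x)) (hB : forall x, ball x -> ball (h x))
  (hf : forall x, ball x -> h (f x) = x) (fh : forall x, ball x -> f (h x) = x)
  (f0 : f 0 = 0)
  (modK : forall Gam : set (curve R n),
    (forall g, Gam g -> curve_in ball g /\ forall t, ball (curve_map g t)) ->
    (modulus (curve_image f @` Gam) <= K%:E * modulus Gam)%E).

Let n0 : (0 < n)%N. Proof. exact: ltn_trans n2. Qed.

(** The closed half ball is compact, so |h| has a maximum below 1 on it; points of the ball beyond
    that radius have their images outside the half ball. The time t depends on f, but later
    estimates use only the bound 1/2. *)
Lemma image_leaves_half_ball (xi : 'rV[R]_n) : enorm xi = 1 ->
  exists2 t, 0 <= t < 1 & 2^-1 <= enorm (f (- (t *: xi))).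
Proof.
move=> xi1; pose A : set 'rV[R]_n := [set y | enorm y <= 2^-1].
have A0 : A 0 by rewrite /A /= enorm0.
have AB y : A y -> ball y by rewrite /A /unit_ball /= => h'; lra.
have cA : compact A.
  apply: bounded_closed_compact.
    exists 1; split; first exact: num_real.
    move=> r r1 y /= Ay; apply: le_trans (normr_le_enorm y) _.
    by apply: le_trans Ay _; lra.
  have -> : A = (@enorm R n) @^-1` [set t | t <= 2^-1] by [].
  by have /continuous_closedP cl := @continuous_enorm R n; apply: cl; exact: closed_le.
have cE : {within A, continuous (fun y => enorm (h y))}.
  apply/subspace_continuousP => y Ay; apply/cvgrPdist_lt => e e0.
  have /within_continuous_enormP/(_ y (AB y Ay) e e0)[d d0 H] := ch.
  apply/enorm_nbhs; exists d => // z yz Az.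
  by apply: le_lt_trans (ler_dist_enorm _ _) _; apply: H => //; exact: AB.
have [c /set_mem cin cmax] := compact_EVT_max (ex_intro _ _ A0) cA cE.
have c1 : enorm (h c) < 1 by apply: hB; exact: AB.
have c0 := enorm_ge0 (h c).
pose t := (1 + enorm (h c)) / 2.
exists t; first by rewrite /t; apply/andP; split; lra.
rewrite leNgt; apply/negP => ft.
have tB : ball (- (t *: xi)).
  by rewrite /unit_ball /= enormN enormZ xi1 mulr1 ger0_norm /t; lra.
have := cmax (f (- (t *: xi))); rewrite hf// inE => /(_ (ltW ft)).
rewrite enormN enormZ xi1 mulr1 ger0_norm /t; lra.
Qed.

Let q : R := 1 + (4 * n%:R)^-1.
Let om := fine (vol (shell 1 q)).

Variables (e : R) (N0 : nat).
Hypotheses (e01 : 0 < e <= 2^-1) (lower : forall N p (g1 g2 : R -> 'rV[R]_n) (rho : borelRn R n -> \bar R),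
    (N0 <= N)%N -> enorm p < 1 ->
    {within `[0, 1], continuous g1} -> {within `[0, 1], continuous g2} ->
    g1 0 = p -> g2 0 = 0 ->
    e * q ^- N <= enorm (g1 1 - p) -> 2^-1 <= enorm (g2 1) ->
    measurable_fun [set: borelRn R n] rho -> (forall x, 0 <= rho x)%E ->
    (forall s t x x', 0 <= s <= 1 -> 0 <= t <= 1 -> unit_ball x -> unit_ball x' ->
      (1 <= segment_integral rho (g1 s) x + (segment_integral rho x x' +
         segment_integral rho (g2 t) x'))%E) ->
    ((om / 4)%:E <= ((q - 1) ^+ n * N%:R ^+ n.-1)%:E * \int[vol]_x (rho x ^+ n))%E).

Let path_continuous (g : R -> 'rV[R]_n) : (forall s, `[0, 1]%classic s -> ball (g s)) ->
  {within `[0, 1], continuous g} -> {within `[0, 1], continuous (f \o g)}.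
Proof.
move=> gB /within_continuous_pathP cg; apply/within_continuous_pathP => t t01 a a0.
have /within_continuous_enormP/(_ _ (gB t t01) a a0)[d d0 H] := cf.
have [d' d'0 H'] := cg t t01 d d0.
by exists d' => // u u01 tu /=; apply: H; [exact: gB|exact: H'].
Qed.

(** If the images were at least e q^-N apart, [lower] and [modulus_ring_upper] would give om / (4 (q
    - 1)^n N^(n-1)) <= K om M / (2 (M (q - 1))^n), that is M^(n-1) <= 2 K N^(n-1). *)
Lemma distortion_step (M N : nat) (xi x y : 'rV[R]_n) : (0 < M)%N -> (0 < N)%N -> (N0 <= N)%N ->
  2 * K * N%:R ^+ n.-1 < M%:R ^+ n.-1 -> enorm xi = 1 -> ball x -> ball y ->
  enorm (x - xi) <= q ^- M -> enorm (y - xi) <= q ^- M ->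
  enorm (f y - f x) < e * q ^- N.
Proof.
move=> M0 Np NN0 KMN xi1 xB yB xM yM; rewrite ltNge; apply/negP => fxy.
have [T /andP[T0 T1] fT] := image_leaves_half_ball xi1.
pose k1 (s : R) := x + s *: (y - x); pose k2 (s : R) := - ((s * T) *: xi).
have line_cont (a b : 'rV[R]_n) : {within `[0, 1], continuous (fun s : R => a + s *: b)}.
  apply/within_continuous_pathP => t _ c c0; exists (c / (enorm b + 1)).
    by rewrite divr_gt0// ltr_wpDl ?enorm_ge0.
  move=> u _ tu; rewrite opprD addrACA subrr add0r -scalerBl enormZ.
  have b1 : 0 < enorm b + 1 by rewrite ltr_wpDl ?enorm_ge0.
  move: tu; rewrite ltr_pdivlMr// => tu; apply: le_lt_trans tu.
  by rewrite ler_wpM2l// lerDl.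
have k1B s : `[0, 1]%classic s -> ball (k1 s).
  by rewrite /= in_itv/= => /andP[? ?]; exact: ball_segment.
have k2B s : `[0, 1]%classic s -> ball (k2 s).
  rewrite /= in_itv/= => /andP[s0 s1].
  rewrite /unit_ball /= enormN enormZ xi1 mulr1 ger0_norm ?mulr_ge0//.
  by apply: le_lt_trans T1; rewrite ler_piMl.
have k1M s : `[0, 1]%classic s -> enorm (k1 s - xi) <= q ^- M.
  rewrite /= in_itv/= => /andP[s0 s1].
  have -> : k1 s - xi = (1 - s) *: (x - xi) + s *: (y - xi).
    by apply/rowP => i; rewrite !mxE; ring.
  apply: le_trans (ler_enormD _ _) _; rewrite !enormZ !ger0_norm ?subr_ge0//.
  have -> : q ^- M = (1 - s) * q ^- M + s * q ^- M by ring.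
  by apply: lerD; apply: ler_wpM2l => //; rewrite subr_ge0.
have k2xi s : `[0, 1]%classic s -> 1 <= enorm (k2 s - xi).
  rewrite /= in_itv/= => /andP[s0 s1].
  have -> : k2 s - xi = - ((1 + s * T) *: xi) by rewrite scalerDl scale1r opprD addrC.
  have sT : 0 <= s * T by rewrite mulr_ge0.
  by rewrite enormN enormZ xi1 mulr1 ger0_norm ?lerDl// addr_ge0.
(* The family is chosen on the image side and pulled back by h. Its image under f is then exactly
   [Gam'], which contains the polygons needed for the lower bound. *)
pose Gam' : set (curve R n) := [set g | exists G L s t,
  [/\ g = Curve `[0, L] G, 0 <= L, 0 <= s <= 1, 0 <= t <= 1 &
   [/\ G 0 = f (k1 s), G L = f (k2 t), forall u, ball (G u) & forall J, {within J, continuous G}]]].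
pose Gam := curve_image h @` Gam'.
have q1 : 1 < q by rewrite /q ltrDl invr_gt0 mulr_gt0// ltr0n.
have imG : curve_image f @` Gam = Gam'.
  rewrite /Gam image_comp; apply/seteqP; split => [_ [g Gg <-]|g Gg]; last first.
    exists g => //; move: Gg => [G [L [s [t [-> _ _ _ [_ _ GB _]]]]]].
    by rewrite /curve_image /=; congr Curve; apply/funext => u /=; rewrite fh.
  move: (Gg) => [G [L [s [t [gE _ _ _ [_ _ GB _]]]]]].
  suff -> : (curve_image f \o curve_image h) g = g by [].
  by rewrite gE /curve_image /=; congr Curve; apply/funext => u /=; rewrite fh.
have GamP g : Gam g -> [/\ curve_in ball g, forall t, ball (curve_map g t) &
    exists a b, [/\ a \in curve_dom g, b \in curve_dom g, a <= b,
      enorm (curve_map g a - xi) <= q ^- M & 1 <= enorm (curve_map g b - xi)]].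
  move=> [_ [G [L [s [t [-> L0 s01 t01 [G0 GL GB cG]]]]]] <-].
  have s01' : `[0, 1]%classic s by rewrite /= in_itv.
  have t01' : `[0, 1]%classic t by rewrite /= in_itv.
  split => /=; first last.
  - exists 0, L; rewrite /= !in_itv/= !lexx L0; split => //.
      by rewrite G0 hf; [exact: k1M|exact: k1B].
    by rewrite GL hf; [exact: k2xi|exact: k2B].
  - by move=> u; apply: hB.
  split => /=.
  - by exists 0; rewrite /= in_itv/= lexx.
  - apply/within_continuous_pathP => u uL a a0.
    have /within_continuous_enormP/(_ _ (GB u) a a0)[d d0 H] := ch.
    have /within_continuous_pathP/(_ u uL d d0)[d' d'0 H'] := cG [set` `[0, L]].
    by exists d' => // v vL uv /=; apply: H => //; exact: H'.
  - by move=> _ [u _ <-]; apply: hB.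
have up : (modulus Gam <= (2^-1 * om * M%:R / (M%:R * (q - 1)) ^+ n)%:E)%E.
  by apply: (@modulus_ring_upper _ _ q (q ^- M) M xi Gam) => // g /GamP[].
have up' : (modulus Gam' <= (K * (2^-1 * om * M%:R / (M%:R * (q - 1)) ^+ n))%:E)%E.
  rewrite -imG EFinM; apply: le_trans (modK _) _ => [g /GamP[]//|].
  by apply: lee_wpmul2l => //; rewrite lee_fin (le_trans _ K1).
have qn0 : 0 < (q - 1) ^+ n by rewrite exprn_gt0// subr_gt0.
have Nn0 : 0 < N%:R ^+ n.-1 :> R by rewrite exprn_gt0// ltr0n.
have Mn0 : 0 < M%:R ^+ n.-1 :> R by rewrite exprn_gt0// ltr0n.
have lo : (((om / 4) / ((q - 1) ^+ n * N%:R ^+ n.-1))%:E <= modulus Gam')%E.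
  apply: le_ereal_inf_tmp => _ [rho [mrho rho0 adm] <-].
  rewrite mulrC EFinM lee_pdivrMl ?mulr_gt0//.
  apply: (@lower N (f x) (f \o k1) (f \o k2)) => //.
  - exact: fB.
  - exact/path_continuous/line_cont.
  - apply: path_continuous => //.
    have -> : k2 = (fun s => 0 + s *: (- (T *: xi))).
      by apply/funext => s; rewrite /k2 add0r scalerN scalerA.
    exact: line_cont.
  - by rewrite /k1 /= scale0r addr0.
  - by rewrite /k2 /= mul0r scale0r oppr0.
  - by rewrite /k1 /= scale1r (addrC x) subrK.
  - by rewrite /k2 /= mul1r.
  move=> s t z z' s01 t01 zB z'B.
  have s01' : `[0, 1]%classic s by rewrite /= in_itv.
  have t01' : `[0, 1]%classic t by rewrite /= in_itv.
  have [G [L [L0 G0 GL [GB cG Grect] Gint]]] :=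
    polygonal_curve n0 (fB (k1B s s01')) zB z'B (fB (k2B t t01')).
  rewrite [X in (_ + (_ + X))%E](segment_integralC mrho rho0).
  apply: le_trans (Gint rho mrho rho0); apply: adm => //.
  by exists G, L, s, t.
have := le_trans lo up'; rewrite lee_fin => main.
have om0 : 0 < om by exact: lebesgue_shell_gt0.
move: main; rewrite ler_pdivrMr ?mulr_gt0//.
have -> : K * (2^-1 * om * M%:R / (M%:R * (q - 1)) ^+ n) * ((q - 1) ^+ n * N%:R ^+ n.-1) =
   om / 4 * (2 * K * N%:R ^+ n.-1 / M%:R ^+ n.-1).
  have M1 : M%:R != 0 :> R by rewrite pnatr_eq0 -lt0n.
  have M2 : M%:R ^+ n.-1 != 0 :> R by rewrite gt_eqF.
  rewrite exprMn -[in M%:R ^+ n](prednK n0) exprS; field.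
  by rewrite M1 M2 gt_eqF.
rewrite -[X in X <= _]mulr1 ler_pM2l ?divr_gt0// ler_pdivlMr// mul1r.
by rewrite leNgt KMN.
Qed.

Let q1 : 1 < q. Proof. by rewrite /q ltrDl invr_gt0 mulr_gt0// ltr0n. Qed.
Let q0 : 0 < q. Proof. exact: lt_trans q1. Qed.

Let geometric_scale (r : R) : 0 < r -> r < 1 -> exists M, q ^- M.+1 < r /\ r <= q ^- M.
Proof.
move=> r0 r1; have [k kr] : exists k, q ^- k < r.
  exists (Num.bound (r^-1 / (q - 1))); set k := Num.bound _.
  have qk : r^-1 < k%:R * (q - 1).
    rewrite -ltr_pdivrMr ?subr_gt0//; apply: archi_boundP.
    by apply: divr_ge0; rewrite ?invr_ge0 ?subr_ge0 ltW.
  rewrite invf_plt ?posrE ?exprn_gt0//; apply: lt_le_trans qk _.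
  by apply: le_trans (bernoulli k (ltW q0)); rewrite lerDr.
have ex : exists k, q ^- k < r by exists k.
case: (ex_minnP ex) => -[|M] Mr min; first by move: Mr; rewrite expr0 invr1 ltNge (ltW r1).
by exists M; split => //; rewrite leNgt; apply/negP => /min; rewrite ltnn.
Qed.

(** Let q^-(M+1) < r <= q^-M, and let N + 1 be the least integer not below M a, with a = 1 / (2 k).
    Then N < M a gives 2 k N < M for [distortion_step], while N + 1 >= M a makes q^-N comparable to
    r^a. The exponent lost is at most 2, or N0 + 2 when M a is too small and the diameter 2 of the
    ball is used instead; [N0.+3] covers both. *)
Lemma boundary_distortion (xi x y : 'rV[R]_n) (r : R) : enorm xi = 1 -> ball x -> ball y ->
  0 < r -> enorm (x - xi) <= r -> enorm (y - xi) <= r ->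
  enorm (f y - f x) <= 2 * q ^+ N0.+3 * r `^ (1 / K `^ (1 / n.-1%:R) / 2).
Proof.
move=> xi1 xB yB r0 xr yr; set k := K `^ _; set a := _ / 2.
have n1 : 0 < n.-1%:R :> R by rewrite ltr0n -ltnS prednK.
have k1 : 1 <= k by rewrite -[leLHS](powRr0 K) ler_powR// divr_ge0// ltW.
have k0 : 0 < k by exact: lt_le_trans k1.
have kK : k ^+ n.-1 = K.
  rewrite -powR_mulrn; last exact: ltW.
  by rewrite /k -powRrM div1r mulVf ?gt_eqF// powRr1// (le_trans _ K1).
have a0 : 0 < a by rewrite !divr_gt0.
have a1 : a <= 1 by rewrite /a ler_pdivrMr// ler_pdivrMr//; lra.
have d2 : enorm (f y - f x) <= 2.
  have := ler_enormB (f y) (f x); have := fB xB; have := fB yB.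
  rewrite /unit_ball /=; lra.
have qN : 1 <= q ^+ N0.+3 by rewrite exprn_ege1// ltW.
have [r1|r1] := leP 1 r.
  have : 1 <= r `^ a by rewrite -[leLHS](powRr0 r) ler_powR// ltW.
  by move=> ra; apply: le_trans d2 _; rewrite -mulrA ler_peMr// mulr_ege1.
have [M [Mr rM]] := geometric_scale r0 r1.
have qpow (c : R) (m : nat) : (q ^- m) `^ c = q `^ (- (m%:R * c)).
  by rewrite -powR_mulrn ?(ltW q0)// -powRN -powRrM mulNr.
(* From here on only powers of q are compared. *)
have ra : q `^ (- (M.+1%:R * a)) <= r `^ a.
  rewrite -qpow; apply: ge0_ler_powR; rewrite ?nnegrE ?(ltW a0) ?(ltW r0) ?(ltW Mr)//.
  by rewrite invr_ge0 exprn_ge0// ltW.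
have qnn m : q ^- m = q `^ (- m%:R) by rewrite -(powRr1 (_ : 0 <= q ^- m)) ?qpow ?mulr1// invr_ge0 exprn_ge0// ltW.
have fin (b : R) : b + M.+1%:R * a <= N0.+3%:R -> 2 * q `^ b <= 2 * q ^+ N0.+3 * r `^ a.
  move=> bM; rewrite -mulrA ler_pM2l//.
  apply: le_trans (ler_wpM2l _ ra); last by rewrite exprn_ge0// ltW.
  rewrite -powR_mulrn ?(ltW q0)// -powRD ?(gt_eqF q0) ?implybT//.
  by apply: ler_powR; [exact: ltW|lra].
have [MN|MN] := leP (M%:R * a) N0.+1%:R.
  apply: le_trans d2 (le_trans _ (fin 0 _)); first by rewrite powRr0 mulr1.
  by move: MN; rewrite add0r -!natr1; lra.
have exm : exists m : nat, M%:R * a <= m%:R.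
  by exists (Num.bound (M%:R * a)); apply: ltW; apply: archi_boundP; rewrite mulr_ge0// ltW.
case: (ex_minnP exm) => -[|N] Nm min.
  by have := lt_le_trans MN Nm; rewrite ltr_nat.
have NN0 : (N0.+1 <= N)%N by have := lt_le_trans MN Nm; rewrite ltr_nat ltnS.
have NM : N%:R < M%:R * a by rewrite ltNge; apply/negP => /min; rewrite ltnn.
have M0 : (0 < M)%N.
  by rewrite lt0n; apply/eqP => M0; move: NM; rewrite M0 mul0r ltNge ler0n.
have KMN : 2 * K * N%:R ^+ n.-1 < M%:R ^+ n.-1.
  (* 2 K <= (2 K^(1/(n-1)))^(n-1): this factor 2 is the one of alpha / 2. *)
  have h1 : 2 * k * N%:R < M%:R.
    have : (2 * k) * N%:R < (2 * k) * (M%:R * a) by rewrite ltr_pM2l// mulr_gt0.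
    suff -> : 2 * k * (M%:R * a) = M%:R by [].
    by rewrite /a; field; rewrite gt_eqF.
  have h2 : (2 * k * N%:R) ^+ n.-1 < M%:R ^+ n.-1.
    rewrite ltrXn2r ?nnegrE ?mulr_ge0 ?(ltW k0)//.
    by rewrite -lt0n -ltnS prednK.
  apply: le_lt_trans h2; rewrite !exprMn kK ler_wpM2r ?exprn_ge0// ler_wpM2r ?(le_trans _ K1)//.
  by case: (n.-1) n1 => [|m _]; [rewrite ltxx|rewrite exprS ler_peMr// exprn_ege1//; lra].
have Np : (0 < N)%N by exact: leq_trans NN0.
have := distortion_step M0 Np (ltnW NN0) KMN xi1 xB yB (le_trans xr rM) (le_trans yr rM).
move=> /ltW/le_trans; apply.
apply: (@le_trans _ _ (2 * q `^ (- N%:R))).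
  rewrite qnn ler_wpM2r ?powR_ge0//; have /andP[_ e1] := e01.
  by lra.
apply: fin; move: Nm; rewrite -!natr1 => Nm.
have := ler0n R N0; lra.
Qed.

End distortion.

(** * Extension to the closed ball *)

Section boundary_extension.
Context {R : realType} {n : nat}.
Local Notation ball := (@unit_ball R n).
Local Notation cball := (@closed_unit_ball R n).
Variables (C a : R).
Hypotheses (C0 : 0 < C) (a0 : 0 < a).

Let powR_small (d e : R) : 0 < d -> 0 < e -> exists r, [/\ 0 < r, r <= e & C * r `^ a <= d].
Proof.
move=> d0 e0; pose s := (d / C) `^ a^-1.
have s0 : 0 < s by rewrite powR_gt0// divr_gt0.
have sa : s `^ a = d / C by rewrite -powRrM mulVf ?gt_eqF// powRr1// divr_ge0 ?ltW.
exists (Num.min s e); split; first by rewrite lt_min s0.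
  by rewrite ge_min lexx orbT.
rewrite mulrC -ler_pdivlMr// -sa; apply: ge0_ler_powR; rewrite ?nnegrE ?(ltW a0) ?(ltW s0)//.
  by rewrite le_min !ltW.
by rewrite ge_min lexx.
Qed.

Let near_sphere (xi : 'rV[R]_n) r : enorm xi = 1 -> 0 < r ->
  exists2 z, ball z & enorm (z - xi) <= r.
Proof.
move=> xi1 r0; pose t := r / (1 + r).
have r1 : 0 < 1 + r by rewrite addr_gt0.
have t0 : 0 < t by rewrite divr_gt0.
have t1 : t < 1 by rewrite ltr_pdivrMr// mul1r ltrDr.
exists ((1 - t) *: xi).
  by rewrite /unit_ball /= enormZ xi1 mulr1 ger0_norm ?subr_ge0 ?(ltW t1)// ltrBlDr ltrDl.
rewrite scalerBl scale1r addrAC subrr add0r enormN enormZ xi1 mulr1 gtr0_norm//.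
by rewrite /t ler_pdivrMr// ler_peMr// ?lerDl ltW.
Qed.

Definition holder_at_boundary (f : 'rV[R]_n -> 'rV[R]_n) := forall xi x y r, enorm xi = 1 ->
  ball x -> ball y -> 0 < r -> enorm (x - xi) <= r -> enorm (y - xi) <= r ->
  enorm (f y - f x) <= C * r `^ a.

Definition boundary_extension (f F : 'rV[R]_n -> 'rV[R]_n) :=
  (forall x, ball x -> F x = f x) /\
  (forall xi x r, enorm xi = 1 -> ball x -> 0 < r -> enorm (x - xi) <= r ->
    enorm (f x - F xi) <= C * r `^ a).

(** The value at a boundary point is the limit along its radius, a Cauchy sequence by the estimate
    itself, which then passes to the limit. *)
Lemma exists_boundary_extension f : holder_at_boundary f -> exists F, boundary_extension f F.
Proof.
move=> fH.
suff /choice[F FP] : forall p, exists l, (ball p -> l = f p) /\ (enorm p = 1 ->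
    forall x r, ball x -> 0 < r -> enorm (x - p) <= r -> enorm (f x - l) <= C * r `^ a).
  exists F; split; first by move=> x xB; have [/(_ xB)] := FP x.
  by move=> xi x r xi1 xB r0 xr; have [_ /(_ xi1 x r xB r0 xr)] := FP xi.
move=> p; have [p1|p1] := eqVneq (enorm p) 1; last first.
  by exists (f p); split => // p1'; rewrite p1' eqxx in p1.
pose u (k : nat) := f ((1 - k.+2%:R^-1) *: p).
have k1 (k : nat) : 0 < (k.+2%:R^-1 : R) < 1.
  by rewrite invr_gt0 ltr0n/= invf_lt1// ltr1n.
have uB k : ball ((1 - k.+2%:R^-1) *: p).
  have /andP[ka kb] := k1 k; rewrite /unit_ball /= enormZ p1 mulr1 ger0_norm.
    by rewrite gtrBl.
  by rewrite subr_ge0 ltW.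
have up k : enorm ((1 - k.+2%:R^-1) *: p - p) = k.+2%:R^-1.
  rewrite scalerBl scale1r addrAC subrr add0r enormN enormZ p1 mulr1 gtr0_norm//.
have small (r : R) : 0 < r -> \forall k \near \oo, enorm ((1 - k.+2%:R^-1) *: p - p) <= r.
  move=> r0; exists (Num.bound r^-1) => // k /= rk; rewrite up.
  rewrite invf_ple ?posrE//; apply: ltW; apply: lt_le_trans (archi_boundP _) _.
    by rewrite invr_ge0 ltW.
  by rewrite ler_nat; apply: leq_trans rk _; rewrite -addn2 leq_addr.
have cu : cvg (u @ \oo).
  apply/cauchy_cvgP/cauchy_exP => e e0.
  have [r [r0 _ re]] := @powR_small (e / 2) 1 (divr_gt0 e0 (ltr0n _ 2)) ltr01.
  have [k0 _ k0P] := small r r0.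
  exists (u k0), k0 => // k /= kk; rewrite -ball_normE /=.
  apply: le_lt_trans (normr_le_enorm _) _.
  apply: le_lt_trans (fH _ _ _ _ p1 (uB k) (uB k0) r0 _ _) _; [exact: (k0P k kk)|exact: (k0P k0 (leqnn k0))|].
  by apply: le_lt_trans re _; lra.
exists (lim (u @ \oo)); split.
  by rewrite /unit_ball /= p1 ltxx.
move=> _ x r xB r0 xr; apply/ler_addgt0Pr => e e0.
have /cvg_enorm/(_ e e0)[k0 _ k0P] := cu.
have [k1' _ k1P] := small r r0.
pose k := maxn k0 k1'.
apply: le_trans (ler_enorm_sub (u k) _ _) _; apply: lerD.
  by apply: (fH p _ _ _ p1) => //; apply: k1P; rewrite /= leq_maxr.
by rewrite enormBC; apply/ltW/k0P; rewrite /= leq_maxl.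
Qed.

Variables (f F : 'rV[R]_n -> 'rV[R]_n).
Hypotheses (cf : {within ball, continuous f}) (fB : forall x, ball x -> ball (f x))
  (FE : boundary_extension f F).

Let F_in x : ball x -> F x = f x. Proof. exact: FE.1. Qed.

Let cball_cases x : cball x -> ball x \/ enorm x = 1.
Proof. by rewrite /closed_unit_ball /= le_eqVlt => /orP[/eqP|]; [right|left]. Qed.

Lemma boundary_extension_closed x : cball x -> cball (F x).
Proof.
move=> /cball_cases[xB|x1].
  by rewrite F_in//; exact/ltW/fB.
rewrite /closed_unit_ball /=; apply/ler_addgt0Pr => e e0.
have [r [r0 _ re]] := @powR_small e 1 e0 ltr01.
have [z zB zx] := near_sphere x1 r0.
have h := FE.2 x z r x1 zB r0 zx.
have fz : enorm (f z) < 1 by exact: fB.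
have := ler_enormB (f z) (f z - F x); rewrite subKr; lra.
Qed.

(** Near a boundary point x, another boundary point y is compared through a ball point z close to y:
    the estimate at y controls F y - F z, and the one at x controls F z - F x. *)
Lemma boundary_extension_continuous : {within cball, continuous F}.
Proof.
apply/within_continuous_enormP => x /cball_cases[xB|x1] e e0.
  have /within_continuous_enormP/(_ x xB e e0)[d d0 H] := cf.
  exists (Num.min d (1 - enorm x)); first by rewrite lt_min d0 subr_gt0.
  move=> y _; rewrite lt_min => /andP[yd yx].
  have yB : ball y.
    rewrite /unit_ball /=; have := ler_enormB x (x - y); rewrite subKr; lra.
  by rewrite !F_in//; exact: H.
have e4 : 0 < e / 4 by rewrite divr_gt0.
have [r [r0 _ re]] := @powR_small (e / 4) 1 e4 ltr01.
have near z : ball z -> enorm (z - x) <= r -> enorm (F x - F z) <= e / 4.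
  move=> zB zx; rewrite enormBC (F_in zB); apply: le_trans re; exact: FE.2.
exists (r / 2); first by rewrite divr_gt0.
move=> y /cball_cases[yB|y1] xy.
  apply: le_lt_trans (near _ yB _) _; first by rewrite enormBC; lra.
  by lra.
have [z zB zy] := near_sphere y1 (divr_gt0 r0 (ltr0n _ 2)).
have zx : enorm (z - x) <= r.
  apply: le_trans (ler_enorm_sub y _ _) _; rewrite (enormBC y x); lra.
have h1 := near z zB zx.
have zy' : enorm (z - y) <= r by lra.
have := FE.2 y z r y1 zB r0 zy'; rewrite -(F_in zB) => h2.
apply: le_lt_trans (ler_enorm_sub (F z) _ _) _; lra.
Qed.

(** On the sphere this follows by approximation: for z in the ball close to x, f z is close to F x,
    hence z = H (f z) is close to H (F x). *)
Lemma boundary_extension_cancel (h H : 'rV[R]_n -> 'rV[R]_n) :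
  {within cball, continuous H} -> (forall x, ball x -> H x = h x) ->
  (forall x, ball x -> h (f x) = x) -> forall x, cball x -> H (F x) = x.
Proof.
move=> /within_continuous_enormP cH HE hf x /[dup] xc /cball_cases[xB|x1].
  by rewrite F_in// HE ?hf//; exact: fB.
apply/eqP; rewrite -subr_eq0 -enorm_eq0 eq_le enorm_ge0 andbT.
apply/ler_addgt0Pr => e e0; rewrite add0r.
have e2 : 0 < e / 2 by rewrite divr_gt0.
have [d d0 Hd] := cH _ (boundary_extension_closed xc) _ e2.
have [r [r0 re rd]] := @powR_small (d / 2) (e / 2) (divr_gt0 d0 (ltr0n _ 2)) e2.
have [z zB zx] := near_sphere x1 r0.
have fzB := fB zB.
have Fz : enorm (F x - f z) < d.
  by rewrite enormBC; have := FE.2 x z r x1 zB r0 zx; lra.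
have := Hd (f z) (ltW fzB) Fz; rewrite (HE _ fzB) (hf _ zB) => h1.
apply: le_trans (ler_enorm_sub z _ _) _; lra.
Qed.

End boundary_extension.

Theorem theorem5p7 (R : realType) (n : nat) (hn : (2 <= n)%N) :
  exists C : R, forall (K : R) (f : 'rV[R]_n -> 'rV[R]_n),
    1 <= K ->
    quasiconformal K (@unit_ball R n) (@unit_ball R n) f ->
    f 0 = 0 ->
    let alpha := 1 / (K `^ (1 / (n.-1)%:R)) in
    exists F : 'rV[R]_n -> 'rV[R]_n,
      [/\ homeomorphism_on (@closed_unit_ball R n) (@closed_unit_ball R n) F,
          forall x, unit_ball x -> F x = f x &
          forall x xi, unit_ball x -> unit_sphere xi ->
            enorm (f x - F xi) <= C * enorm (x - xi) `^ (alpha / 2)].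
Proof.
have n0 : (0 < n)%N by apply: leq_trans hn.
have [e [N0 [e01 lower]]] := @polygon_density_lower R n hn.
pose q : R := 1 + (4 * n%:R)^-1.
have q0 : 0 < q by rewrite addr_gt0// invr_gt0 mulr_gt0// ltr0n.
pose C := 2 * q ^+ N0.+3; have C0 : 0 < C by rewrite mulr_gt0// exprn_gt0.
(* C is built from q and N0, which were fixed before K and f are introduced. *)
exists C => K f K1 [_ _ [fbij cf [h [hf ch]]] mod] f0 alpha.
pose B := @unit_ball R n.
have K0 : 0 < K by exact: lt_le_trans K1.
have alpha0 : 0 < alpha / 2 by rewrite !divr_gt0// powR_gt0.
have fB x : B x -> B (f x) by move=> Bx; case: fbij => h1 _ _; apply: h1.
have hf' x : B x -> h (f x) = x by move=> Bx; apply: hf; rewrite inE.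
have fsurj y : B y -> exists2 x, B x & f x = y by case: fbij => _ _; exact.
have hB y : B y -> B (h y) by move=> /fsurj[x Bx <-]; rewrite hf'.
have fh y : B y -> f (h y) = y by move=> /fsurj[x Bx <-]; rewrite hf'.
have h0 : h 0 = 0 by rewrite -[in LHS]f0 hf'// /B /unit_ball /= enorm0.
have hom_f : holder_at_boundary C (alpha / 2) f.
  move=> xi x y r; apply: (@boundary_distortion R n K f h hn K1 cf ch fB hB hf' fh f0 _ e N0 e01 lower).
  by move=> Gam GB; apply: (mod Gam _).2 => g /GB[].
(* For the inverse, the left inequality of quasiconformality is applied to h(Gam): f maps this
   family back to Gam, so its modulus is at most K times that of Gam. *)
have hom_h : holder_at_boundary C (alpha / 2) h.
  move=> xi x y r; apply: (@boundary_distortion R n K h f hn K1 ch cf hB fB fh hf' h0 _ e N0 e01 lower).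
  move=> Gam GB.
  have GhB : curve_image h @` Gam `<=` curve_in B.
    move=> _ [g /GB[[J0 cg gB] gT] <-]; split => //=.
      apply/within_continuous_pathP => t tJ a a0.
      have /within_continuous_enormP/(_ _ (gT t) a a0)[d d0 H] := ch.
      have /within_continuous_pathP/(_ t tJ d d0)[d' d'0 H'] := cg.
      by exists d' => // u uJ tu; apply: H; [exact: gT|exact: H'].
    by move=> _ [t _ <-]; apply: hB; exact: gT.
  have [+ _] := mod _ GhB.
  have -> : curve_image f @` (curve_image h @` Gam) = Gam.
    rewrite image_comp; have fhg g : Gam g -> (curve_image f \o curve_image h) g = g.
      case: g => J g /GB[_ gT]; rewrite /= /curve_image/=; congr Curve.
      by apply/funext => t /=; rewrite fh//; exact: gT.
    apply/seteqP; split => [_ [g Gg <-]|g Gg]; first by rewrite fhg.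
    by exists g => //; exact: fhg.
  by rewrite muleC lee_pdivrMr// muleC.
have [F FE] := exists_boundary_extension C0 alpha0 hom_f.
have [H HE] := exists_boundary_extension C0 alpha0 hom_h.
have cF := boundary_extension_continuous C0 alpha0 cf FE.
have cH := boundary_extension_continuous C0 alpha0 ch HE.
have FB := boundary_extension_closed C0 alpha0 fB FE.
have HB := boundary_extension_closed C0 alpha0 hB HE.
have HF := boundary_extension_cancel C0 alpha0 fB FE cH HE.1 hf'.
have FH := boundary_extension_cancel C0 alpha0 hB HE cF FE.1 fh.
exists F; split; [split=> //; [split|exists H; split => //]|exact: FE.1|].
- by [].
- by move=> x y /set_mem xB /set_mem yB xy; rewrite -(HF x)// xy HF.
- by move=> y yB; exists (H y); [exact: HB|exact: FH].
- by move=> x /set_mem xB; exact: HF.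
(* The estimate is used with r = |x - xi|, which is positive because x is not on the sphere. *)
move=> x xi xB xi1; apply: FE.2 => //.
rewrite enorm_gt0 subr_eq0; apply/eqP => xxi.
by move: xB; rewrite /unit_ball /= xxi xi1 ltxx.
Qed.
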